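(* Let $X$ be a random variable in $\mathbb{R}^d$ with $X\in B(0,R)$ almost surely (where $R>0$) and $\mathbb{E}[X]=0$. There exists $T_0$ depending only on $\mathcal{L}(X)$ such that the following holds for all $T\ge T_0$. Let $\epsilon>0$ and $N\ge 1$ be such that $T>\epsilon$ and $h=\frac{T-\epsilon}{N}$ satisfies $h\le \epsilon\le R^2$. Let $\hat X=\hat X_N$ be the output of the Euler–Maruyama sampler with exact score: $\hat X_0\sim\mathcal{N}(0,TI)$ and, for $n=1,\dots,N$, with $t_n=nh$, $$\hat X_n=\hat X_{n-1}+h\,\nabla\log p_{T-t_{n-1}}(\hat X_{n-1})+Z_n,$$ where $Z_1,\dots,Z_N\sim\mathcal{N}(0,hI)$ are independent and independent of $\hat X_0$. Then $$W_2(\mathcal{L}(X),\mathcal{L}(\hat X))\le \sqrt{d\epsilon}+\frac{2\epsilon}{T^{3/2}}\exp\left(\frac{R^2}{\epsilon}\right)R^2+\sqrt{\frac{2d}{3}}\,\frac{R^2}{\epsilon^{3/2}}\exp\left(\frac{R^2}{\epsilon}\right)h.$$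
   Context: $B(0,R)$ is the closed Euclidean ball; $\mathcal{L}(Y)$ is the law of $Y$; $W_2$ is the Wasserstein-2 distance on $\mathbb{R}^d$ for the Euclidean norm. Forward process: $X_t=X+B_t$, with $B$ a standard Brownian motion in $\mathbb{R}^d$ independent of $X$ (so $B_t\sim\mathcal{N}(0,tI)$); $p_t$ is the density of $X_t$, $t>0$. *)

(* Defs.v *)
From HB Require Import structures.
From mathcomp Require Import all_boot all_order all_algebra.
From mathcomp Require Import all_classical all_reals all_analysis.

Set Implicit Arguments.
Unset Strict Implicit.
Unset Printing Implicit Defensive.

Import Order.TTheory GRing.Theory Num.Theory.
Import numFieldNormedType.Exports.

Local Open Scope classical_set_scope.
Local Open Scope ring_scope.

(* R^d is 'rV[R]_d with the product of the Borel sigma-algebras, i.e. its own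
   Borel sigma-algebra. *)
Definition row_display : measure_display.
Proof. exact: default_measure_display. Qed.

Section measurable_row.
Context {R : realType} (d : nat).

Let coord : 'I_d -> 'rV[R]_d -> measurableTypeR R := fun i x => x ord0 i.

Let row_set0 : g_sigma_preimage coord set0.
Proof. exact: sigma_algebra0. Qed.

Let row_setC A : g_sigma_preimage coord A -> g_sigma_preimage coord (~` A).
Proof. exact: sigma_algebraC. Qed.

Let row_bigcup (F : _^nat) : (forall i, g_sigma_preimage coord (F i)) ->
  g_sigma_preimage coord (\bigcup_i (F i)).
Proof. exact: sigma_algebra_bigcup. Qed.

HB.instance Definition _ := @isMeasurable.Build row_display 'rV[R]_d
  (g_sigma_preimage coord) row_set0 row_setC row_bigcup.

End measurable_row.

(* The type carries the library's sup norm; this is the Euclidean one. *)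
Definition enorm (R : realType) (d : nat) (x : 'rV[R]_d) : R :=
  Num.sqrt (\sum_(i < d) x ord0 i ^+ 2).

Definition grad (R : realType) (d : nat) (f : 'rV[R]_d -> R) (x : 'rV[R]_d) :
  'rV[R]_d := \row_(i < d) 'D_(delta_mx ord0 i) f x.

Definition cons_row (R : realType) (d : nat) (z : measurableTypeR R * 'rV[R]_d) :
  'rV[R]_d.+1 := row_mx (z.1)%:M z.2.

(* The d-fold product of m with itself. *)
Fixpoint measure_power (R : realType) (m : set (measurableTypeR R) -> \bar R)
    (d : nat) : set 'rV[R]_d -> \bar R :=
  match d with
  | 0%N => \d_(0 : 'rV[R]_0)
  | d'.+1 => pushforward (m \x @measure_power R m d')%E (@cons_row R d')
  end.
Arguments measure_power {R} m d.

Definition lebesgue_row (R : realType) (d : nat) : set 'rV[R]_d -> \bar R :=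
  measure_power (@lebesgue_measure R) d.
Arguments lebesgue_row : clear implicits.

(* N(0, s I); [normal_prob] is parametrized by the standard deviation. *)
Definition gaussian (R : realType) (d : nat) (s : R) : set 'rV[R]_d -> \bar R :=
  measure_power (normal_prob 0 (Num.sqrt s)) d.
Arguments gaussian {R} d s.

Section probability.
Context {dO : measure_display} {Omega : measurableType dO} {R : realType}
  (P : probability Omega R).

Definition has_law (d : nat) (Y : Omega -> 'rV[R]_d)
    (mu : set 'rV[R]_d -> \bar R) : Prop :=
  forall A, measurable A -> P (Y @^-1` A) = mu A.

Definition has_density (d : nat) (Y : Omega -> 'rV[R]_d) (f : 'rV[R]_d -> R) :
  Prop :=
  [/\ forall x, 0 <= f x, measurable_fun setT f &
      has_law Y (fun A => \int[lebesgue_row R d]_(x in A) (f x)%:E)%E].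

(* Taking some A n to be setT gives the product rule for all subfamilies. *)
Definition mutually_independent (d N : nat) (Y : nat -> Omega -> 'rV[R]_d) :
  Prop :=
  forall A : nat -> set 'rV[R]_d, (forall n, measurable (A n)) ->
    (P (\bigcap_(n in `I_N) Y n @^-1` A n) = \prod_(n < N) P (Y n @^-1` A n))%E.

Definition brownian_motion (d : nat) (B : R -> {RV P >-> 'rV[R]_d}) : Prop :=
  [/\ {ae P, forall w, B 0 w = 0},
      forall (n : nat) (t : nat -> R),
        0 <= t 0%N -> {homo t : i j / (i <= j)%N >-> i <= j} ->
        mutually_independent n (fun i w => B (t i.+1) w - B (t i) w),
      forall s t : R, 0 <= s -> s < t ->
        has_law (fun w => B t w - B s w) (gaussian d (t - s)) &
      {ae P, forall w, {within `[0, +oo[, continuous (fun t => B t w)}}].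

(* Independence of X from the sigma-algebra of (B_t)_{t >= 0}, tested on the
   finite-dimensional cylinders, which form a generating pi-system. *)
Definition independent_of_process (d : nat) (X : {RV P >-> 'rV[R]_d})
    (B : R -> {RV P >-> 'rV[R]_d}) : Prop :=
  forall (A : set 'rV[R]_d) (n : nat) (t : 'I_n -> R)
      (C : 'I_n -> set 'rV[R]_d),
    measurable A -> (forall i, 0 <= t i) -> (forall i, measurable (C i)) ->
    (P (X @^-1` A `&` \bigcap_i (B (t i) @^-1` C i)) =
     P (X @^-1` A) * P (\bigcap_i (B (t i) @^-1` C i)))%E.

End probability.

Definition coupling (R : realType) (d : nat) (mu nu : set 'rV[R]_d -> \bar R)
    (g : probability ('rV[R]_d * 'rV[R]_d)%type R) : Prop :=
  (forall A, measurable A -> g (A `*` setT) = mu A) /\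
  (forall A, measurable A -> g (setT `*` A) = nu A).

Definition W2 (R : realType) (d : nat) (mu nu : set 'rV[R]_d -> \bar R) :
  \bar R :=
  ereal_inf [set ((\int[g]_z (enorm (z.1 - z.2) ^+ 2)%:E) `^ 2^-1)%E |
              g in coupling mu nu].

(* Main.v *)
(** Put [U = Y_t / t] and [a = 1 / t]. The noisy input [Y_t = X + B_t] becomes the
    localization process [U = a X + W_a], and with the posterior mean
    [m_a U = E(X | U)] the score is [(m_(1/t) (y/t) - y) / t]. Hence, up to a factor
    [u], an Euler step from noise level [s] to [u = s - h] is a step of this process
    from [1/s] to [1/u] with its drift frozen at [m_(1/s)].

    Cutting that step into many substeps, each of which draws a sample from the
    current posterior, couples the exact step with a Gaussian of the right law. The
    drift error is centered, and its second moment is at most [3/4 r^4 A^3] with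
    [A = 1/u - 1/s], because the mean square displacement of the posterior mean grows
    at rate at most [r^4] ([m_a] is [r^2]-Lipschitz and [|X| <= r]). The Euler map has
    Lipschitz constant at most [(u/s) exp(r^2 (1/u - 1/s))], so the squared errors,
    weighted by [(eps/t)^2 exp(2 r^2 (1/eps - 1/t))], add up to telescoping sums.
    Starting the sampler at [N(0, T I)] is a localization step from signal strength
    [0] to [1/T], and a final posterior draw replaces [Y_eps] by [X] at the cost
    [sqrt (d eps)]. *)

Require Import Defs.
From HB Require Import structures.
From mathcomp Require Import all_boot all_order all_algebra.
From mathcomp Require Import all_classical all_reals all_analysis.
From mathcomp Require Import measurable_realfun ring lra.

Set Implicit Arguments.
Unset Strict Implicit.
Unset Printing Implicit Defensive.

Import Order.TTheory GRing.Theory Num.Theory.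
Import numFieldNormedType.Exports.

Local Open Scope classical_set_scope.
Local Open Scope ring_scope.

(** * Euclidean structure on rows *)

Section measurable_rows.
Context {R : realType} {d : nat}.
Local Notation V := 'rV[R]_d.

(** No stochastic calculus is used: a localization step is a finite chain on an explicit product
    space, and its law is carried by a density [w] against reference noise, not by the solution of
    an equation. As the number of substeps grows the error bound tends to [r^4 A^3 / 2]; the gap
    between 1/2 and 3/4 lets the chain stop at a finite length, so no limit of couplings is taken.

    Centering gives the order in [h]. The cross term between the present discrepancy and the new
    error integrates to zero, so a step adds an error of order [h^3] to the squared distance, hence
    [h^2] over all steps; adding the distances themselves would only give order [sqrt h].

    Rescaled by [u], the exact step carries noise of variance [u h / s], whereas the sampler noise
    has variance [h]. Both use the same Gaussian with different factors, and this mismatch is the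
    source of the dimension in the last term of the bound.

    Signed integrals are avoided: centered quantities are shifted by a constant or split into
    positive and negative parts, so that Tonelli applies without integrability conditions. *)

Lemma measurable_coord (i : 'I_d) :
  measurable_fun setT (fun x : V => x ord0 i).
Proof.
move=> _ A mA; rewrite setTI.
apply: sub_sigma_algebra; rewrite -bigcup_seq/=; exists i.
  by rewrite /= mem_index_enum.
by exists A => //; rewrite setTI.
Qed.

(** The sets with measurable preimage under [f] form a sigma-algebra, and it contains the coordinate
    preimages that generate the one on rows. *)
Lemma measurable_rowP d1 (T : measurableType d1) (f : T -> V) :
  (forall i, measurable_fun setT (fun t => f t ord0 i)) -> measurable_fun setT f.
Proof.
move=> mf.
pose D := [set A | measurable (f @^-1` A)].
suff H : @measurable _ V `<=` D by move=> _ A mA; rewrite setTI; exact: H.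
apply: smallest_sub.
  split=> [|A DA|F DF]; rewrite /D/=.
  - by rewrite preimage_set0.
  - by rewrite setTD preimage_setC; exact: measurableC.
  - by rewrite preimage_bigcup; exact: bigcupT_measurable.
move=> A; rewrite -bigcup_seq => -[i _] [B mB <-]; rewrite /D/= setTI.
by have := mf i measurableT B mB; rewrite setTI.
Qed.

Context d1 (T : measurableType d1).
Implicit Types f g : T -> V.

Lemma measurable_fun_coord f (i : 'I_d) :
  measurable_fun setT f -> measurable_fun setT (fun t => f t ord0 i).
Proof. by move=> mf; apply: (measurableT_comp (measurable_coord i)). Qed.

Lemma measurable_rowD f g : measurable_fun setT f -> measurable_fun setT g ->
  measurable_fun setT (fun t => f t + g t).
Proof.
move=> mf mg; apply: measurable_rowP => i.
under eq_fun do rewrite mxE.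
by apply: measurable_funD; exact: measurable_fun_coord.
Qed.

Lemma measurable_rowN f : measurable_fun setT f ->
  measurable_fun setT (fun t => - f t).
Proof.
move=> mf; apply: measurable_rowP => i.
under eq_fun do rewrite mxE.
by apply: measurableT_comp => //; exact: measurable_fun_coord.
Qed.

Lemma measurable_rowB f g : measurable_fun setT f -> measurable_fun setT g ->
  measurable_fun setT (fun t => f t - g t).
Proof. by move=> mf mg; apply/measurable_rowD => //; exact: measurable_rowN. Qed.

Lemma measurable_rowZ (c : T -> R) f : measurable_fun setT c ->
  measurable_fun setT f -> measurable_fun setT (fun t => c t *: f t).
Proof.
move=> mc mf; apply: measurable_rowP => i.
under eq_fun do rewrite mxE.
by apply: measurable_funM => //; exact: measurable_fun_coord.
Qed.

End measurable_rows.

Section dot_product.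
Context {R : realType} {d : nat}.
Implicit Types (x y z : 'rV[R]_d) (c : R).

Definition dot x y : R := \sum_(i < d) x ord0 i * y ord0 i.

Definition nrm2 x : R := dot x x.

Lemma dotC x y : dot x y = dot y x.
Proof. by apply: eq_bigr => i _; rewrite mulrC. Qed.

Lemma dotDl x y z : dot (x + y) z = dot x z + dot y z.
Proof. by rewrite -big_split/=; apply: eq_bigr => i _; rewrite mxE mulrDl. Qed.

Lemma dotZl c x y : dot (c *: x) y = c * dot x y.
Proof. by rewrite mulr_sumr; apply: eq_bigr => i _; rewrite mxE mulrA. Qed.

Lemma dotNl x y : dot (- x) y = - dot x y.
Proof. by rewrite -scaleN1r dotZl mulN1r. Qed.

Lemma dotDr x y z : dot x (y + z) = dot x y + dot x z.
Proof. by rewrite !(dotC x) dotDl. Qed.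

Lemma dotZr c x y : dot x (c *: y) = c * dot x y.
Proof. by rewrite !(dotC x) dotZl. Qed.

Lemma dotNr x y : dot x (- y) = - dot x y.
Proof. by rewrite !(dotC x) dotNl. Qed.

Lemma dot0l x : dot 0 x = 0.
Proof. by rewrite -(scale0r x) dotZl mul0r. Qed.

Lemma dot0r x : dot x 0 = 0.
Proof. by rewrite dotC dot0l. Qed.

Definition dotE := (dotDl, dotDr, dotNl, dotNr, dotZl, dotZr, dot0l, dot0r).

Lemma nrm2_ge0 x : 0 <= nrm2 x.
Proof. by apply: sumr_ge0 => i _; rewrite -expr2 sqr_ge0. Qed.

Lemma nrm2D x y : nrm2 (x + y) = nrm2 x + 2 * dot x y + nrm2 y.
Proof. by rewrite /nrm2 !dotE (dotC y x); ring. Qed.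

Lemma nrm2Z c x : nrm2 (c *: x) = c ^+ 2 * nrm2 x.
Proof. by rewrite /nrm2 !dotE; ring. Qed.

Lemma nrm2N x : nrm2 (- x) = nrm2 x.
Proof. by rewrite /nrm2 !dotE opprK. Qed.

Lemma nrm2B x y : nrm2 (x - y) = nrm2 x - 2 * dot x y + nrm2 y.
Proof. by rewrite nrm2D nrm2N dotNr mulrN. Qed.

Lemma nrm2_eq0 x : nrm2 x = 0 -> x = 0.
Proof.
move=> /eqP; rewrite psumr_eq0; last by move=> i _; rewrite -expr2 sqr_ge0.
move=> /allP x0; apply/rowP => i; rewrite mxE; apply/eqP.
by have := x0 i (mem_index_enum _); rewrite /= mulf_eq0 orbb.
Qed.

Lemma nrm2_coord x i : x ord0 i ^+ 2 <= nrm2 x.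
Proof.
rewrite /nrm2 /dot (bigD1 i)//= -expr2 lerDl.
by apply: sumr_ge0 => j _; rewrite -expr2 sqr_ge0.
Qed.

(** Expansion of [0 <= nrm2 (c *: x - y)], divided by [c]. *)
Lemma dot_young c x y : 0 < c -> 2 * dot x y <= c * nrm2 x + c^-1 * nrm2 y.
Proof.
move=> c0; have := nrm2_ge0 (c *: x - y).
rewrite nrm2B nrm2Z dotZl => h.
have : 0 <= c^-1 * (c ^+ 2 * nrm2 x - 2 * (c * dot x y) + nrm2 y).
  by rewrite mulr_ge0// invr_ge0 ltW.
have -> : c^-1 * (c ^+ 2 * nrm2 x - 2 * (c * dot x y) + nrm2 y) =
  c * nrm2 x - 2 * dot x y + c^-1 * nrm2 y by field; rewrite gt_eqF.
lra.
Qed.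

Lemma nrm2D_young c x y : 0 < c ->
  nrm2 (x + y) <= (1 + c) * nrm2 x + (1 + c^-1) * nrm2 y.
Proof. by move=> c0; rewrite nrm2D; have := dot_young x y c0; lra. Qed.

(** Cauchy-Schwarz, from Young's inequality with the weight [e / c]; the cases where this weight
    degenerates are treated apart. *)
Lemma dot_le c e x y : 0 <= c -> 0 <= e -> nrm2 x <= c ^+ 2 ->
  nrm2 y <= e ^+ 2 -> dot x y <= c * e.
Proof.
move=> c0 e0 xc ye.
have [c_eq0|cn0] := eqVneq c 0.
  suff -> : x = 0 by rewrite dot0l c_eq0 mul0r.
  apply: nrm2_eq0; apply/eqP; rewrite eq_le nrm2_ge0 andbT.
  by rewrite c_eq0 expr0n in xc.
have [e_eq0|en0] := eqVneq e 0.
  suff -> : y = 0 by rewrite dot0r e_eq0 mulr0.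
  apply: nrm2_eq0; apply/eqP; rewrite eq_le nrm2_ge0 andbT.
  by rewrite e_eq0 expr0n in ye.
have cp : 0 < c by rewrite lt_neqAle eq_sym cn0.
have ep : 0 < e by rewrite lt_neqAle eq_sym en0.
have := @dot_young (e / c) x y (divr_gt0 ep cp).
have : e / c * nrm2 x <= e / c * c ^+ 2.
  by rewrite ler_wpM2l// ltW// divr_gt0.
have : (e / c)^-1 * nrm2 y <= (e / c)^-1 * e ^+ 2.
  by rewrite ler_wpM2l// invr_ge0 ltW// divr_gt0.
have -> : e / c * c ^+ 2 = e * c by field.
have -> : (e / c)^-1 * e ^+ 2 = e * c by field; apply/andP.
lra.
Qed.

Lemma normr_dot_le c e x y : 0 <= c -> 0 <= e -> nrm2 x <= c ^+ 2 ->
  nrm2 y <= e ^+ 2 -> `|dot x y| <= c * e.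
Proof.
move=> c0 e0 xc ye; rewrite ler_norml; apply/andP; split; last exact: dot_le.
by rewrite lerNl -dotNl dot_le// nrm2N.
Qed.

Lemma enormE x : enorm x = Num.sqrt (nrm2 x).
Proof. by rewrite /enorm; congr Num.sqrt; apply: eq_bigr => i _; rewrite expr2. Qed.

Lemma sqr_enorm x : enorm x ^+ 2 = nrm2 x.
Proof. by rewrite enormE sqr_sqrtr// nrm2_ge0. Qed.

Lemma enorm_ge0 x : 0 <= enorm x.
Proof. by rewrite enormE. Qed.

End dot_product.

Section measurable_dot.
Context {R : realType} {d : nat} d1 (T : measurableType d1).
Implicit Types f g : T -> 'rV[R]_d.

Lemma measurable_dot f g : measurable_fun setT f -> measurable_fun setT g ->
  measurable_fun setT (fun t => dot (f t) (g t)).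
Proof.
move=> mf mg; apply: measurable_sum => i.
by apply: measurable_funM; exact: measurable_fun_coord.
Qed.

Lemma measurable_nrm2 f : measurable_fun setT f ->
  measurable_fun setT (fun t => nrm2 (f t)).
Proof. by move=> mf; exact: measurable_dot. Qed.

End measurable_dot.

(** * Densities, images and products of measures *)

Section density_measure.
Context d (T : measurableType d) (R : realType).
Variables (m : {measure set T -> \bar R}) (w : T -> R).
Hypotheses (mw : measurable_fun setT w) (w0 : forall t, 0 <= w t).

Definition density_measure (A : set T) : \bar R := (\int[m]_(t in A) (w t)%:E)%E.

Let density0 : density_measure set0 = 0%E.
Proof. by rewrite /density_measure integral_set0. Qed.

Let density_ge0 A : (0 <= density_measure A)%E.
Proof. by apply: integral_ge0 => t _; rewrite lee_fin. Qed.

Let density_sigma_additive : semi_sigma_additive density_measure.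
Proof.
move=> F mF tF mUF; rewrite /density_measure ge0_integral_bigcup//.
- by apply: is_cvg_ereal_nneg_natsum_cond => n _ _; exact: density_ge0.
- by apply/measurable_EFinP; exact: measurable_funTS.
- by move=> t _; rewrite lee_fin.
Qed.

HB.instance Definition _ := isMeasure.Build _ _ _ density_measure
  density0 density_ge0 density_sigma_additive.

Definition mdensity : {measure set T -> \bar R} := density_measure.

Import HBNNSimple.

(** Monotone approximation by simple functions reduces the claim to indicators, where it is the
    definition of [density_measure]. *)
Lemma ge0_integral_density (f : T -> \bar R) : measurable_fun setT f ->
  (forall t, 0 <= f t)%E ->
  (\int[mdensity]_t f t = \int[m]_t (f t * (w t)%:E))%E.
Proof.
move=> mf f0.
pose f_ := nnsfun_approx measurableT mf.
have mwE : measurable_fun setT (EFin \o w) by exact/measurable_EFinP.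
have f_w n t : (0 <= (f_ n t)%:E * (w t)%:E)%E by rewrite mule_ge0 ?lee_fin.
transitivity (limn (fun n => \int[mdensity]_x (f_ n x)%:E))%E.
  rewrite -monotone_convergence//.
  - apply: eq_integral => y _; apply/esym/cvg_lim => //.
    by apply: cvg_nnsfun_approx.
  - by move=> n; exact/measurable_EFinP/measurable_funP.
  - by move=> n y _; rewrite lee_fin.
  - by move=> y _ k n kn; rewrite lee_fin; exact/lefP/nd_nnsfun_approx.
rewrite [X in limn X](_ : _ =
    (fun n => \int[m]_x ((f_ n x)%:E * (w x)%:E)))%E.
  rewrite -monotone_convergence//; last 2 first.
    - move=> n /=; apply: emeasurable_funM => //.
      exact/measurable_EFinP/measurable_funP.
    - move=> x _ k n kn; rewrite lee_pmul ?lee_fin//.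
      exact/lefP/nd_nnsfun_approx.
  apply: eq_integral => t _; apply/cvg_lim => //.
  under eq_fun do rewrite muleC. rewrite (muleC (f t)).
  apply: cvgeZl => //.
  by apply: cvg_nnsfun_approx.
apply/funext => n.
have f1 k x : 0 <= k * \1_(f_ n @^-1` [set k]) x.
  by have := nnfun_muleindic_ge0 (f_ n) k x; rewrite -EFinM lee_fin.
transitivity (\sum_(k \in range (f_ n))
    \int[m]_x ((k * \1_(f_ n @^-1` [set k]) x)%:E * (w x)%:E))%E; last first.
  rewrite -ge0_integral_fsum//.
  - apply: eq_integral => x _; rewrite fimfunE -fsumEFin// ge0_mule_fsuml//.
    by move=> k; rewrite lee_fin.
  - move=> r; apply: emeasurable_funM => //.
    exact/measurable_EFinP/measurable_funM.
  - by move=> r x _; rewrite mule_ge0 ?lee_fin.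
under eq_integral do rewrite fimfunE -fsumEFin//.
rewrite ge0_integral_fsum//; last 2 first.
- by move=> y; exact/measurable_EFinP/measurable_funM.
- by move=> y x _; rewrite lee_fin.
apply: eq_fsbigr => r _; rewrite integralZl_indic_nnsfun//.
rewrite integral_indic// setIT [mdensity _]/(density_measure _) /density_measure.
(* The approximating functions are non-negative, so negative levels have empty preimage; constants
   may be pulled out only for the others. *)
have [r0|r0] := ltP r 0.
  rewrite preimage_nnfun0// integral_set0 mule0.
  rewrite integral0_eq// => t _; rewrite indicE in_set0 mulr0 mul0e//.
rewrite integral_mkcond -ge0_integralZl//; last 2 first.
- by apply: (measurable_restrictT _ _).1 => //; exact: measurable_funTS.
- by move=> t _; rewrite patchE; case: ifP => //; rewrite lee_fin.
apply: eq_integral => t _; rewrite patchE indicE.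
by case: ifP; rewrite ?mulr1 ?mulr0 ?mule0 ?mul0e.
Qed.

End density_measure.

Section image_measures.
Context d d' (T1 : measurableType d) (T2 : measurableType d') (R : realType).
Variable f : T1 -> T2.
Hypothesis mf : measurable_fun [set: T1] f.

Definition mpush (m : {measure set T1 -> \bar R}) : {measure set T2 -> \bar R}.
Proof.
unshelve eapply (pushforward m f : {measure set T2 -> \bar R}); exact: mf.
Defined.

Lemma ge0_integral_mpush (m : {measure set T1 -> \bar R}) (g : T2 -> \bar R) :
  measurable_fun setT g -> (forall y, 0 <= g y)%E ->
  (\int[mpush m]_y g y = \int[m]_x g (f x))%E.
Proof. by move=> mg g0; rewrite ge0_integral_pushforward. Qed.

Let fM : {mfun T1 >-> T2} :=
  HB.pack_for {mfun T1 >-> T2} f (isMeasurableFun.Build _ _ _ _ f mf).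

Definition plaw (P : probability T1 R) : probability T2 R := distribution P fM.

Lemma ge0_integral_plaw (P : probability T1 R) (g : T2 -> \bar R) :
  measurable_fun setT g -> (forall y, 0 <= g y)%E ->
  (\int[plaw P]_y g y = \int[P]_x g (f x))%E.
Proof. by move=> mg g0; rewrite ge0_integral_distribution. Qed.

End image_measures.

Section tonelli.
Context d1 d2 (T1 : measurableType d1) (T2 : measurableType d2) (R : realType).
Variables (m1 : {sigma_finite_measure set T1 -> \bar R}).
Variables (m2 : {sigma_finite_measure set T2 -> \bar R}).
Variables (f : T1 * T2 -> \bar R).
Hypotheses (mf : measurable_fun setT f) (f0 : forall z, (0 <= f z)%E).

Lemma tonelli_prod :
  (\int[(m1 \x m2)%E]_z f z = \int[m1]_x \int[m2]_y f (x, y))%E.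
Proof. exact: fubini_tonelli1. Qed.

Lemma tonelli_swap :
  (\int[m1]_x \int[m2]_y f (x, y) = \int[m2]_y \int[m1]_x f (x, y))%E.
Proof. exact: fubini_tonelli. Qed.

Lemma measurable_tonelli : measurable_fun setT (fun x => \int[m2]_y f (x, y))%E.
Proof. exact: measurable_fun_fubini_tonelli_F. Qed.

End tonelli.

Lemma integral_prob_cst d (T : measurableType d) (R : realType)
    (P : probability T R) (c : \bar R) : (\int[P]_x c = c)%E.
Proof.
transitivity (c * P setT)%E; first exact: integral_cst.
by rewrite probability_setT mule1.
Qed.

(** * Elementary bounds for hyperbolic functions *)

Section sinh_bound.
Context {R : realType}.
Implicit Types t y : R.

(** The difference of the two sides vanishes at 0 and has the square of
    [expR (x / 2) - expR (- (x / 2))] as derivative. *)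
Lemma expRB_ge t : 0 <= t -> 2 * t <= expR t - expR (- t).
Proof.
move=> t0.
pose f (x : R) := expR x - expR (- x) - 2 * x.
have df (x : R) : is_derive x (1 : R) f (expR x + expR (- x) - 2).
  rewrite /f.
  apply: is_derive_eq.
  by rewrite /GRing.scale/=; ring.
have f0 : f 0 = 0 by rewrite /f oppr0 subrr mulr0 subrr.
suff : f 0 <= f t by rewrite f0 /f; lra.
have := @ger0_derive1_le_cc R f 0 t.
apply => //.

- move=> x _; rewrite derive1E derive_val.
  have := sqr_ge0 (expR (x / 2) - expR (- (x / 2))).
  rewrite sqrrB -expRM_natl -expRM_natl mulr2n -expRD subrr expR0.
  have -> : 2%:R * (x / 2) = x by field.
  have -> : 2%:R * - (x / 2) = - x by field.
  lra.
- by apply: derivable_within_continuous => x _; have [] := df x.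
- by rewrite in_itv/= lexx t0.
- by rewrite in_itv/= lexx t0.
Qed.

(** The right side is the square of [expR (y / 2) - expR (- (y / 2))]. The bound serves to read off
    the Gaussian second moment from the moment generating function. *)
Lemma expRD_ge y : y ^+ 2 <= expR y + expR (- y) - 2.
Proof.
wlog y0 : y / 0 <= y => [h|].
  have [/h//|y0] := leP 0 y.
  by have := h (- y); rewrite opprK sqrrN (addrC (expR (- y))); apply; lra.
have -> : expR y + expR (- y) - 2 = (expR (y / 2) - expR (- (y / 2))) ^+ 2.
  rewrite sqrrB -expRM_natl -expRM_natl mulr2n -expRD subrr expR0.
  have -> : 2%:R * (y / 2) = y by field.
  have -> : 2%:R * - (y / 2) = - y by field.
  ring.
have := @expRB_ge (y / 2); rewrite ler_sqr ?nnegrE//; last first.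
- by rewrite subr_ge0 ler_expR; lra.
- have -> : 2 * (y / 2) = y by field.
  by apply; lra.
Qed.

End sinh_bound.

(** * Affine substitution on the line *)

Section lebesgue_affine.
Context {R : realType}.
Local Notation leb := (@lebesgue_measure R).
Local Notation mR := (measurableTypeR R).

(** The image of Lebesgue measure under [x |-> c x + b], multiplied by [c], gives every interval its
    length, hence is Lebesgue measure by uniqueness. *)
Lemma ge0_integral_affine (c b : R) (f : R -> \bar R) : 0 < c ->
  measurable_fun setT f -> (forall x, 0 <= f x)%E ->
  (\int[leb]_x f x = c%:E * \int[leb]_x f (c * x + b)%R)%E.
Proof.
move=> c0 mf f0.
pose g (x : mR) : mR := (c * (x : R) + b)%R.
have mg : measurable_fun setT g by apply: measurable_funD => //; exact: mulrl_measurable.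
pose mu' : {measure set mR -> \bar R} := mscale (NngNum (ltW c0)) (mpush mg leb).
have leb_eq A : measurable A -> leb A = mu' A.
  apply: lebesgue_measure_unique => _ [[x y]] _ <-.
  rewrite /mu' /mscale /= /pushforward.
  pose x' := (x - b) / c; pose y' := (y - b) / c.
  transitivity (c%:E * leb `]x', y']%classic)%E; last first.
    congr (_ * leb _)%E.
    apply/seteqP; split => z /=; rewrite !in_itv/= /g /x' /y' ltr_pdivrMr//
      ler_pdivlMr// ltrBlDr lerBrDr (mulrC (z : R)); by [].
  rewrite !lebesgue_measure_itv/= !lte_fin /x' /y' ltr_pM2r ?invr_gt0// ltrD2r.
  case: ifP => _; last by rewrite mule0.
  by rewrite -!EFinB -EFinM; congr EFin; field; rewrite gt_eqF.
rewrite (eq_measure_integral mu'); last by move=> A mA _; exact: leb_eq.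
by rewrite ge0_integral_mscale//= ge0_integral_mpush.
Qed.

End lebesgue_affine.

(** * Gaussian vectors *)

Section normal1.
Context {R : realType}.
Local Notation leb := (@lebesgue_measure R).
Local Notation mR := (measurableTypeR R).
Implicit Types (s t b c : R) (f : R -> \bar R).

Definition normal1 s : probability mR R := normal_prob 0 (Num.sqrt s).

Definition pdf1 s (x : R) : R := normal_pdf 0 (Num.sqrt s) x.

Lemma pdf1E s x : 0 < s ->
  pdf1 s x = normal_peak (Num.sqrt s) * expR (- x ^+ 2 / (2 * s)).
Proof.
move=> s0; rewrite /pdf1 normal_pdfE ?gt_eqF ?sqrtr_gt0//.
by rewrite /normal_fun subr0 sqr_sqrtr ?ltW// mulr_natl.
Qed.

Lemma pdf1_ge0 s x : 0 <= pdf1 s x.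
Proof. exact: normal_pdf_ge0. Qed.

Lemma measurable_pdf1 s : measurable_fun setT (pdf1 s).
Proof. exact: measurable_normal_pdf. Qed.

Lemma measurable_pdf1E s : measurable_fun setT (fun x => (pdf1 s x)%:E).
Proof. by apply/measurable_EFinP; exact: measurable_pdf1. Qed.

Lemma ge0_integral_normal1 s f : measurable_fun setT f ->
  (forall x, 0 <= f x)%E ->
  (\int[normal1 s]_x f x = \int[leb]_x (f x * (pdf1 s x)%:E))%E.
Proof.
move=> mf f0.
rewrite -(ge0_integral_density leb (measurable_pdf1 s) (pdf1_ge0 s))//.
Qed.

(** Cameron-Martin formula in dimension one: after translation by [s b], completing the square in
    the exponent leaves the stated factor. *)
Lemma normal1_shift s b f : 0 < s -> measurable_fun setT f ->
  (forall x, 0 <= f x)%E ->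
  (\int[normal1 s]_x f (x + s * b)%R =
   \int[normal1 s]_x (f x * (expR (b * x - s * b ^+ 2 / 2))%:E))%E.
Proof.
move=> s0 mf f0.
have mfs : measurable_fun setT (fun x : R => f (x + s * b)).
  by apply: measurableT_comp => //; apply: measurable_funD.
have mw : measurable_fun setT (fun x : R => expR (b * x - s * b ^+ 2 / 2)).
  apply: measurableT_comp => //; apply: measurable_funB => //.
rewrite ge0_integral_normal1// ge0_integral_normal1//; last 2 first.
- by apply: emeasurable_funM => //; exact/measurable_EFinP.
- by move=> x; rewrite mule_ge0// lee_fin expR_ge0.
rewrite [RHS](@ge0_integral_affine _ 1 (s * b))//; last 2 first.
- apply: emeasurable_funM; last exact: measurable_pdf1E.
  by apply: emeasurable_funM => //; exact/measurable_EFinP.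
- by move=> x; rewrite !mule_ge0// lee_fin ?expR_ge0 ?pdf1_ge0.
rewrite mul1e; apply: eq_integral => x _; rewrite mul1r -muleA; congr *%E.
rewrite -EFinM; congr EFin; rewrite !pdf1E// mulrCA -expRD; congr (_ * expR _).
by field; rewrite gt_eqF.
Qed.

Lemma normal1_scale s c f : 0 < s -> 0 < c -> measurable_fun setT f ->
  (forall x, 0 <= f x)%E ->
  (\int[normal1 s]_x f (c * x)%R = \int[normal1 (c ^+ 2 * s)]_x f x)%E.
Proof.
move=> s0 c0 mf f0.
have mfc : measurable_fun setT (fun x : R => f (c * x)).
  by apply: measurableT_comp => //; exact: mulrl_measurable.
rewrite [LHS](ge0_integral_normal1 s mfc (fun x => f0 (c * x))).
rewrite [RHS](ge0_integral_normal1 _ mf f0).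
pose G (x : R) : \bar R := (f x * (pdf1 (c ^+ 2 * s) x)%:E)%E.
have mG : measurable_fun setT G.
  by apply: emeasurable_funM => //; exact: measurable_pdf1E.
have G0 x : (0 <= G x)%E by rewrite mule_ge0// lee_fin pdf1_ge0.
rewrite [RHS](ge0_integral_affine 0 c0 mG G0).
rewrite -ge0_integralZl; last 4 first.
- exact: measurableT.
- apply: (measurableT_comp mG); apply: measurable_funD.
    exact: mulrl_measurable.
  exact: measurable_cst.
- by move=> x _.
- by rewrite lee_fin ltW.
apply: eq_integral => x _; rewrite /G addr0 muleCA; congr *%E.
rewrite -EFinM; congr EFin; rewrite !pdf1E ?mulr_gt0 ?exprn_gt0//.
rewrite [RHS]mulrA; congr (_ * expR _); last first.
  by field; rewrite !gt_eqF.
rewrite /normal_peak !sqr_sqrtr ?mulr_ge0 ?exprn_ge0 ?ltW//.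
have -> : c ^+ 2 * s * pi *+ 2 = c ^+ 2 * (s * pi *+ 2) by ring.
rewrite (sqrtrM _ (sqr_ge0 c)). rewrite sqrtr_sqr (gtr0_norm c0). by rewrite invfM mulVKf// gt_eqF.
Qed.

(** With [z = x + y], the product of the two densities factors into the density of [N(0, s + t)] at
    [z] and that of a Gaussian in [x] with mean [s z / (s + t)] and variance [q = s t / (s + t)];
    the latter integrates to 1. *)
Lemma normal1_conv s t f : 0 < s -> 0 < t -> measurable_fun setT f ->
  (forall x, 0 <= f x)%E ->
  (\int[normal1 s]_x \int[normal1 t]_y f (x + y)%R =
   \int[normal1 (s + t)]_z f z)%E.
Proof.
move=> s0 t0 mf f0.
have st0 : 0 < s + t by exact: addr_gt0.
pose q := s * t / (s + t).
have q0 : 0 < q by rewrite divr_gt0// mulr_gt0.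
pose F (z : R * R) : \bar R := (f z.2 * (pdf1 t (z.2 - z.1))%:E * (pdf1 s z.1)%:E)%E.
have mF : measurable_fun setT F.
  apply: emeasurable_funM; [apply: emeasurable_funM|].
  - by apply: measurableT_comp.
  - apply/measurable_EFinP; apply: (measurableT_comp (measurable_pdf1 t)).
    by apply: measurable_funB.
  - by apply/measurable_EFinP; apply: (measurableT_comp (measurable_pdf1 s)).
have F0 z : (0 <= F z)%E by rewrite !mule_ge0// lee_fin pdf1_ge0.
have mG : measurable_fun setT (fun x : R => \int[normal1 t]_y f (x + y)%R)%E.
  apply: (@measurable_fun_fubini_tonelli_F _ _ mR mR R (normal1 t)
    (fun z => f (z.1 + z.2)%R)) => //.
  exact: (measurableT_comp mf (measurable_funD measurable_fst measurable_snd)).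
have mfx (x : R) : measurable_fun setT (fun y : R => f (x + y)).
  by apply: (measurableT_comp mf); apply: measurable_funD; [exact: measurable_cst|exact: measurable_id].
have mfp (x : R) : measurable_fun setT (fun y : R => f (x + y)%R * (pdf1 t y)%:E)%E.
  exact: (emeasurable_funM (mfx x) (measurable_pdf1E t)).
transitivity (\int[leb]_x \int[leb]_y F (x, y))%E.
  rewrite [LHS](ge0_integral_normal1 s mG); last by move=> x; exact: integral_ge0.
  apply: eq_integral => x _.
  rewrite (ge0_integral_normal1 t (mfx x) (fun y => f0 (x + y))).
  rewrite -(@ge0_integralZr _ mR R leb setT measurableT _ (mfp x)); last 2 first.
  - by move=> y _; rewrite mule_ge0// lee_fin pdf1_ge0.
  - by rewrite lee_fin pdf1_ge0.
  rewrite [RHS](ge0_integral_affine x ltr01 (measurableT_comp mF (measurable_pair1 x)) (fun y => F0 (x, y))).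
  rewrite mul1e; apply: eq_integral => y _.
  by rewrite /F/= mul1r (addrC x) addrK.
rewrite (tonelli_swap leb leb mF F0) [RHS](ge0_integral_normal1 _ mf f0).
apply: eq_integral => z _.
rewrite /F/=; under eq_integral do rewrite -muleA -EFinM.
have mpz (u c : R) : measurable_fun setT (fun x : R => pdf1 u (c - x)).
  by apply: (measurableT_comp (measurable_pdf1 u)); apply: measurable_funB; [exact: measurable_cst|exact: measurable_id].
have mpz' (u c : R) : measurable_fun setT (fun x : R => pdf1 u (x - c)).
  by apply: (measurableT_comp (measurable_pdf1 u)); apply: measurable_funB; [exact: measurable_id|exact: measurable_cst].
rewrite (@ge0_integralZl _ mR R leb setT measurableT); last 3 first.
- by apply/measurable_EFinP; apply: (measurable_funM (mpz t z)); exact: measurable_pdf1.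
- by move=> y _; rewrite lee_fin mulr_ge0// pdf1_ge0.
- exact: f0.
congr *%E.
have pk u : 0 < u -> 0 < normal_peak (Num.sqrt u).
  by move=> u0; rewrite normal_peak_gt0// gt_eqF// sqrtr_gt0.
have qE : q * (s + t) = s * t by rewrite /q divfK// gt_eqF.
have pkM : normal_peak (Num.sqrt t) * normal_peak (Num.sqrt s) =
    normal_peak (Num.sqrt (s + t)) * normal_peak (Num.sqrt q) :> R.
  rewrite /normal_peak !sqr_sqrtr ?(ltW s0) ?(ltW t0) ?(ltW q0) ?(ltW st0)//.
  have pi2 u : 0 < u -> 0 <= u * pi *+ 2 :> R.
    by move=> u0; rewrite mulrn_wge0// mulr_ge0 ?pi_ge0// ltW.
  rewrite -!invfM -(sqrtrM _ (pi2 _ t0)) -(sqrtrM _ (pi2 _ st0)).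
  suff -> : t * pi *+ 2 * (s * pi *+ 2) = (s + t) * pi *+ 2 * (q * pi *+ 2) by [].
  move: (pi : R) => w.
  transitivity (q * (s + t) * (w *+ 2 * (w *+ 2))); last by ring.
  by rewrite qE; ring.
transitivity (\int[leb]_x ((pdf1 (s + t) z)%:E * (pdf1 q (x - s * z / (s + t)))%:E))%E.
  apply: eq_integral => x _; rewrite -EFinM; congr EFin.
  rewrite !pdf1E// mulrACA pkM [RHS]mulrACA; congr (_ * _).
  rewrite -!expRD; congr expR; rewrite /q; field.
  by rewrite !gt_eqF.
rewrite (@ge0_integralZl _ mR R leb setT measurableT); last 3 first.
- by apply/measurable_EFinP; exact: mpz'.
- by move=> y _; rewrite lee_fin pdf1_ge0.
- by rewrite lee_fin pdf1_ge0.
rewrite (@ge0_integral_affine _ 1 (s * z / (s + t))); last 3 first.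
- exact: ltr01.
- by apply/measurable_EFinP; exact: mpz'.
- by move=> y; rewrite lee_fin pdf1_ge0.
rewrite mul1e; under eq_integral do rewrite mul1r addrK.
by rewrite integral_normal_pdf mule1.
Qed.

Lemma normal1_opp s f : 0 < s -> measurable_fun setT f ->
  (forall x, 0 <= f x)%E ->
  (\int[normal1 s]_x f (- x)%R = \int[normal1 s]_x f x)%E.
Proof.
move=> s0 mf f0.
have mN : measurable_fun setT (-%R : mR -> mR) by [].
have mfN : measurable_fun setT (fun x : R => f (- x)) by exact: (measurableT_comp mf mN).
rewrite (ge0_integral_normal1 s mf f0) (ge0_integral_normal1 s mfN (fun x => f0 (- x))).
rewrite [RHS](@eq_measure_integral _ _ _ _ (mpush mN leb)); last first.
  by move=> A mA _; rewrite -[LHS](lebesgue_measureN mA).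
pose G (x : mR) : \bar R := (f x * (pdf1 s x)%:E)%E.
have mG : measurable_fun setT G by exact: (emeasurable_funM mf (measurable_pdf1E s)).
have G0 x : (0 <= G x)%E by rewrite mule_ge0// lee_fin pdf1_ge0.
rewrite (ge0_integral_mpush mN leb mG G0).
by apply: eq_integral => x _; rewrite /G !(pdf1E _ s0) sqrrN.
Qed.

(** The shift formula for the constant function 1: the tilting factor has mean 1. *)
Lemma normal1_mgf s b : 0 < s ->
  (\int[normal1 s]_x (expR (b * x))%:E = (expR (s * b ^+ 2 / 2))%:E)%E.
Proof.
move=> s0.
have me : measurable_fun setT (fun x : R => (expR (b * x - s * b ^+ 2 / 2))%:E).
  apply/measurable_EFinP; apply: (measurableT_comp (@measurable_expR R)).
  by apply: measurable_funB; [exact: mulrl_measurable|exact: measurable_cst].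
have := @normal1_shift s b (cst 1%E) s0 (measurable_cst _) (fun=> lee01).
rewrite [X in X = _ -> _](_ : _ = 1%E); last exact: integral_prob_cst.
under eq_integral do rewrite mul1e.
move=> H; rewrite -[RHS]mule1 H -(@ge0_integralZl _ mR R _ setT measurableT _ me); last 2 first.
- by move=> x _; rewrite lee_fin expR_ge0.
- by rewrite lee_fin expR_ge0.
apply: eq_integral => x _; rewrite -EFinM -expRD; congr (expR _)%:E; ring.
Qed.

(** Integrating [(b x)^2 + 2 <= expR (b x) + expR (- b x)] gives [M b^2 + 2 <= 2 expR (s b^2 / 2)]
    for the second moment [M] and every [b]. Taking [b = 1] shows that [M] is finite, and small [b]
    that it is at most [s]. *)
Lemma normal1_sqr s : 0 < s -> (\int[normal1 s]_x (x ^+ 2)%:E <= s%:E)%E.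
Proof.
move=> s0.
pose M := (\int[normal1 s]_x (x ^+ 2)%:E)%E.
have mX : measurable_fun setT (fun x : R => (x ^+ 2)%:E) by exact/measurable_EFinP.
have me b : measurable_fun setT (fun x : R => (expR (b * x))%:E).
  by apply/measurable_EFinP; apply: measurableT_comp.
have M0 : (0 <= M)%E by apply: integral_ge0 => x _; rewrite lee_fin sqr_ge0.
have H b : (M * (b ^+ 2)%:E + 2%:E <= (2 * expR (s * b ^+ 2 / 2))%:E)%E.
  have -> : (2 * expR (s * b ^+ 2 / 2))%:E =
    (\int[normal1 s]_x ((expR (b * x))%:E + (expR (- b * x))%:E))%E.
    have e0 c (x : mR) : [set: mR] x -> (0 <= (expR (c * x))%:E)%E.
      by move=> _; rewrite lee_fin expR_ge0.
    rewrite (@ge0_integralD _ mR R _ setT measurableT _ _ (e0 b) (me b) (e0 (- b)) (me (- b))).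
    rewrite !normal1_mgf// sqrrN -EFinD; congr EFin; ring.
  have x0 (x : mR) : [set: mR] x -> (0 <= (x ^+ 2)%:E :> \bar R)%E.
    by move=> _; rewrite lee_fin sqr_ge0.
  have b0 : (0 <= (b ^+ 2)%:E)%E by rewrite lee_fin sqr_ge0.
  rewrite /M -(@ge0_integralZr _ mR R _ setT measurableT _ mX _ x0 b0).
  rewrite -[X in (_ + X)%E](integral_prob_cst (normal1 s)).
  have mXb : measurable_fun setT (fun x : mR => (x ^+ 2)%:E * (b ^+ 2)%:E : \bar R)%E.
    by apply: (emeasurable_funM mX); exact: measurable_cst.
  have xb0 (x : mR) : [set: mR] x -> (0 <= (x ^+ 2)%:E * (b ^+ 2)%:E :> \bar R)%E.
    by move=> _; rewrite mule_ge0// lee_fin sqr_ge0.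
  have c0 (x : mR) : [set: mR] x -> (0 <= 2%:E :> \bar R)%E by [].
  rewrite -(@ge0_integralD _ mR R _ setT measurableT _ _ xb0 mXb c0 (measurable_cst _)).
  apply: ge0_le_integral.
  - exact: measurableT.
  - by move=> x _; rewrite adde_ge0// mule_ge0// lee_fin sqr_ge0.
  - by apply: (emeasurable_funD mXb); exact: measurable_cst.
  - exact: (emeasurable_funD (me b) (me (- b))).
  - move=> x _; rewrite -EFinM -!EFinD lee_fin.
    by have := expRD_ge (b * x); rewrite exprMn mulNr; lra.
have Mfin : M \is a fin_num.
  rewrite ge0_fin_numE// ltNge leye_eq; apply/negP => /eqP My.
  by have := H 1; rewrite -/M My expr1n mule1.
rewrite -/M -(fineK Mfin) lee_fin leNgt; apply/negP => sM.
set m := fine M in sM.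
have ms : 1 < m / s by rewrite ltr_pdivlMr// mul1r.
(* For [z = s b^2 / 2] the inequality reads [m / s * z <= expR z - 1], and the right side is at most
   [z * expR z]. Half the logarithm of [m / s] makes [expR z < m / s], a contradiction. *)
pose z := ln (m / s) / 2.
have z0 : 0 < z by rewrite divr_gt0// ln_gt0.
have ez : expR z * s < m.
  rewrite -ltr_pdivlMr// -[ltRHS]lnK ?posrE; last by rewrite (lt_trans _ ms).
  rewrite ltr_expR /z; have := ln_gt0 ms; lra.
pose b := Num.sqrt (2 * z / s).
have b2 : b ^+ 2 = 2 * z / s by rewrite sqr_sqrtr// divr_ge0 ?(ltW s0)// mulr_ge0 ?(ltW z0).
have := H b; rewrite -(fineK Mfin) -/m -EFinM -EFinD lee_fin b2.
have -> : s * (2 * z / s) / 2 = z by field; rewrite gt_eqF.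
have : 1 - z <= expR (- z) by have := expR_ge1Dx (- z); lra.
rewrite expRN -(ler_pM2l (expR_gt0 z)) divff ?gt_eqF ?expR_gt0// => h1 h2.
have h3 : m * (2 * z / s) <= 2 * (expR z * z) by lra.
suff : m / s <= expR z by rewrite ler_pdivrMr// leNgt ez.
have z2 : 0 < 2 * z by rewrite mulr_gt0.
rewrite -(ler_pM2r z2).
have -> : m / s * (2 * z) = m * (2 * z / s) by field; rewrite gt_eqF.
by rewrite (le_trans h3)// mulrCA.
Qed.

End normal1.

(** * Rows as a head and a tail *)

Section cons_row_theory.
Context {R : realType} {d : nat}.
Implicit Types (x y c : R) (u v : 'rV[R]_d).

Lemma cons_row0 x v : cons_row (x, v) ord0 ord0 = x.
Proof.
rewrite /cons_row mxE; case: splitP => [j _|k]; last by [].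
by rewrite (ord1 j) mxE eqxx mulr1n.
Qed.

Lemma cons_rowS x v i : cons_row (x, v) ord0 (lift ord0 i) = v ord0 i.
Proof.
rewrite /cons_row mxE; case: splitP => [j|k].
  by rewrite (ord1 j).
by rewrite /= /bump /= !add1n => -[ik]; congr (v _ _); exact: val_inj.
Qed.

Lemma row_eqP (a b : 'rV[R]_d.+1) : a ord0 ord0 = b ord0 ord0 ->
  (forall i, a ord0 (lift ord0 i) = b ord0 (lift ord0 i)) -> a = b.
Proof.
by move=> h0 hS; apply/rowP => i; case: (unliftP ord0 i) => [j ->|->].
Qed.

Lemma cons_rowD x y u v :
  cons_row (x, u) + cons_row (y, v) = cons_row (x + y, u + v).
Proof.
by apply: row_eqP => [|i]; rewrite mxE ?cons_row0 ?cons_rowS ?mxE.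
Qed.

Lemma cons_rowZ c x u : c *: cons_row (x, u) = cons_row (c * x, c *: u).
Proof.
by apply: row_eqP => [|i]; rewrite mxE ?cons_row0 ?cons_rowS ?mxE.
Qed.

Lemma cons_rowN x u : - cons_row (x, u) = cons_row (- x, - u).
Proof.
by apply: row_eqP => [|i]; rewrite mxE ?cons_row0 ?cons_rowS ?mxE.
Qed.

Lemma dot_cons x y u v :
  dot (cons_row (x, u)) (cons_row (y, v)) = x * y + dot u v.
Proof.
rewrite /dot big_ord_recl !cons_row0; congr (_ + _).
by apply: eq_bigr => i _; rewrite !cons_rowS.
Qed.

Lemma nrm2_cons x u : nrm2 (cons_row (x, u)) = x ^+ 2 + nrm2 u.
Proof. by rewrite /nrm2 dot_cons expr2. Qed.

Definition tail_row (a : 'rV[R]_d.+1) : 'rV[R]_d := \row_i a ord0 (lift ord0 i).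

Lemma cons_tail (a : 'rV[R]_d.+1) : a = cons_row (a ord0 ord0, tail_row a).
Proof. by apply: row_eqP => [|i]; rewrite ?cons_row0 ?cons_rowS ?mxE. Qed.

Lemma measurable_cons_row : measurable_fun setT (@cons_row R d).
Proof.
apply: measurable_rowP => i; case: (unliftP ord0 i) => [j|] ->.
  rewrite [X in measurable_fun _ X](_ : _ = (fun z : measurableTypeR R * 'rV[R]_d => z.2 ord0 j)).
    exact: (measurableT_comp (measurable_coord j) measurable_snd).
  by apply/funext => -[x v]; rewrite cons_rowS.
rewrite [X in measurable_fun _ X](_ : _ = fst); first exact: measurable_fst.
by apply/funext => -[x v]; rewrite cons_row0.
Qed.

End cons_row_theory.

(** * Gaussian vectors by induction on the dimension *)

Section gaussian_rows.
Context {R : realType}.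
Local Notation mR := (measurableTypeR R).
Implicit Types (s t c : R) (d : nat).

(** [gaussian] is a bare set function; the same recursion on bundled probabilities makes Tonelli's
    theorem and the image formula available in every dimension. *)
Fixpoint gaussP d s : probability 'rV[R]_d R :=
  match d with
  | 0%N => \d_(0 : 'rV[R]_0)
  | d'.+1 => plaw measurable_cons_row (normal1 s \x gaussP d' s)%E
  end.

Lemma gaussianE d s : @gaussian R d s = gaussP d s.
Proof.
rewrite /gaussian; elim: d => [//|d IH].
by rewrite [LHS]/= IH.
Qed.

Lemma ge0_integral_gaussS d s (f : 'rV[R]_d.+1 -> \bar R) :
  measurable_fun setT f -> (forall x, 0 <= f x)%E ->
  (\int[gaussP d.+1 s]_v f v =
   \int[normal1 s]_x \int[gaussP d s]_v f (cons_row (x, v)))%E.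
Proof.
move=> mf f0; rewrite (ge0_integral_plaw measurable_cons_row _ mf f0).
exact: (tonelli_prod (normal1 s) (gaussP d s)
  (measurableT_comp mf measurable_cons_row) (fun z => f0 (cons_row z))).
Qed.

Lemma ge0_integral_gauss0 s (f : 'rV[R]_0 -> \bar R) :
  (\int[gaussP 0 s]_v f v = f 0%R)%E.
Proof.
rewrite (eq_integral (cst (f 0))); last by move=> x _; rewrite (thinmx0 x).
exact: integral_prob_cst.
Qed.

Opaque gaussP normal1.

Lemma measurable_gauss_inner d s (f : R * 'rV[R]_d -> \bar R) :
  measurable_fun setT f -> (forall x, 0 <= f x)%E ->
  measurable_fun setT (fun x : R => \int[gaussP d s]_v f (x, v))%E.
Proof. by move=> mf f0; exact: (@measurable_tonelli _ _ mR _ R (gaussP d s) f). Qed.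

Lemma measurable_cons_fun d (d1 : measure_display) (T : measurableType d1) (g : T -> R) (h : T -> 'rV[R]_d) :
  measurable_fun setT g -> measurable_fun setT h ->
  measurable_fun setT (fun x => cons_row (g x, h x)).
Proof.
move=> mg mh; apply: (measurableT_comp measurable_cons_row).
exact/measurable_fun_pair.
Qed.

Lemma measurable_exp_dot d (b : 'rV[R]_d) c :
  measurable_fun setT (fun v : 'rV_d => expR (dot b v - c)).
Proof.
apply: (measurableT_comp (@measurable_expR R)); apply: measurable_funB.
  by apply: measurable_dot; [exact: measurable_cst|exact: measurable_id].
exact: measurable_cst.
Qed.

(** Cameron-Martin formula. The tilting factor is a product over coordinates, so the head is shifted
    by the one-dimensional formula and the tail by induction. *)
Lemma gauss_shift d s (b : 'rV[R]_d) (f : 'rV[R]_d -> \bar R) : 0 < s ->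
  measurable_fun setT f -> (forall x, 0 <= f x)%E ->
  (\int[gaussP d s]_v f (v + s *: b)%R =
   \int[gaussP d s]_v (f v * (expR (dot b v - s * nrm2 b / 2))%:E))%E.
Proof.
move=> s0; elim: d b f => [b f _ _|d IH b f mf f0].
  rewrite !ge0_integral_gauss0 [X in f X]thinmx0 (thinmx0 b).
  by rewrite /nrm2 !dot0l mulr0 mul0r subrr expR0 mule1.
pose G v := (f v * (expR (dot b v - s * nrm2 b / 2))%:E)%E.
have mG : measurable_fun setT G.
  apply: (emeasurable_funM mf); apply/measurable_EFinP; exact: measurable_exp_dot.
have G0 v : (0 <= G v)%E by rewrite mule_ge0// lee_fin expR_ge0.
have mfs : measurable_fun setT (fun v : 'rV[R]_d.+1 => f (v + s *: b)).
  by apply: (measurableT_comp mf); apply: measurable_rowD;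
    [exact: measurable_id|exact: measurable_cst].
rewrite [LHS](ge0_integral_gaussS s mfs (fun v => f0 _)) [RHS](ge0_integral_gaussS s mG G0).
rewrite /G {mfs mG G0 G} (cons_tail b); set b0 := b ord0 ord0; set b' := tail_row b.
pose F (z : R * 'rV[R]_d) : \bar R :=
  (f (cons_row z) * (expR (dot b' z.2 - s * nrm2 b' / 2))%:E)%E.
have mF : measurable_fun setT F.
  apply: (emeasurable_funM (measurableT_comp mf measurable_cons_row)).
  apply/measurable_EFinP.
  exact: (measurableT_comp (measurable_exp_dot b' (s * nrm2 b' / 2)) measurable_snd).
have F0 z : (0 <= F z)%E by rewrite mule_ge0// lee_fin expR_ge0.
transitivity (\int[normal1 s]_x (fun y => \int[gaussP d s]_v F (y, v)) (x + s * b0)%R)%E.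
  apply: eq_integral => x _.
  have mfc : measurable_fun setT (fun v => f (cons_row (x + s * b0, v))).
    by apply: (measurableT_comp mf); apply: measurable_cons_fun;
      [exact: measurable_cst|exact: measurable_id].
  rewrite /F -(IH b' _ mfc (fun v => f0 _)).
  by apply: eq_integral => v _; rewrite cons_rowZ cons_rowD.
have mI := measurable_gauss_inner s mF F0.
have I0 x : (0 <= \int[gaussP d s]_v F (x, v))%E.
  by apply: integral_ge0 => v _; exact: F0.
rewrite [LHS](normal1_shift b0 s0 mI I0).
apply: eq_integral => x _.
rewrite -(ge0_integralZr _ measurableT (measurableT_comp mF (measurable_pair1 x))); last 2 first.
- by move=> v _; exact: F0.
- by rewrite lee_fin expR_ge0.
apply: eq_integral => v _; rewrite /F/= -muleA -EFinM -expRD; congr (_ * (expR _)%:E)%E.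
by rewrite dot_cons nrm2_cons; ring.
Qed.

Lemma gauss_scale d s c (f : 'rV[R]_d -> \bar R) : 0 < s -> 0 < c ->
  measurable_fun setT f -> (forall x, 0 <= f x)%E ->
  (\int[gaussP d s]_v f (c *: v)%R = \int[gaussP d (c ^+ 2 * s)]_v f v)%E.
Proof.
move=> s0 c0; elim: d f => [f _ _|d IH f mf f0].
  by rewrite !ge0_integral_gauss0 scaler0.
have mfc : measurable_fun setT (fun v : 'rV[R]_d.+1 => f (c *: v)).
  by apply: (measurableT_comp mf); apply: measurable_rowZ;
    [exact: measurable_cst|exact: measurable_id].
rewrite [LHS](ge0_integral_gaussS s mfc (fun v => f0 _)) [RHS](ge0_integral_gaussS _ mf f0).
have mF : measurable_fun setT (fun z => f (cons_row z)).
  exact: (measurableT_comp mf (@measurable_cons_row R d)).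
pose G x := (\int[gaussP d (c ^+ 2 * s)]_v f (cons_row (x, v)))%E.
have mG : measurable_fun setT G := measurable_gauss_inner (c ^+ 2 * s) mF (fun z => f0 _).
have G0 x : (0 <= G x)%E by apply: integral_ge0 => v _; exact: f0.
transitivity (\int[normal1 s]_x G (c * x)%R)%E; last exact: (normal1_scale s0 c0 mG G0).
apply: eq_integral => x _; under eq_integral do rewrite cons_rowZ.
apply: (IH (fun v => f (cons_row (c * x, v)))) => [|v]; last exact: f0.
by apply: (measurableT_comp mf); apply: measurable_cons_fun;
  [exact: measurable_cst|exact: measurable_id].
Qed.

Lemma gauss_opp d s (f : 'rV[R]_d -> \bar R) : 0 < s ->
  measurable_fun setT f -> (forall x, 0 <= f x)%E ->
  (\int[gaussP d s]_v f (- v)%R = \int[gaussP d s]_v f v)%E.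
Proof.
move=> s0; elim: d f => [f _ _|d IH f mf f0].
  by rewrite !ge0_integral_gauss0 oppr0.
have mfN : measurable_fun setT (fun v : 'rV[R]_d.+1 => f (- v)).
  by apply: (measurableT_comp mf); apply: measurable_rowN; exact: measurable_id.
rewrite [LHS](ge0_integral_gaussS s mfN (fun v => f0 _)) [RHS](ge0_integral_gaussS s mf f0).
have mF : measurable_fun setT (fun z => f (cons_row z)).
  exact: (measurableT_comp mf (@measurable_cons_row R d)).
pose G x := (\int[gaussP d s]_v f (cons_row (x, v)))%E.
have mG : measurable_fun setT G := measurable_gauss_inner s mF (fun z => f0 _).
have G0 x : (0 <= G x)%E by apply: integral_ge0 => v _; exact: f0.
transitivity (\int[normal1 s]_x G (- x)%R)%E; last exact: (normal1_opp s0 mG G0).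
apply: eq_integral => x _; under eq_integral do rewrite cons_rowN.
apply: (IH (fun v => f (cons_row (- x, v)))) => [|v]; last exact: f0.
by apply: (measurableT_comp mf); apply: measurable_cons_fun;
  [exact: measurable_cst|exact: measurable_id].
Qed.

Lemma gauss_conv d s t (f : 'rV[R]_d -> \bar R) : 0 < s -> 0 < t ->
  measurable_fun setT f -> (forall x, 0 <= f x)%E ->
  (\int[gaussP d s]_u \int[gaussP d t]_v f (u + v)%R =
   \int[gaussP d (s + t)]_v f v)%E.
Proof.
move=> s0 t0; elim: d f => [f _ _|d IH f mf f0].
  by rewrite !ge0_integral_gauss0 addr0.
have mfD (u : 'rV_d.+1) : measurable_fun setT (fun v : 'rV[R]_d.+1 => f (u + v)).
  by apply: (measurableT_comp mf); apply: measurable_rowD;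
    [exact: measurable_cst|exact: measurable_id].
have mF2 : measurable_fun setT (fun z : 'rV_d.+1 * 'rV_d.+1 => f (z.1 + z.2)).
  by apply: (measurableT_comp mf); apply: measurable_rowD.
have mG := measurable_tonelli (gaussP d.+1 t) mF2 (fun z => f0 _).
rewrite [LHS](ge0_integral_gaussS s mG); last first.
  by move=> x; apply: integral_ge0 => v _; exact: f0.
rewrite [RHS](ge0_integral_gaussS _ mf f0).
have mF : measurable_fun setT (fun z => f (cons_row z)).
  exact: (measurableT_comp mf (@measurable_cons_row R d)).
pose K x := (\int[gaussP d (s + t)]_v f (cons_row (x, v)))%E.
have mK : measurable_fun setT K := measurable_gauss_inner (s + t) mF (fun z => f0 _).
have K0 x : (0 <= K x)%E by apply: integral_ge0 => v _; exact: f0.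
transitivity (\int[normal1 s]_x \int[normal1 t]_y K (x + y)%R)%E;
  last exact: (normal1_conv s0 t0 mK K0).
apply: eq_integral => x _.
transitivity (\int[gaussP d s]_u \int[normal1 t]_y \int[gaussP d t]_v
    f (cons_row (x + y, u + v)%R))%E.
  apply: eq_integral => u _; rewrite (ge0_integral_gaussS _ (mfD _) (fun v => f0 _)).
  by apply: eq_integral => y _; apply: eq_integral => v _; rewrite cons_rowD.
have mH3 : measurable_fun setT (fun z : 'rV[R]_d * mR * 'rV[R]_d =>
    f (cons_row ((x + z.1.2)%R, z.1.1 + z.2))).
  apply: (measurableT_comp mf); apply: measurable_cons_fun.
    apply: measurable_funD; first exact: measurable_cst.
    exact: (measurableT_comp measurable_snd measurable_fst).
  apply: measurable_rowD; last exact: measurable_snd.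
  exact: (measurableT_comp measurable_fst measurable_fst).
(* The tail of the first vector is exchanged with the head of the second, so that heads and tails
   are convolved separately. *)
rewrite (@tonelli_swap _ _ _ mR R (gaussP d s) (normal1 t)
  (fun z : 'rV[R]_d * mR => \int[gaussP d t]_v f (cons_row (x + z.2, z.1 + v)%R))%E
  (measurable_tonelli (gaussP d t) mH3 (fun z => f0 _))); last first.
  by move=> z; apply: integral_ge0 => v _; exact: f0.
apply: eq_integral => y _ /=.
apply: (IH (fun v => f (cons_row (x + y, v)%R))) => [|v]; last exact: f0.
by apply: (measurableT_comp mf); apply: measurable_cons_fun;
  [exact: measurable_cst|exact: measurable_id].
Qed.

Lemma gauss_nrm2 d s : 0 < s -> (\int[gaussP d s]_v (nrm2 v)%:E <= (d%:R * s)%:E)%E.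
Proof.
move=> s0; elim: d => [|d IH].
  by rewrite ge0_integral_gauss0 /nrm2 dot0l mul0r.
have mn k : measurable_fun setT (fun v : 'rV[R]_k => (nrm2 v)%:E).
  by apply/measurable_EFinP; apply: measurable_nrm2; exact: measurable_id.
have mX : measurable_fun setT (fun x : mR => (x ^+ 2)%:E).
  by apply/measurable_EFinP; exact: exprn_measurable.
rewrite (ge0_integral_gaussS s (mn d.+1)); last by move=> v; rewrite lee_fin nrm2_ge0.
pose M := (\int[gaussP d s]_v (nrm2 v)%:E)%E.
have M0 : (0 <= M)%E by apply: integral_ge0 => v _; rewrite lee_fin nrm2_ge0.
rewrite (eq_integral (fun x : mR => (x ^+ 2)%:E + M)%E); last first.
  move=> x _; under eq_integral do rewrite nrm2_cons EFinD.
  rewrite (ge0_integralD _ measurableT _ (measurable_cst _) _ (mn d)).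
  - by rewrite integral_prob_cst.
  - by move=> v _; rewrite lee_fin sqr_ge0.
  - by move=> v _; rewrite lee_fin nrm2_ge0.
rewrite (ge0_integralD _ measurableT _ mX _ (measurable_cst _)).
- rewrite integral_prob_cst -natr1 mulrDl mul1r addrC EFinD leeD//.
  exact: normal1_sqr.
- by move=> v _; rewrite lee_fin sqr_ge0.
- by move=> v _.
Qed.

End gaussian_rows.

(** * Posterior weights and means *)

Section bounded_measurable.
Context d (T : measurableType d) (R : realType) (P : probability T R).
Implicit Types (f g : T -> R) (c : R).

(** Bounded measurable functions: integrable under every probability and stable under sums and
    products, so that real expectations behave linearly. *)
Definition bmf g := measurable_fun setT g /\ exists C, forall t, `|g t| <= C.

Lemma bmf_cst c : bmf (fun=> c).
Proof. by split; [exact: measurable_cst|exists `|c|]. Qed.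

Lemma bmfD f g : bmf f -> bmf g -> bmf (fun t => f t + g t).
Proof.
move=> [mf [C fC]] [mg [D gD]]; split; first exact: measurable_funD.
by exists (C + D) => t; rewrite (le_trans (ler_normD _ _))// lerD.
Qed.

Lemma bmfM f g : bmf f -> bmf g -> bmf (fun t => f t * g t).
Proof.
move=> [mf [C fC]] [mg [D gD]]; split; first exact: measurable_funM.
by exists (C * D) => t; rewrite normrM ler_pM.
Qed.

Lemma bmfN f : bmf f -> bmf (fun t => - f t).
Proof.
move=> [mf [C fC]]; split; first exact: measurable_funN.
by exists C => t; rewrite normrN.
Qed.

Lemma bmfB f g : bmf f -> bmf g -> bmf (fun t => f t - g t).
Proof. by move=> bf bg; apply: bmfD => //; exact: bmfN. Qed.

Lemma bmfZ c f : bmf f -> bmf (fun t => c * f t).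
Proof. by move=> bf; apply: bmfM => //; exact: bmf_cst. Qed.

Lemma bmf_int f : bmf f -> P.-integrable setT (EFin \o f).
Proof.
move=> [mf [C fC]]; apply: measurable_bounded_integrable.
- exact: measurableT.
- by rewrite (le_lt_trans (probability_le1 _ _))// ltry.
- exact: mf.
- exists C; split; first exact: num_real.
  by move=> x Cx t _; apply: (le_trans (fC t)); exact: ltW.
Qed.

Definition expect f : R := (\int[P]_t f t).

Lemma expectE f : bmf f -> (\int[P]_t (f t)%:E = (expect f)%:E)%E.
Proof.
move=> bf; rewrite /expect /Rintegral fineK//.
exact: (integrable_fin_num measurableT (bmf_int bf)).
Qed.

Lemma expectD f g : bmf f -> bmf g ->
  expect (fun t => f t + g t) = expect f + expect g.
Proof. by move=> bf bg; apply: RintegralD => //; exact: bmf_int. Qed.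

Lemma expectZ c f : bmf f -> expect (fun t => c * f t) = c * expect f.
Proof. by move=> bf; apply: RintegralZl => //; exact: bmf_int. Qed.

Lemma expect_le f g : bmf f -> bmf g -> (forall t, f t <= g t) ->
  expect f <= expect g.
Proof.
move=> bf bg fg; apply: le_Rintegral => //; [exact: bmf_int|exact: bmf_int].
Qed.

Lemma expect_cst c : expect (fun=> c) = c.
Proof. by rewrite /expect /Rintegral integral_prob_cst. Qed.

Lemma expect_ge0 f : (forall t, 0 <= f t) -> 0 <= expect f.
Proof. by move=> f0; apply: Rintegral_ge0. Qed.

Lemma expect_sum n (f : 'I_n -> T -> R) : (forall i, bmf (f i)) ->
  bmf (fun t => \sum_(i < n) f i t) /\
  expect (fun t => \sum_(i < n) f i t) = \sum_(i < n) expect (f i).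
Proof.
elim: n f => [|n IH] f bf.
  rewrite big_ord0; under [X in bmf X]eq_fun do rewrite big_ord0.
  under [X in expect X]eq_fun do rewrite big_ord0.
  by rewrite expect_cst; split => //; exact: bmf_cst.
rewrite big_ord_recr/=; under [X in bmf X]eq_fun do rewrite big_ord_recr/=.
under [X in expect X]eq_fun do rewrite big_ord_recr/=.
have [b1 <-] := IH (fun i => f (widen_ord (leqnSn n) i)) (fun i => bf _).
by split; [exact: bmfD|rewrite expectD].
Qed.

End bounded_measurable.

(** * Differentiation under the expectation *)

Section derive_under_expect.
Context d (T : measurableType d) (R : realType) (P : probability T R).

Lemma is_derive_expect_exp (g q : T -> R) (th : R) : bmf g -> bmf q ->
  is_derive th (1 : R) (fun x => expect P (fun t => g t * expR (x * q t)))
    (expect P (fun t => g t * q t * expR (th * q t))).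
Proof.
move=> bg bq.
have bE x : bmf (fun t => expR (x * q t)).
  have [mq [C qC]] := bq; split.
    apply: (measurableT_comp (@measurable_expR R)).
    by apply: measurable_funM => //; exact: measurable_cst.
  exists (expR (`|x| * C)) => t; rewrite ger0_norm ?expR_ge0// ler_expR.
  by rewrite (le_trans (ler_norm _))// normrM ler_wpM2l.
have [_ [Cg gC]] := bg; have [mq [Cq qC]] := bq.
have Cg0 : 0 <= Cg by rewrite (le_trans _ (gC point)).
have Cq0 : 0 <= Cq by rewrite (le_trans _ (qC point)).
pose f (x : R) t := g t * expR (x * q t).
have d1 x t : is_derive x (1 : R) (f ^~ t) (g t * q t * expR (x * q t)).
  rewrite /f; apply: is_derive_eq.
  by rewrite /GRing.scale/=; ring.
(* On the unit interval around [th] the derivative in [x] is dominated by the constant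
   [Cg * Cq * K]. *)
pose K := expR ((`|th| + 1) * Cq).
have Kub x t : x \in `](th - 1), (th + 1)[ -> `|g t * q t * expR (x * q t)| <= Cg * Cq * K.
  rewrite in_itv/= => /andP[x1 x2].
  rewrite !normrM (ger0_norm (expR_ge0 _)) ler_pM// ?ler_pM// ?mulr_ge0// ?expR_ge0//.
  rewrite ler_expR (le_trans (ler_norm _))// normrM ler_pM//.
  by rewrite ler_norml; have := ler_norm th; have := ler_norm (- th); rewrite normrN; lra.
have I_th : `](th - 1), (th + 1)[%classic th by rewrite /= in_itv/= ltrBlDr ltrDl ltr01.
have fint x : `](th - 1), (th + 1)[%classic x -> P.-integrable setT (EFin \o f x).
  by move=> _; apply: bmf_int; exact: bmfM.
have fder x t : `](th - 1), (th + 1)[%classic x -> setT t -> derivable (f ^~ t) x 1.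
  by move=> _ _; have [] := d1 x t.
have Gint : P.-integrable setT (EFin \o (fun t : T => Cg * Cq * K)).
  by apply: bmf_int; exact: bmf_cst.
have G0 (t : T) : 0 <= Cg * Cq * K by rewrite !mulr_ge0// expR_ge0.
have Gub x t : `](th - 1), (th + 1)[%classic x -> setT t -> `|partial1of2 f x t| <= Cg * Cq * K.
  by move=> xI _; rewrite partial1of2E (@derive_val _ _ _ _ _ _ _ (d1 x t)); exact: Kub.
split.
  exact: (derivable_under_integral measurableT I_th fint fder G0 Gint Gub).
rewrite -derive1E.
rewrite (differentiation_under_integral measurableT I_th fint fder G0 Gint Gub).
apply: eq_Rintegral => t _.
by rewrite partial1of2E (@derive_val _ _ _ _ _ _ _ (d1 th t)).
Qed.

End derive_under_expect.

(** * Posterior law of a bounded sample *)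

Section posterior.
Context {R : realType} {d : nat} d' (T : measurableType d') (nu : probability T R).
Local Notation V := 'rV[R]_d.
Variables (xi : T -> V) (r : R).
Hypotheses (mxi : measurable_fun setT xi) (r0 : 0 < r).
Hypothesis xir : forall t, nrm2 (xi t) <= r ^+ 2.
Implicit Types (a c : R) (U v e : V) (g : T -> R).

Lemma bmf_dot e : bmf (fun t => dot e (xi t)).
Proof.
split; first by apply: measurable_dot => //; exact: measurable_cst.
exists (enorm e * r) => t; apply: normr_dot_le; rewrite ?enorm_ge0 ?(ltW r0)//.
by rewrite sqr_enorm.
Qed.

Lemma bmf_nrm2 : bmf (fun t => nrm2 (xi t)).
Proof.
split; first exact: measurable_nrm2.
by exists (r ^+ 2) => t; rewrite ger0_norm// nrm2_ge0.
Qed.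

Lemma bmf_coord i : bmf (fun t => xi t ord0 i).
Proof.
split; first exact: measurable_fun_coord.
exists r => t; rewrite -(@ler_pXn2r _ 2)// ?nnegrE ?(ltW r0)//.
by rewrite -normrX ger0_norm ?sqr_ge0// (le_trans (nrm2_coord _ _)).
Qed.

(* Likelihood, up to a factor independent of [t], of the sample [xi t] given that
   [U] is a draw from [N(a xi t, a I)]. *)
Definition obs_weight a U t : R := expR (dot (xi t) U - a * nrm2 (xi t) / 2).

Lemma lw_gt0 a U t : 0 < obs_weight a U t.
Proof. exact: expR_gt0. Qed.

Let lw_bound a U t : `|dot (xi t) U - a * nrm2 (xi t) / 2| <=
  enorm U * r + `|a| * r ^+ 2.
Proof.
rewrite (le_trans (ler_normB _ _))// lerD//.
  by rewrite dotC; apply: normr_dot_le; rewrite ?enorm_ge0 ?(ltW r0)// sqr_enorm.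
rewrite !normrM (ger0_norm (nrm2_ge0 _)) -mulrA ler_wpM2l//.
rewrite ger0_norm ?invr_ge0// (le_trans _ (xir t))// ler_piMr ?nrm2_ge0//.
by rewrite invf_le1// ler1n.
Qed.

Lemma bmf_lw a U : bmf (obs_weight a U).
Proof.
split.
  apply: (measurableT_comp (@measurable_expR R)); apply: measurable_funB.
    by apply: measurable_dot => //; exact: measurable_cst.
  apply: measurable_funM; last exact: measurable_cst.
  by apply: measurable_funM; [exact: measurable_cst|exact: measurable_nrm2].
exists (expR (enorm U * r + `|a| * r ^+ 2)) => t.
rewrite gtr0_norm ?lw_gt0// ler_expR.
by rewrite (le_trans (ler_norm _))// lw_bound.
Qed.

(** Partition function of the posterior. Up to the substitution [U = x / s], [a = 1 / s] it is the
    density of the noisy sample relative to [N(0, s I)]. *)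
Definition obs_mass a U : R := expect nu (obs_weight a U).

Lemma Zpost_gt0 a U : 0 < obs_mass a U.
Proof.
apply: (@lt_le_trans _ _ (expR (- (enorm U * r + `|a| * r ^+ 2)))).
  exact: expR_gt0.
rewrite -[leLHS](expect_cst nu); apply: expect_le.
- exact: bmf_cst.
- exact: bmf_lw.
move=> t; rewrite ler_expR lerNl (le_trans (ler_norm _))// normrN.
exact: lw_bound.
Qed.

Definition post_weight a U t : R := obs_weight a U t / obs_mass a U.

Lemma pw_ge0 a U t : 0 <= post_weight a U t.
Proof. by rewrite divr_ge0// ltW// ?lw_gt0 ?Zpost_gt0. Qed.

Lemma bmf_pw a U : bmf (post_weight a U).
Proof. by apply: bmfM; [exact: bmf_lw|exact: bmf_cst]. Qed.

Definition pexp a U g : R := expect nu (fun t => g t * post_weight a U t).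

Lemma pexpE a U g : bmf g -> pexp a U g = expect nu (fun t => g t * obs_weight a U t) / obs_mass a U.
Proof.
move=> bg; rewrite mulrC -expectZ; last by apply: bmfM => //; exact: bmf_lw.
by congr expect; apply/funext => t; rewrite /post_weight mulrA [RHS]mulrC.
Qed.

Lemma pexp_cst a U c : pexp a U (fun=> c) = c.
Proof.
rewrite pexpE; last exact: bmf_cst.
rewrite expectZ; last exact: bmf_lw.
by rewrite -mulrA divff ?mulr1// gt_eqF// Zpost_gt0.
Qed.

Lemma pexpD a U g1 g2 : bmf g1 -> bmf g2 ->
  pexp a U (fun t => g1 t + g2 t) = pexp a U g1 + pexp a U g2.
Proof.
move=> b1 b2; rewrite /pexp.
under [X in expect _ X]eq_fun do rewrite mulrDl.
by rewrite expectD//; apply: bmfM => //; exact: bmf_pw.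
Qed.

Lemma pexpZ a U c g : bmf g -> pexp a U (fun t => c * g t) = c * pexp a U g.
Proof.
move=> bg; rewrite /pexp.
under [X in expect _ X]eq_fun do rewrite -mulrA.
by rewrite expectZ//; apply: bmfM => //; exact: bmf_pw.
Qed.

Lemma pexpB a U g1 g2 : bmf g1 -> bmf g2 ->
  pexp a U (fun t => g1 t - g2 t) = pexp a U g1 - pexp a U g2.
Proof.
move=> b1 b2; rewrite -[X in _ + X]mulN1r -pexpZ// -pexpD//; last exact: bmfZ.
by congr (pexp _ _ _); apply/funext => t; rewrite mulN1r.
Qed.

Lemma pexp_le a U g1 g2 : bmf g1 -> bmf g2 -> (forall t, g1 t <= g2 t) ->
  pexp a U g1 <= pexp a U g2.
Proof.
move=> b1 b2 g12; apply: expect_le => [| |t].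
- by apply: bmfM => //; exact: bmf_pw.
- by apply: bmfM => //; exact: bmf_pw.
- by rewrite ler_wpM2r// pw_ge0.
Qed.

Definition mp a U : V := \row_i pexp a U (fun t => xi t ord0 i).

Lemma dot_mp a U e : dot e (mp a U) = pexp a U (fun t => dot e (xi t)).
Proof.
rewrite /dot /pexp.
under [X in expect _ X]eq_fun do rewrite mulr_suml.
have b i : bmf (fun t => e ord0 i * xi t ord0 i * post_weight a U t).
  by apply: bmfM; [apply: bmfZ; exact: bmf_coord|exact: bmf_pw].
rewrite (expect_sum nu b).2; apply: eq_bigr => i _; rewrite mxE -pexpZ//.
exact: bmf_coord.
Qed.

(** The square is expanded around the posterior mean; the posterior variance is at most the second
    moment, hence at most [r^2]. *)
Lemma pexp_nrm2D a U v c :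
  pexp a U (fun t => nrm2 (v + c *: xi t)) <= nrm2 (v + c *: mp a U) + c ^+ 2 * r ^+ 2.
Proof.
have b1 := bmf_dot v; have b2 := bmf_nrm2.
have -> : pexp a U (fun t => nrm2 (v + c *: xi t)) =
    nrm2 v + 2 * c * dot v (mp a U) + c ^+ 2 * pexp a U (fun t => nrm2 (xi t)).
  have b0 : bmf (fun t : T => nrm2 v) := bmf_cst T _.
  have b1' := bmfZ (2 * c) b1; have b2' := bmfZ (c ^+ 2) b2.
  rewrite dot_mp -(pexpZ a U _ b1) -(pexpZ a U _ b2).
  rewrite -[X in X + _ + _](pexp_cst a U) -(pexpD a U b0 b1').
  rewrite -(pexpD a U (bmfD b0 b1') b2').
  by congr (pexp _ _ _); apply/funext => t; rewrite nrm2D nrm2Z dotZr; ring.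
rewrite nrm2D nrm2Z dotZr.
have : pexp a U (fun t => nrm2 (xi t)) <= r ^+ 2.
  by rewrite -[leRHS](pexp_cst a U) pexp_le//; exact: bmf_cst.
move=> /(ler_wpM2l (sqr_ge0 c)).
have := mulr_ge0 (sqr_ge0 c) (nrm2_ge0 (mp a U)); lra.
Qed.

(** Averaging [2 dot m (xi t) <= nrm2 m + r^2] over the posterior, with [m] its mean, gives
    [2 nrm2 m <= nrm2 m + r^2]. *)
Lemma nrm2_mp a U : nrm2 (mp a U) <= r ^+ 2.
Proof.
have : dot (mp a U) (mp a U) <= (nrm2 (mp a U) + r ^+ 2) / 2.
  rewrite dot_mp -[leRHS](pexp_cst a U) pexp_le//; [exact: bmf_dot|exact: bmf_cst|].
  move=> t; have := @dot_young _ _ 1 (mp a U) (xi t) ltr01; have := xir t.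
  rewrite invr1; lra.
rewrite -/(nrm2 _); lra.
Qed.

Lemma lw_line a U v x t : obs_weight a (U + x *: v) t = obs_weight a U t * expR (x * dot v (xi t)).
Proof. by rewrite /obs_weight -expRD !dotE (dotC v); congr expR; ring. Qed.

Lemma is_derive_Zpost a U v x :
  is_derive x (1 : R) (fun y => obs_mass a (U + y *: v))
    (expect nu (fun t => dot v (xi t) * obs_weight a (U + x *: v) t)).
Proof.
have := is_derive_expect_exp nu x (bmf_lw a U) (bmf_dot v).
congr (is_derive _ _ _ _).
  by apply/funext => y; congr expect; apply/funext => t; rewrite lw_line.
by congr expect; apply/funext => t; rewrite lw_line; ring.
Qed.

(** The posterior is an exponential family in [U], so the quotient rule produces the posterior
    covariance of [g] with the linear statistic in direction [v]. *)
Lemma is_derive_pexp a U v g x : bmf g ->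
  is_derive x (1 : R) (fun y => pexp a (U + y *: v) g)
    (pexp a (U + x *: v) (fun t => g t * dot v (xi t)) -
     pexp a (U + x *: v) g * pexp a (U + x *: v) (fun t => dot v (xi t))).
Proof.
move=> bg.
have bq := bmf_dot v.
have bgq := bmfM bg bq.
have dN : is_derive x (1 : R) (fun y => expect nu (fun t => g t * obs_weight a (U + y *: v) t))
    (expect nu (fun t => g t * dot v (xi t) * obs_weight a (U + x *: v) t)).
  have := is_derive_expect_exp nu x (bmfM bg (bmf_lw a U)) bq.
  congr (is_derive _ _ _ _).
    by apply/funext => y; congr expect; apply/funext => t; rewrite lw_line mulrA.
  by congr expect; apply/funext => t; rewrite lw_line; ring.
have dZ := is_derive_Zpost a U v x.
have Z0 : obs_mass a (U + x *: v) != 0 by rewrite gt_eqF// Zpost_gt0.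
have dV := is_deriveV Z0 dZ.
have dM := is_deriveM dN dV.
move: dM; congr (is_derive _ _ _ _).
  by apply/funext => y; rewrite pexpE.
rewrite !pexpE// /GRing.scale/=; field.
exact: Z0.
Qed.

(** The mean value theorem is applied to the scalar function [dot e (mp a _)] on the segment from
    [U] to [U'], with [e] the increment itself. It writes [nrm2 e] as a covariance at an
    intermediate point, and covariances of linear statistics are controlled by [|xi| <= r]. *)
Lemma mp_lipschitz a U U' : nrm2 (mp a U' - mp a U) <= r ^+ 4 * nrm2 (U' - U).
Proof.
set e := mp a U' - mp a U; set v := U' - U.
have bp := bmf_dot e; have bq := bmf_dot v.
pose f x := pexp a (U + x *: v) (fun t => dot e (xi t)).
have df (x : R) := is_derive_pexp a U v x bp.
have [x _] := @MVT R f _ 0 1 ltr01 (fun x _ => df x)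
  (derivable_within_continuous (fun x _ => @ex_derive _ _ _ _ _ _ _ (df x))).
rewrite subr0 mulr1 /f scale1r scale0r addr0 -!dot_mp (addrC U) subrK -!dotNr -dotDr.
rewrite -/e -/(nrm2 e) => eE.
set W := U + x *: v.
set p := fun t => dot e (xi t); set q := fun t => dot v (xi t).
(* covariance bound: expand the square of c (p - E p) - (q - E q) *)
have key c : 2 * c * (pexp a W (fun t => p t * q t) - pexp a W p * pexp a W q) <=
    c ^+ 2 * (nrm2 e * r ^+ 2) + nrm2 v * r ^+ 2.
  have bpp := bmfM bp bp; have bqq := bmfM bq bq; have bpq := bmfM bp bq.
  set s := c * pexp a W p - pexp a W q.
  have : 0 <= pexp a W (fun t => (c * p t - q t - s) ^+ 2).
    by apply: expect_ge0 => t; rewrite mulr_ge0 ?pw_ge0// sqr_ge0.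
  have -> : pexp a W (fun t => (c * p t - q t - s) ^+ 2) =
     pexp a W (fun t => (c ^+ 2 * (p t * p t) + q t * q t - (2 * c) * (p t * q t))
        + ((- 2 * s * c) * p t + (2 * s) * q t + s ^+ 2)).
    by congr (pexp _ _ _); apply/funext => t; ring.
  have b0 : bmf (fun t : T => s ^+ 2) := bmf_cst T _.
  have b1 := bmfB (bmfD (bmfZ (c ^+ 2) bpp) bqq) (bmfZ (2 * c) bpq).
  have b2 := bmfD (bmfZ (- 2 * s * c) bp) (bmfZ (2 * s) bq).
  rewrite (pexpD _ _ b1 (bmfD b2 b0)) (pexpD _ _ b2 b0).
  rewrite (pexpD _ _ (bmfZ (- 2 * s * c) bp) (bmfZ (2 * s) bq)).
  rewrite (pexpB _ _ (bmfD (bmfZ (c ^+ 2) bpp) bqq) (bmfZ (2 * c) bpq)).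
  rewrite (pexpD _ _ (bmfZ (c ^+ 2) bpp) bqq).
  rewrite (pexpZ _ _ _ bpp) (pexpZ _ _ _ bpq) (pexpZ _ _ _ bp) (pexpZ _ _ _ bq) pexp_cst.
  have bnd w : pexp a W (fun t => dot w (xi t) * dot w (xi t)) <= nrm2 w * r ^+ 2.
    rewrite -[leRHS](pexp_cst a W); apply: pexp_le.
    - exact: (bmfM (bmf_dot w) (bmf_dot w)).
    - exact: bmf_cst.
    move=> t; rewrite -expr2 -real_normK ?num_real//.
    rewrite -sqr_enorm -exprMn ler_pXn2r ?nnegrE// ?mulr_ge0 ?enorm_ge0 ?(ltW r0)//.
    by apply: normr_dot_le; rewrite ?enorm_ge0 ?(ltW r0)// sqr_enorm.
  have := bnd e; rewrite -/p => /(ler_wpM2l (sqr_ge0 c)).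
  have := bnd v; rewrite -/q.
  have : 0 <= (c * pexp a W p - pexp a W q) ^+ 2 by exact: sqr_ge0.
  rewrite /s; nra.
(* The covariance equals [nrm2 e], so with [c = r^-2] the left side is [2 r^-2 nrm2 e] and half of
   it absorbs the first term on the right. *)
have := key (r ^- 2); rewrite /p /q -!dot_mp -eE.
set C := nrm2 e.
have r2 : 0 < r ^+ 2 by rewrite exprn_gt0.
move=> kc.
have {kc} : r ^+ 2 * (2 * r ^- 2 * C) <= r ^+ 2 * (r ^- 2 ^+ 2 * (nrm2 e * r ^+ 2) + nrm2 v * r ^+ 2).
  by rewrite ler_wpM2l// ltW.
have -> : r ^+ 2 * (2 * r ^- 2 * C) = 2 * C by field; rewrite gt_eqF.
have -> : r ^+ 2 * (r ^- 2 ^+ 2 * (nrm2 e * r ^+ 2) + nrm2 v * r ^+ 2) =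
  C + r ^+ 4 * nrm2 v by rewrite /C; field; rewrite gt_eqF.
lra.
Qed.
End posterior.

(** * Gaussian steps tilted by posterior draws *)

Section posterior_gauss.
Context {R : realType} {d : nat} d' (T : measurableType d') (nu : probability T R).
Local Notation V := 'rV[R]_d.
Variables (xi : T -> V) (r : R).
Hypotheses (mxi : measurable_fun setT xi) (r0 : 0 < r).
Hypothesis xir : forall t, nrm2 (xi t) <= r ^+ 2.
Implicit Types (a c s : R) (U v e y : V) (g : T -> R).

Local Notation lw := (obs_weight xi).
Local Notation Zpost := (obs_mass nu xi).
Local Notation pw := (post_weight nu xi).
Local Notation pexp := (pexp nu xi).
Local Notation mp := (mp nu xi).

Lemma measurable_lw a : measurable_fun setT (fun z : V * T => lw a z.1 z.2).
Proof.
have mx : measurable_fun setT (fun z : V * T => xi z.2).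
  exact: (measurableT_comp mxi measurable_snd).
apply: (measurableT_comp (@measurable_expR R)); apply: measurable_funB.
  exact: (measurable_dot mx measurable_fst).
apply: measurable_funM; last exact: measurable_cst.
by apply: measurable_funM; [exact: measurable_cst|exact: measurable_nrm2].
Qed.

Lemma measurable_expect_lw a g : (forall t, 0 <= g t) -> bmf g ->
  measurable_fun setT (fun U => expect nu (fun t => g t * lw a U t)).
Proof.
move=> g0 bg.
apply: (measurableT_comp (fine_measurable measurableT)).
have mg : measurable_fun setT (fun z : V * T => (g z.2 * lw a z.1 z.2)%:E).
  apply/measurable_EFinP; apply: measurable_funM; last exact: measurable_lw.
  exact: (measurableT_comp bg.1 measurable_snd).
apply: (measurable_tonelli nu mg) => z.
by rewrite lee_fin mulr_ge0// ltW// lw_gt0.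
Qed.

Lemma measurable_Zpost a : measurable_fun setT (Zpost a).
Proof.
rewrite (_ : Zpost a = (fun U => expect nu (fun t => 1 * lw a U t))).
  by apply: measurable_expect_lw => //; exact: bmf_cst.
by apply/funext => U; congr expect; apply/funext => t; rewrite mul1r.
Qed.

Lemma measurable_invZpost a : measurable_fun setT (fun U => (Zpost a U)^-1).
Proof.
rewrite (_ : (fun U => _) = (fun U => Zpost a U `^ (-1))).
  exact: (measurableT_comp (measurable_powR _) (measurable_Zpost a)).
by apply/funext => U; rewrite powR_inv1// ltW// (Zpost_gt0 _ mxi r0 xir).
Qed.

Lemma measurable_pw a : measurable_fun setT (fun z : V * T => pw a z.1 z.2).
Proof.
apply: (measurable_funM (measurable_lw a)).
exact: (measurableT_comp (measurable_invZpost a) measurable_fst).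
Qed.

Lemma measurable_mp a : measurable_fun setT (mp a).
Proof.
apply: measurable_rowP => i.
have bi := bmf_coord mxi r0 xir i.
(* Adding [r] makes the coordinate non-negative, as measurability of parameter integrals is obtained
   from Tonelli; the posterior mean shifts by the same [r]. *)
have br : bmf (fun t => xi t ord0 i + r) := bmfD bi (bmf_cst T r).
rewrite (_ : (fun U => _) =
    (fun U => expect nu (fun t => (xi t ord0 i + r) * lw a U t) / Zpost a U - r)).
  apply: measurable_funB; last exact: measurable_cst.
  apply: (measurable_funM _ (measurable_invZpost a)).
  apply: measurable_expect_lw => // t.
  have : `|xi t ord0 i| <= r.
    rewrite -(@ler_pXn2r _ 2)// ?nnegrE ?(ltW r0)//.
    by rewrite -normrX ger0_norm ?sqr_ge0// (le_trans (nrm2_coord _ _)).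
  by rewrite ler_norml; lra.
apply/funext => U; rewrite mxE -(pexpE nu mxi r0 xir a U br).
by rewrite (pexpD nu mxi r0 xir a U bi (bmf_cst T r)) (pexp_cst nu mxi r0 xir) addrK.
Qed.

Lemma expect_lwE a U g : bmf g ->
  (\int[nu]_t (g t * lw a U t)%:E = (pexp a U g * Zpost a U)%:E)%E.
Proof.
move=> bg; rewrite expectE; last exact: (bmfM bg (bmf_lw mxi r0 xir a U)).
by rewrite (pexpE nu mxi r0 xir) // divfK// gt_eqF// (Zpost_gt0 nu mxi r0 xir).
Qed.

Lemma expect_pwE a U g : bmf g ->
  (\int[nu]_t (g t * pw a U t)%:E = (pexp a U g)%:E)%E.
Proof. by move=> bg; rewrite expectE//; exact: (bmfM bg (bmf_pw nu mxi r0 xir a U)). Qed.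

Lemma lw_shift a s U v t :
  lw (a + s) (U + v) t = lw a U t * expR (dot (xi t) v - s * nrm2 (xi t) / 2).
Proof. by rewrite /lw -expRD dotDr; congr expR; ring. Qed.

(* Doob transform: a Gaussian step tilted by a posterior draw of [xi] is the
   Gaussian step reweighted by the partition functions. *)
Lemma tilted_step a s y (f : T -> V -> \bar R) : 0 < s ->
  measurable_fun setT (fun z : T * V => f z.1 z.2) ->
  (forall t u, 0 <= f t u)%E ->
  (\int[nu]_t ((pw a y t)%:E * \int[gaussP d s]_v f t (y + s *: xi t + v)%R) =
   \int[gaussP d s]_v \int[nu]_t (f t (y + v)%R * (lw (a + s) (y + v) t / Zpost a y)%:E))%E.
Proof.
move=> s0 mf f0.
have Z0 : 0 <= (Zpost a y)^-1 by rewrite invr_ge0 ltW// (Zpost_gt0 nu mxi r0 xir).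
have mfy t : measurable_fun setT (fun u : V => f t (y + u)).
  have h : measurable_fun setT (fun u : V => (t, y + u)).
    apply: measurable_fun_pair; first exact: measurable_cst.
    by apply: measurable_rowD; [exact: measurable_cst|exact: measurable_id].
  exact: (measurableT_comp mf h).
have mlwy t : measurable_fun setT (fun u : V => lw (a + s) (y + u) t / Zpost a y).
  apply: measurable_funM; last exact: measurable_cst.
  have h : measurable_fun setT (fun u : V => (y + u, t)).
    apply: measurable_fun_pair; last exact: measurable_cst.
    by apply: measurable_rowD; [exact: measurable_cst|exact: measurable_id].
  exact: (measurableT_comp (measurable_lw (a + s)) h).
pose F (z : T * V) := (f z.1 (y + z.2)%R * (lw (a + s) (y + z.2)%R z.1 / Zpost a y)%:E)%E.
have mF : measurable_fun setT F.
  apply: emeasurable_funM.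
    have h : measurable_fun setT (fun z : T * V => (z.1, y + z.2)).
      apply: measurable_fun_pair; first exact: measurable_fst.
      by apply: measurable_rowD; [exact: measurable_cst|exact: measurable_snd].
    exact: (measurableT_comp mf h).
  apply/measurable_EFinP; apply: measurable_funM; last exact: measurable_cst.
  have h : measurable_fun setT (fun z : T * V => (y + z.2, z.1)).
    apply: measurable_fun_pair; last exact: measurable_fst.
    by apply: measurable_rowD; [exact: measurable_cst|exact: measurable_snd].
  exact: (measurableT_comp (measurable_lw (a + s)) h).
have F0 z : (0 <= F z)%E.
  by rewrite mule_ge0// lee_fin mulr_ge0// ltW// lw_gt0.
rewrite -(tonelli_swap nu (gaussP d s) mF F0).
apply: eq_integral => t _.
under eq_integral do rewrite -addrA (addrC (s *: _)) .
rewrite (gauss_shift (xi t) s0 (mfy t) (fun u => f0 _ _)).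
have mfe : measurable_fun setT (fun u : V => f t (y + u)%R *
    (expR (dot (xi t) u - s * nrm2 (xi t) / 2))%:E)%E.
  apply: (emeasurable_funM (mfy t)); apply/measurable_EFinP.
  exact: measurable_exp_dot.
rewrite -(ge0_integralZl _ measurableT mfe); last 2 first.
- by move=> u _; rewrite mule_ge0// lee_fin expR_ge0.
- by rewrite lee_fin (pw_ge0 _ mxi r0 xir).
apply: eq_integral => u _; rewrite /F/= muleCA; congr *%E.
by rewrite -EFinM lw_shift /pw; congr EFin; ring.
Qed.

(** Martingale property of the likelihood: the extra factor is the Cameron-Martin density for the
    shift [s *: xi t], which has mean 1. *)
Lemma gauss_lw a s y t : 0 < s ->
  (\int[gaussP d s]_v (lw (a + s) (y + v) t)%:E = (lw a y t)%:E)%E.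
Proof.
move=> s0.
have me : measurable_fun setT (fun u : V => (expR (dot (xi t) u - s * nrm2 (xi t) / 2))%:E).
  by apply/measurable_EFinP; exact: measurable_exp_dot.
under eq_integral do rewrite lw_shift EFinM.
rewrite (ge0_integralZl _ measurableT me); last 2 first.
- by move=> u _; rewrite lee_fin expR_ge0.
- by rewrite lee_fin ltW// lw_gt0.
have h := gauss_shift (xi t) s0 (measurable_cst 1%E) (fun=> lee01).
rewrite [X in (_ * X)%E](_ : _ = 1%E) ?mule1//.
transitivity (\int[gaussP d s]_(x in setT) (cst 1 x *
    (expR (dot (xi t) x - s * nrm2 (xi t) / 2))%:E))%E.
  by apply: eq_integral => u _; rewrite /cst mul1e.
by rewrite -h; exact: integral_prob_cst.
Qed.

(** The unnormalized posterior expectation inherits the martingale property of the likelihood by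
    exchanging the two integrals. *)
Lemma gauss_Zpost a s y g : 0 < s -> bmf g -> (forall t, 0 <= g t) ->
  (\int[gaussP d s]_v (pexp (a + s) (y + v) g * Zpost (a + s) (y + v))%:E =
   (pexp a y g * Zpost a y)%:E)%E.
Proof.
move=> s0 bg g0.
under eq_integral do rewrite -expect_lwE//.
have mlwy : measurable_fun setT (fun z : T * V => (lw (a + s) (y + z.2) z.1)%:E).
  apply/measurable_EFinP.
  have h : measurable_fun setT (fun z : T * V => (y + z.2, z.1)).
    apply: measurable_fun_pair; last exact: measurable_fst.
    by apply: measurable_rowD; [exact: measurable_cst|exact: measurable_snd].
  exact: (measurableT_comp (measurable_lw (a + s)) h).
have mG : measurable_fun setT (fun z : T * V => (g z.1 * lw (a + s) (y + z.2) z.1)%:E).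
  rewrite (_ : (fun z => _) = (fun z : T * V => (g z.1)%:E * (lw (a + s) (y + z.2) z.1)%:E)%E).
    apply: (emeasurable_funM _ mlwy); apply/measurable_EFinP.
    exact: (measurableT_comp bg.1 measurable_fst).
  by apply/funext => z; rewrite EFinM.
have G0 (z : T * V) : (0 <= (g z.1 * lw (a + s) (y + z.2) z.1)%:E)%E.
  by rewrite lee_fin mulr_ge0// ltW// lw_gt0.
rewrite -(tonelli_swap nu (gaussP d s) mG G0) -expect_lwE//.
apply: eq_integral => t _ /=.
under eq_integral do rewrite EFinM.
have m1 : measurable_fun setT (fun v : V => (lw (a + s) (y + v) t)%:E).
  exact: (measurableT_comp mlwy (measurable_pair1 t)).
rewrite (ge0_integralZl _ measurableT m1); last 2 first.
- by move=> u _; rewrite lee_fin ltW// lw_gt0.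
- by rewrite lee_fin.
by rewrite gauss_lw// EFinM.
Qed.

End posterior_gauss.

(** * Localization process *)

Section gauss_op.
Context {R : realType} {d : nat}.
Local Notation V := 'rV[R]_d.
Implicit Types (s t : R) (f : V -> \bar R).

(* [normal_prob] has a junk value at standard deviation 0, where the Gaussian
   has to be a Dirac mass. *)
Definition gop s f : \bar R := if s == 0 then f 0 else (\int[gaussP d s]_v f v)%E.

Lemma gop_pos s f : 0 < s -> gop s f = (\int[gaussP d s]_v f v)%E.
Proof. by move=> s0; rewrite /gop gt_eqF. Qed.

Lemma eq_gop s f f' : f =1 f' -> gop s f = gop s f'.
Proof. by move=> ff'; rewrite (funext ff'). Qed.

Lemma gop_conv s t f : 0 <= s -> 0 < t -> measurable_fun setT f ->
  (forall u, 0 <= f u)%E ->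
  gop s (fun u => \int[gaussP d t]_v f (u + v)%R)%E = gop (s + t) f.
Proof.
rewrite le_eqVlt => /orP[/eqP <- t0 mf f0|s0 t0 mf f0].
  rewrite /gop eqxx add0r gt_eqF//.
  by apply: eq_integral => v _; rewrite add0r.
by rewrite !gop_pos ?addr_gt0// gauss_conv.
Qed.

End gauss_op.

(** * Mean square displacement of the posterior mean *)

Section mean_increment.
Context {R : realType} {d : nat} d' (T : measurableType d') (nu : probability T R).
Local Notation V := 'rV[R]_d.
Variables (xi : T -> V) (r : R).
Hypotheses (mxi : measurable_fun setT xi) (r0 : 0 < r).
Hypothesis xir : forall t, nrm2 (xi t) <= r ^+ 2.
Implicit Types (a c s : R) (U v e y : V) (g : T -> R).

Local Notation lw := (obs_weight xi).
Local Notation Zpost := (obs_mass nu xi).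
Local Notation pw := (post_weight nu xi).
Local Notation pexp := (pexp nu xi).
Local Notation mp := (mp nu xi).

Lemma nrm2B_le (x y : V) : nrm2 x <= r ^+ 2 -> nrm2 y <= r ^+ 2 ->
  nrm2 (x - y) <= (2 * r) ^+ 2.
Proof.
move=> hx hy; have := @nrm2D_young _ _ 1 x (- y) ltr01.
by rewrite nrm2N invr1 exprMn; lra.
Qed.

Lemma pexp_nrm2B a y : pexp a y (fun t => nrm2 (xi t - mp a y)) <= r ^+ 2.
Proof.
have := pexp_nrm2D nu mxi r0 xir a y (- mp a y) 1.
rewrite scale1r addNr /nrm2 dot0l add0r expr1n mul1r; apply: le_trans.
rewrite le_eqVlt; apply/orP; left; apply/eqP.
by congr (pexp _ _ _); apply/funext => t; rewrite scale1r addrC.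
Qed.

Lemma bmf_nrm2B (e : V) : bmf (fun t => nrm2 (xi t - e)).
Proof.
have mx : measurable_fun setT (fun t => xi t - e).
  by apply: measurable_rowB => //; exact: measurable_cst.
split; first exact: measurable_nrm2.
exists (2 * (r ^+ 2 + nrm2 e)) => t; rewrite ger0_norm ?nrm2_ge0//.
have := @nrm2D_young _ _ 1 (xi t) (- e) ltr01; have := xir t.
by rewrite nrm2N invr1; lra.
Qed.

Lemma bmf_dotB (e e' : V) : bmf (fun t => dot e (xi t - e')).
Proof.
under [X in bmf X]eq_fun do rewrite dotDr dotNr.
by apply: bmfB; [exact: (bmf_dot mxi r0 xir)|exact: bmf_cst].
Qed.

Lemma pexp_dotB a y (e e' : V) :
  pexp a y (fun t => dot e (xi t - e')) = dot e (mp a y - e').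
Proof.
rewrite dotDr dotNr (dot_mp nu mxi r0 xir).
rewrite -[X in _ - X](pexp_cst nu mxi r0 xir a y).
rewrite -(pexpB nu mxi r0 xir a y (bmf_dot mxi r0 xir e) (bmf_cst T _)).
by congr (pexp _ _ _); apply/funext => t; rewrite dotDr dotNr.
Qed.

Lemma dot_diff_le c (x x' z : V) : 0 < c -> nrm2 (x - x') <= c ^+ 2 * nrm2 z ->
  dot x z <= c * nrm2 z + dot x' z.
Proof.
move=> c0 h; have k0 : 0 < c^-1 by rewrite invr_gt0.
have := dot_young (x - x') z k0; rewrite invrK dotDl dotNl.
have := ler_wpM2l (ltW k0) h.
have -> : c^-1 * (c ^+ 2 * nrm2 z) = c * nrm2 z by field; rewrite gt_eqF.
lra.
Qed.

(** Transition density of the localization process from [(a, y)] to strength [a + s], relative to a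
    Gaussian increment [v] of variance [s]. *)
Definition mass_ratio a s y v : R := Zpost (a + s) (y + v) / Zpost a y.

Lemma Zratio_ge0 a s y v : 0 <= mass_ratio a s y v.
Proof. by rewrite divr_ge0// ltW// (Zpost_gt0 nu mxi r0 xir). Qed.

Lemma measurable_addy y : measurable_fun setT (fun v : V => y + v).
Proof. by apply: measurable_rowD; [exact: measurable_cst|exact: measurable_id]. Qed.

Lemma measurable_Zratio a s y : measurable_fun setT (mass_ratio a s y).
Proof.
apply: measurable_funM; last exact: measurable_cst.
exact: (measurableT_comp (measurable_Zpost nu mxi (a + s)) (measurable_addy y)).
Qed.

(** Under the localization kernel the posterior expectations form a martingale. *)
Lemma gop_Zratio a s y g : 0 <= s -> bmf g -> (forall t, 0 <= g t) ->
  gop s (fun v => (pexp (a + s) (y + v) g * mass_ratio a s y v)%:E) = (pexp a y g)%:E.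
Proof.
have Z0 := Zpost_gt0 nu mxi r0 xir a y.
rewrite le_eqVlt => /orP[/eqP <- bg g0|s0 bg g0].
  by rewrite /gop eqxx /mass_ratio !addr0 divff ?mulr1// gt_eqF.
rewrite gop_pos//.
under eq_integral do rewrite /mass_ratio mulrA EFinM.
have mZ : measurable_fun setT (fun v => (pexp (a + s) (y + v) g * Zpost (a + s) (y + v))%:E).
  apply/measurable_EFinP.
  rewrite (_ : (fun v => _) = (fun v => expect nu (fun t => g t * lw (a + s) (y + v) t))).
    exact: (measurableT_comp (measurable_expect_lw nu mxi (a + s) g0 bg) (measurable_addy y)).
  apply/funext => v; rewrite (pexpE nu mxi r0 xir _ _ bg) divfK//.
  exact: lt0r_neq0 (Zpost_gt0 nu mxi r0 xir _ _).
rewrite (ge0_integralZr _ measurableT mZ); last 2 first.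
- move=> v _; rewrite lee_fin; apply: mulr_ge0.
    by apply: expect_ge0 => t; rewrite mulr_ge0 ?(pw_ge0 nu mxi r0 xir).
  exact: ltW (Zpost_gt0 nu mxi r0 xir _ _).
- by rewrite lee_fin invr_ge0 ltW.
rewrite (gauss_Zpost nu mxi r0 xir a y s0 bg g0).
by rewrite -EFinM mulfK// gt_eqF.
Qed.

Lemma gop_Zratio1 a s y : 0 <= s -> gop s (fun v => (mass_ratio a s y v)%:E) = 1%E.
Proof.
move=> s0; have := @gop_Zratio a s y (fun=> 1) s0 (bmf_cst T 1) (fun=> ler01).
rewrite (pexp_cst nu mxi r0 xir) => <-; apply: eq_gop => v.
by rewrite (pexp_cst nu mxi r0 xir) mul1r.
Qed.

(** By the tower property [E |D(U)|^2 = E <D(U), xi - m0>], where [U = y + s xi + v] for a posterior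
    draw [xi] and [D] is the displacement from [m0]. Replacing [U] by [y + s m0 + v], which does not
    depend on the draw, makes the inner product centered. By the Lipschitz bound the replacement
    costs [s r^2 |xi - m0|^2], of mean at most [s r^4]. *)
Lemma mean_increment a s y : 0 <= s ->
  (gop s (fun v => (nrm2 (mp (a + s) (y + v) - mp a y) * mass_ratio a s y v)%:E) <=
   (s * r ^+ 4)%:E)%E.
Proof.
rewrite le_eqVlt => /orP[/eqP <-|s0].
  by rewrite /gop eqxx !addr0 subrr /nrm2 dot0l !mul0r.
set m0 := mp a y; pose D u := mp (a + s) u - m0; pose C := (2 * r) ^+ 2.
have mpr := nrm2_mp nu mxi r0 xir.
have r2 : 0 <= 2 * r by rewrite mulr_ge0// ltW.
have DC u x : nrm2 x <= r ^+ 2 -> `|dot (D u) (x - m0)| <= C.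
  move=> hx; rewrite /C expr2; exact: (normr_dot_le r2 r2 (nrm2B_le (mpr _ _) (mpr _ _)) (nrm2B_le hx (mpr _ _))).
(* [C] bounds the inner product in absolute value, so [f] is non-negative; it enters both sides with
   total mass 1 and is cancelled before the comparison. *)
pose f t u := (dot (D u) (xi t - m0) + C)%:E.
have f0 t u : (0 <= f t u)%E.
  by rewrite lee_fin; have := DC u _ (xir t); rewrite ler_norml; lra.
have mD : measurable_fun setT D.
  apply: measurable_rowB; first exact: (measurable_mp nu mxi r0 xir).
  exact: measurable_cst.
have mxm : measurable_fun setT (fun t => xi t - m0).
  by apply: measurable_rowB => //; exact: measurable_cst.
have mf : measurable_fun setT (fun z : T * V => f z.1 z.2).
  apply/measurable_EFinP; apply: measurable_funD; last exact: measurable_cst.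
  apply: measurable_dot; first exact: (measurableT_comp mD measurable_snd).
  exact: (measurableT_comp mxm measurable_fst).
(* Given the endpoint [y + v] the draw has mean [mp (a + s) (y + v)], so the inner product averages
   to [nrm2 (D (y + v))]. *)
have := tilted_step nu mxi r0 xir a y s0 mf f0.
rewrite [X in _ = X -> _](_ : _ =
  \int[gaussP d s]_v ((nrm2 (D (y + v)) * mass_ratio a s y v)%:E +
     C%:E * (mass_ratio a s y v)%:E))%E; last first.
  apply: eq_integral => v _.
  have bD : bmf (fun t => dot (D (y + v)) (xi t - m0) + C).
    by apply: bmfD; [exact: bmf_dotB|exact: bmf_cst].
  under eq_integral do rewrite -EFinM mulrA EFinM.
  have mg : measurable_fun setT
      (fun t => ((dot (D (y + v)) (xi t - m0) + C) * lw (a + s) (y + v) t)%:E).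
    by apply/measurable_EFinP; apply: (bmfM bD (bmf_lw mxi r0 xir _ _)).1.
  rewrite (ge0_integralZr _ measurableT mg); last 2 first.
  - move=> t _; rewrite lee_fin mulr_ge0 ?(ltW (lw_gt0 _ _ _ _))//.
    by have := f0 t (y + v); rewrite lee_fin.
  - by rewrite lee_fin invr_ge0 ltW// (Zpost_gt0 nu mxi r0 xir).
  rewrite (expect_lwE nu mxi r0 xir _ _ bD) -EFinM -EFinM -EFinD; congr EFin.
  rewrite (pexpD nu mxi r0 xir _ _ (bmf_dotB _ _) (bmf_cst T C)).
  rewrite (pexp_cst nu mxi r0 xir) pexp_dotB -/(D (y + v)) -/(nrm2 _) /mass_ratio; ring.
have mZr : measurable_fun setT (fun v => (mass_ratio a s y v)%:E).
  by apply/measurable_EFinP; exact: measurable_Zratio.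
have mDZ : measurable_fun setT (fun v => (nrm2 (D (y + v)) * mass_ratio a s y v)%:E).
  apply/measurable_EFinP; apply: measurable_funM; last exact: measurable_Zratio.
  exact: (measurable_nrm2 (measurableT_comp mD (measurable_addy y))).
have Zr0 (v : V) : [set: V] v -> (0 <= (mass_ratio a s y v)%:E)%E.
  by move=> _; rewrite lee_fin Zratio_ge0.
have DZ0 (v : V) : [set: V] v -> (0 <= (nrm2 (D (y + v)) * mass_ratio a s y v)%:E)%E.
  by move=> _; rewrite lee_fin mulr_ge0 ?nrm2_ge0 ?Zratio_ge0.
have C0 : 0 <= C by exact: sqr_ge0.
have CE : (0 <= C%:E)%E by rewrite lee_fin.
rewrite (ge0_integralD _ measurableT DZ0 mDZ); last 2 first.
- by move=> v vT; rewrite mule_ge0// Zr0.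
- by apply: (emeasurable_funM _ mZr); exact: measurable_cst.
rewrite (ge0_integralZl _ measurableT mZr Zr0 CE).
rewrite -[X in (C%:E * X)%E](gop_pos _ s0) (gop_Zratio1 _ _ (ltW s0)) mule1.
rewrite -[X in (X + C%:E)%E](gop_pos _ s0).
set q := gop s _ => qE.
have q0 : (0 <= q)%E by rewrite /q gop_pos//; exact: integral_ge0.
suff : (q + C%:E <= (s * r ^+ 4)%:E + C%:E)%E by rewrite leeD2rE.
rewrite -qE {qE}.
(* The majorant: [D] is evaluated at the state reached with drift [m0], and the first term pays for
   the change of argument. *)
pose h (z : T * V) := s * r ^+ 2 * nrm2 (xi z.1 - m0) +
  (dot (D (y + s *: m0 + z.2)) (xi z.1 - m0) + C).
have fh t v : (f t (y + s *: xi t + v)%R <= (h (t, v))%:E)%E.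
  set u1 := y + s *: xi t + v; set u0 := y + s *: m0 + v.
  suff H : dot (D u1) (xi t - m0) <= s * r ^+ 2 * nrm2 (xi t - m0) + dot (D u0) (xi t - m0).
    have H' := lerD H (lexx C).
    rewrite -addrA in H'.
    have H'E : ((dot (D u1) (xi t - m0) + C)%:E <= (s * r ^+ 2 * nrm2 (xi t - m0) +
        (dot (D u0) (xi t - m0) + C))%:E)%E by rewrite lee_fin; exact H'.
    exact H'E.
  apply: dot_diff_le; first by rewrite mulr_gt0// exprn_gt0.
  have -> : D u1 - D u0 = mp (a + s) u1 - mp (a + s) u0.
    by rewrite /D opprB addrA subrK.
  apply: le_trans (mp_lipschitz nu mxi r0 xir _ _ _) _.
  have -> : u1 - u0 = s *: (xi t - m0).
    by rewrite /u1 /u0 scalerBr; apply/rowP => i; rewrite !mxE; ring.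
  by rewrite nrm2Z le_eqVlt; apply/orP; left; apply/eqP; ring.
have h0 z : (0 <= (h z)%:E)%E.
  rewrite lee_fin /h addr_ge0//; last first.
    by have := DC (y + s *: m0 + z.2) _ (xir z.1); rewrite ler_norml; lra.
  by rewrite !mulr_ge0 ?nrm2_ge0 ?exprn_ge0 ?(ltW r0) ?(ltW s0).
have mDs : measurable_fun setT (fun v : V => D (y + s *: m0 + v)).
  exact: (measurableT_comp mD (measurable_addy _)).
have mh : measurable_fun setT (fun z => (h z)%:E).
  apply/measurable_EFinP; apply: measurable_funD.
    apply: measurable_funM; first exact: measurable_cst.
    exact: (measurable_nrm2 (measurableT_comp mxm measurable_fst)).
  apply: measurable_funD; last exact: measurable_cst.
  apply: measurable_dot; first exact: (measurableT_comp mDs measurable_snd).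
  exact: (measurableT_comp mxm measurable_fst).
have mpwE : measurable_fun setT (fun t => (pw a y t)%:E).
  by apply/measurable_EFinP; exact: (bmf_pw nu mxi r0 xir a y).1.
have pwE0 t : (0 <= (pw a y t)%:E)%E by rewrite lee_fin (pw_ge0 nu mxi r0 xir).
have mhw : measurable_fun setT (fun z : T * V => (h z)%:E * (pw a y z.1)%:E)%E.
  exact: (emeasurable_funM mh (measurableT_comp mpwE measurable_fst)).
have hw0 (z : T * V) : (0 <= (h z)%:E * (pw a y z.1)%:E)%E by rewrite mule_ge0.
apply: (@le_trans _ _ (\int[nu]_t \int[gaussP d s]_v ((h (t, v))%:E * (pw a y t)%:E))%E).
  have mfs t : measurable_fun setT (fun v : V => f t (y + s *: xi t + v)).
    have h1 : measurable_fun setT (fun v : V => (t, y + s *: xi t + v)).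
      by apply: measurable_fun_pair; [exact: measurable_cst|exact: measurable_addy].
    exact: (measurableT_comp mf h1).
  apply: ge0_le_integral.
  - exact: measurableT.
  - by move=> t _; rewrite mule_ge0//; exact: integral_ge0.
  - apply: (emeasurable_funM mpwE).
    have h2 : measurable_fun setT (fun z : T * V => f z.1 (y + s *: xi z.1 + z.2)).
      have h3 : measurable_fun setT (fun z : T * V => (z.1, y + s *: xi z.1 + z.2)).
        apply: measurable_fun_pair; first exact: measurable_fst.
        apply: measurable_rowD; last exact: measurable_snd.
        apply: measurable_rowD; first exact: measurable_cst.
        apply: measurable_rowZ; first exact: measurable_cst.
        exact: (measurableT_comp mxi measurable_fst).
      exact: (measurableT_comp mf h3).
    exact: (measurable_tonelli (gaussP d s) h2 (fun z => f0 _ _)).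
  - exact: (measurable_tonelli (gaussP d s) mhw hw0).
  move=> t _.
  have mht : measurable_fun setT (fun v => (h (t, v))%:E).
    exact: (measurableT_comp mh (measurable_pair1 t)).
  rewrite (ge0_integralZr _ measurableT mht (fun v _ => h0 _) (pwE0 t)) muleC.
  apply: lee_wpmul2r => //.
  apply: ge0_le_integral.
  - exact: measurableT.
  - by move=> v _; exact: f0.
  - exact: mfs.
  - exact: mht.
  - by move=> v _; exact: fh.
rewrite (tonelli_swap nu (gaussP d s) mhw hw0).
rewrite -[leRHS](integral_prob_cst (gaussP d s)).
apply: ge0_le_integral.
- exact: measurableT.
- by move=> v _; apply: integral_ge0 => t _; exact: hw0.
- have mhw' : measurable_fun setT (fun z : V * T => (h (z.2, z.1))%:E * (pw a y z.2)%:E)%E.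
    have sw : measurable_fun setT (fun z : V * T => (z.2, z.1)).
      by apply: measurable_fun_pair; [exact: measurable_snd|exact: measurable_fst].
    exact: (measurableT_comp mhw sw).
  exact: (measurable_tonelli nu mhw' (fun z => hw0 (z.2, z.1))).
- exact: measurable_cst.
move=> v _; under eq_integral do rewrite /= -EFinM.
have b1 := bmfZ (s * r ^+ 2) (bmf_nrm2B m0).
have b2 := bmf_dotB (D (y + s *: m0 + v)) m0.
have b3 := bmf_cst T C.
rewrite (expect_pwE nu mxi r0 xir _ _ (bmfD b1 (bmfD b2 b3))).
rewrite (pexpD nu mxi r0 xir _ _ b1 (bmfD b2 b3)).
rewrite (pexpD nu mxi r0 xir _ _ b2 b3) (pexpZ nu mxi r0 xir _ _ _ (bmf_nrm2B m0)).
rewrite pexp_dotB subrr dot0r add0r (pexp_cst nu mxi r0 xir) EFinD leeD2rE//.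
rewrite lee_fin -mulrA ler_wpM2l ?(ltW s0)// (_ : r ^+ 4 = r ^+ 2 * r ^+ 2); last by ring.
by rewrite ler_wpM2l ?sqr_ge0// pexp_nrm2B.
Qed.

End mean_increment.

(** * Coupling of a localization step with its driving noise *)

Section localization.
Context {R : realType} {d : nat} d' (T : measurableType d') (nu : probability T R).
Local Notation V := 'rV[R]_d.
Variables (xi : T -> V) (r : R).
Hypotheses (mxi : measurable_fun setT xi) (r0 : 0 < r).
Hypothesis xir : forall t, nrm2 (xi t) <= r ^+ 2.
Implicit Types (a c s : R) (U v e y : V) (g : T -> R).

Local Notation lw := (obs_weight xi).
Local Notation Zpost := (obs_mass nu xi).
Local Notation pw := (post_weight nu xi).
Local Notation pexp := (pexp nu xi).
Local Notation mp := (mp nu xi).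
Local Notation Zratio := (mass_ratio nu xi).

Definition drift_error (dS : measure_display) (S : measurableType dS) a s
    (U G : V * S -> V) (z : V * S) : V :=
  U z - z.1 - G z - s *: mp a z.1.

(* [U] runs the observation process from signal strength [a] and state [y] up
   to signal strength [a + s] under the density [w y], [G] is its driving
   Gaussian noise; the increments are coupled so that [U - y - G] stays close
   to the drift [s *: mp a y] frozen at the start. *)
Definition localizes a s (E : R) : Prop :=
  exists (dS : measure_display) (S : measurableType dS) (P : probability S R)
    (w : V * S -> R) (U G : V * S -> V),
  [/\ measurable_fun setT w, measurable_fun setT U, measurable_fun setT G &
      forall z, 0 <= w z] /\
  forall y, [/\
    forall f : V -> \bar R, measurable_fun setT f -> (forall u, 0 <= f u)%E ->
      (\int[P]_t (f (U (y, t)) * (w (y, t))%:E) =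
       gop s (fun v => f (y + v)%R * (Zratio a s y v)%:E))%E,
    forall f : V -> \bar R, measurable_fun setT f -> (forall u, 0 <= f u)%E ->
      (\int[P]_t (f (G (y, t)) * (w (y, t))%:E) = gop s f)%E,
    exists C, forall t, nrm2 (drift_error a s U G (y, t)) <= C,
    forall e, exists C, (forall t, 0 <= dot e (drift_error a s U G (y, t)) + C) /\
      (\int[P]_t ((dot e (drift_error a s U G (y, t)) + C) * w (y, t))%:E = C%:E)%E &
    (\int[P]_t (nrm2 (drift_error a s U G (y, t)) * w (y, t))%:E <= E%:E)%E].

Lemma localizes0 a : localizes a 0 0.
Proof.
exists default_measure_display, unit, (\d_tt : probability unit R),
  (fun=> 1), (fun z => z.1), (fun=> 0); split.
  split; [exact: measurable_cst|exact: measurable_fst|exact: measurable_cst|by []].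
move=> y.
have err t : drift_error a 0 (fun z : V * unit => z.1) (fun=> 0) (y, t) = 0.
  by rewrite /drift_error /= subrr scale0r !subr0.
split.
- move=> f mf f0; rewrite /gop eqxx /= integral_prob_cst.
  rewrite /Zratio !addr0 divff// gt_eqF//; exact: (Zpost_gt0 nu mxi r0 xir).
- by move=> f mf f0; rewrite /gop eqxx /= integral_prob_cst mule1.
- by exists 0 => t; rewrite err /nrm2 dot0l.
- move=> e; exists 0; split => [t|]; first by rewrite err dot0r addr0.
  by under eq_integral do rewrite err dot0r addr0 mul0r; rewrite integral_prob_cst.
- by under eq_integral do rewrite err /nrm2 dot0l mul0r; rewrite integral_prob_cst.
Qed.

Lemma localizes_le a s E E' : E <= E' -> localizes a s E -> localizes a s E'.
Proof.
move=> EE' [dS [S [P [w [U [G [m H]]]]]]].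
exists dS, S, P, w, U, G; split => // y; have [h1 h2 h3 h4 h5] := H y.
by split => //; apply: (le_trans h5); rewrite lee_fin.
Qed.

Section step.
Variables (dS : measure_display) (S : measurableType dS) (P : probability S R).
Variables (w : V * S -> R) (U G : V * S -> V) (a s k : R) (y : V).
Hypotheses (mw : measurable_fun setT w) (mU : measurable_fun setT U)
  (w0 : forall z, 0 <= w z).

Let Q : probability (T * V)%type R := (nu \x gaussP d k)%E.
Let P' : probability (S * (T * V))%type R := (P \x Q)%E.

(** Density of the extended chain: the old one times the posterior density of a draw made at the
    state reached so far. The Gaussian increment keeps its reference law. *)
Definition step_w (z : V * (S * (T * V))) : R :=
  w (z.1, z.2.1) * pw (a + s) (U (z.1, z.2.1)) z.2.2.1.

Lemma measurable_step_fst :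
  measurable_fun setT (fun z : V * (S * (T * V)) => (z.1, z.2.1)).
Proof.
apply: measurable_fun_pair; first exact: measurable_fst.
exact: (measurableT_comp measurable_fst measurable_snd).
Qed.

Lemma measurable_step_w : measurable_fun setT step_w.
Proof.
apply: measurable_funM; first exact: (measurableT_comp mw measurable_step_fst).
have h : measurable_fun setT (fun z : V * (S * (T * V)) => (U (z.1, z.2.1), z.2.2.1)).
  apply: measurable_fun_pair; first exact: (measurableT_comp mU measurable_step_fst).
  apply: (measurableT_comp measurable_fst).
  exact: (measurableT_comp measurable_snd measurable_snd).
exact: (measurableT_comp (measurable_pw nu mxi r0 xir (a + s)) h).
Qed.

Lemma step_w_ge0 z : 0 <= step_w z.
Proof. by rewrite mulr_ge0// (pw_ge0 nu mxi r0 xir). Qed.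

Lemma integral_step (F : S -> T -> V -> \bar R) :
  measurable_fun setT (fun q : S * (T * V) => F q.1 q.2.1 q.2.2) ->
  (forall t u v, 0 <= F t u v)%E ->
  (\int[P']_q (F q.1 q.2.1 q.2.2 * (step_w (y, q))%:E) =
   \int[P]_t (\int[nu]_u ((pw (a + s) (U (y, t)) u)%:E *
     \int[gaussP d k]_v F t u v) * (w (y, t))%:E))%E.
Proof.
move=> mF F0.
have mwy : measurable_fun setT (fun q => (step_w (y, q))%:E).
  apply/measurable_EFinP; exact: (measurableT_comp measurable_step_w (measurable_pair1 y)).
have mFw : measurable_fun setT (fun q : S * (T * V) =>
    F q.1 q.2.1 q.2.2 * (step_w (y, q))%:E)%E by exact: emeasurable_funM.
have Fw0 (q : S * (T * V)) : (0 <= F q.1 q.2.1 q.2.2 * (step_w (y, q))%:E)%E.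
  by rewrite mule_ge0// lee_fin step_w_ge0.
rewrite (tonelli_prod P Q mFw Fw0).
apply: eq_integral => t _ /=.
rewrite (tonelli_prod nu (gaussP d k) (measurableT_comp mFw (measurable_pair1 t)) (fun q => Fw0 (t, q))) /=.
have mFt : measurable_fun setT (fun q : T * V => F t q.1 q.2).
  exact: (measurableT_comp mF (measurable_pair1 t)).
have mFtu u : measurable_fun setT (fun v : V => F t u v).
  exact: (measurableT_comp mFt (measurable_pair1 u)).
have mI : measurable_fun setT (fun u => (pw (a + s) (U (y, t)) u)%:E *
     \int[gaussP d k]_v F t u v)%E.
  apply: emeasurable_funM.
    by apply/measurable_EFinP; exact: (bmf_pw nu mxi r0 xir (a + s) (U (y, t))).1.
  exact: (measurable_tonelli (gaussP d k) mFt (fun q => F0 _ _ _)).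
have pwE u : (0 <= (pw (a + s) (U (y, t)) u)%:E)%E.
  by rewrite lee_fin (pw_ge0 nu mxi r0 xir).
have wE : (0 <= (w (y, t))%:E)%E by rewrite lee_fin.
rewrite -(ge0_integralZr _ measurableT mI _ wE); last first.
  by move=> u _; rewrite mule_ge0//; exact: integral_ge0.
apply: eq_integral => u _.
rewrite /step_w /=.
have pE : (0 <= (w (y, t) * pw (a + s) (U (y, t)) u)%:E)%E.
  by rewrite lee_fin mulr_ge0// (pw_ge0 nu mxi r0 xir).
rewrite (ge0_integralZr _ measurableT (mFtu u) (fun v _ => F0 _ _ _) pE).
by rewrite EFinM muleC -muleA muleC.
Qed.

End step.

Lemma integral_pw_cst a y (c : \bar R) : (0 <= c)%E ->
  (\int[nu]_u ((pw a y u)%:E * c) = c)%E.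
Proof.
move=> c0.
have mpwE : measurable_fun setT (fun t => (pw a y t)%:E).
  by apply/measurable_EFinP; exact: (bmf_pw nu mxi r0 xir a y).1.
rewrite (ge0_integralZr _ measurableT mpwE _ c0); last first.
  by move=> t _; rewrite lee_fin (pw_ge0 nu mxi r0 xir).
have := expect_pwE nu mxi r0 xir a y (bmf_cst T 1).
rewrite (pexp_cst nu mxi r0 xir) => h.
rewrite [X in (X * c)%E](_ : _ = 1%E) ?mul1e// -h.
by apply: eq_integral => t _; rewrite mul1r.
Qed.

(** One more substep changes the drift error by [k *: (xi - m0)]. Given the past, [xi] has the
    current posterior mean, with a fluctuation of second moment at most [r^2]; the distance of that
    mean from [m0] is controlled by [mean_increment]. *)
Lemma localizes_step a s k c E : 0 <= s -> 0 < k -> 0 < c -> localizes a s E ->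
  localizes a (s + k)
    ((1 + c) * E + (1 + c^-1) * (k ^+ 2 * (s * r ^+ 4)) + k ^+ 2 * r ^+ 2).
Proof.
move=> s0 k0 c0 [dS [S [P [w [U [G [[mw mU mG w0] H]]]]]]].
pose Q : probability (T * V)%type R := (nu \x gaussP d k)%E.
pose P' : probability (S * (T * V))%type R := (P \x Q)%E.
pose tv (z : V * (S * (T * V))) := (z.1, z.2.1).
(* The drift of the substep is a posterior draw, and the chain and its driving noise [G'] receive
   the same Gaussian increment, which therefore cancels in the error. *)
pose U' (z : V * (S * (T * V))) := U (tv z) + k *: xi z.2.2.1 + z.2.2.2.
pose G' (z : V * (S * (T * V))) := G (tv z) + z.2.2.2.
have mtv : measurable_fun setT tv by exact: measurable_step_fst.
have m3 : measurable_fun setT (fun z : V * (S * (T * V)) => z.2.2.2).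
  apply: (measurableT_comp measurable_snd).
  exact: (measurableT_comp measurable_snd measurable_snd).
have m2 : measurable_fun setT (fun z : V * (S * (T * V)) => xi z.2.2.1).
  apply: (measurableT_comp mxi); apply: (measurableT_comp measurable_fst).
  exact: (measurableT_comp measurable_snd measurable_snd).
exists _, (S * (T * V))%type, P', (step_w w U a s), U', G'; split.
  split.
  - exact: measurable_step_w.
  - apply: measurable_rowD m3; apply: measurable_rowD.
      exact: (measurableT_comp mU mtv).
    by apply: measurable_rowZ m2; exact: measurable_cst.
  - exact: (measurable_rowD (measurableT_comp mG mtv) m3).
  - exact: step_w_ge0.
move=> y; have [h1 h2 [B h3] h4 h5] := H y.
set m0 := mp a y; pose D t := drift_error a s U G (y, t).
have mpr := nrm2_mp nu mxi r0 xir.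
have DE q : drift_error a (s + k) U' G' (y, q) = D q.1 + k *: (xi q.2.1 - m0).
  rewrite /D /drift_error /U' /G' /tv /= -/m0 scalerDl scalerBr.
  by apply/rowP => i; rewrite !mxE; ring.
have mUy : measurable_fun setT (fun t => U (y, t)).
  exact: (measurableT_comp mU (measurable_pair1 y)).
have mGy : measurable_fun setT (fun t => G (y, t)).
  exact: (measurableT_comp mG (measurable_pair1 y)).
have mwy : measurable_fun setT (fun t => (w (y, t))%:E).
  by apply/measurable_EFinP; exact: (measurableT_comp mw (measurable_pair1 y)).
have wE0 t : (0 <= (w (y, t))%:E)%E by rewrite lee_fin.
have mD : measurable_fun setT D.
  exact: (measurable_rowB (measurable_rowB (measurable_rowB mUy (measurable_cst y)) mGy)
    (measurable_cst (s *: m0))).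
have mxm : measurable_fun setT (fun t => xi t - m0).
  by apply: measurable_rowB => //; exact: measurable_cst.
have mass1 : (\int[P]_t (w (y, t))%:E = 1)%E.
  have := h2 (cst 1%E) (measurable_cst _) (fun=> lee01).
  have -> : gop s (cst 1%E : V -> \bar R) = 1%E.
    rewrite /gop; case: (s == 0); first by [].
    exact: integral_prob_cst.
  by move=> <-; apply: eq_integral => t _; rewrite [RHS]mul1e.
have step := integral_step P a s k y mw mU w0.
have mDz : measurable_fun setT (fun q : S * (T * V) => D q.1 + k *: (xi q.2.1 - m0)).
  apply: measurable_rowD; first exact: (measurableT_comp mD measurable_fst).
  apply: measurable_rowZ; first exact: measurable_cst.
  apply: (measurableT_comp mxm).
  exact: (measurableT_comp measurable_fst measurable_snd).
(* functions of the drift error do not depend on the Gaussian increment *)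
have stepD (F : V -> R) : measurable_fun setT F ->
    (forall t u, 0 <= F (D t + k *: (xi u - m0))) ->
    (forall v, bmf (fun u => F (v + k *: (xi u - m0)))) ->
    (\int[P']_q (F (drift_error a (s + k) U' G' (y, q)) * step_w w U a s (y, q))%:E =
     \int[P]_t (pexp (a + s) (U (y, t)) (fun u => F (D t + k *: (xi u - m0))) * w (y, t))%:E)%E.
  move=> mF F0 bF.
  pose FF (t : S) (u : T) (v : V) := (F (D t + k *: (xi u - m0)))%:E.
  have mFF : measurable_fun setT (fun q : S * (T * V) => FF q.1 q.2.1 q.2.2).
    by apply/measurable_EFinP; exact: (measurableT_comp mF mDz).
  have FF0 t u v : (0 <= FF t u v)%E by rewrite lee_fin.
  transitivity (\int[P']_q (FF q.1 q.2.1 q.2.2 * (step_w w U a s (y, q))%:E))%E.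
    by apply: eq_integral => q _; rewrite DE EFinM.
  rewrite [LHS](step FF mFF FF0).
  apply: eq_integral => t _; rewrite EFinM; congr (_ * _)%E.
  rewrite -(expect_pwE nu mxi r0 xir _ _ (bF _)).
  by apply: eq_integral => u _; rewrite integral_prob_cst muleC EFinM.
split.
- move=> f mf f0.
  pose F (t : S) (u : T) (v : V) := f (U (y, t) + k *: xi u + v).
  have mF : measurable_fun setT (fun q : S * (T * V) => F q.1 q.2.1 q.2.2).
    apply: (measurableT_comp mf); apply: measurable_rowD.
      apply: measurable_rowD; first exact: (measurableT_comp mUy measurable_fst).
      apply: measurable_rowZ; first exact: measurable_cst.
      apply: (measurableT_comp mxi).
      exact: (measurableT_comp measurable_fst measurable_snd).
    exact: (measurableT_comp measurable_snd measurable_snd).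
  rewrite [LHS](step F mF (fun _ _ _ => f0 _)) {mF}.
  pose Hf u := (\int[gaussP d k]_v (f (u + v)%R * (Zratio (a + s) k u v)%:E))%E.
  have mfu u : measurable_fun setT (fun v : V => f (u + v)).
    exact: (measurableT_comp mf (measurable_addy u)).
  have mHi : measurable_fun setT (fun z : V * V => f (z.1 + z.2)%R * (Zratio (a + s) k z.1 z.2)%:E)%E.
    have madd : measurable_fun setT (fun z : V * V => z.1 + z.2).
      exact: (measurable_rowD measurable_fst measurable_snd).
    apply: (emeasurable_funM (measurableT_comp mf madd)); apply/measurable_EFinP.
    apply: measurable_funM; first exact: (measurableT_comp (measurable_Zpost nu mxi _) madd).
    exact: (measurableT_comp (measurable_invZpost nu mxi r0 xir _) measurable_fst).
  have Hi0 (z : V * V) : (0 <= f (z.1 + z.2)%R * (Zratio (a + s) k z.1 z.2)%:E)%E.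
    by rewrite mule_ge0// lee_fin (Zratio_ge0 nu mxi r0 xir).
  have mH := measurable_tonelli (gaussP d k) mHi Hi0.
  have H0 u : (0 <= Hf u)%E by apply: integral_ge0 => v _; exact: (Hi0 (u, v)).
  have mf2 : measurable_fun setT (fun z : T * V => f z.2).
    exact: (measurableT_comp mf measurable_snd).
  transitivity (\int[P]_t (Hf (U (y, t)) * (w (y, t))%:E))%E.
    apply: eq_integral => t _; congr (_ * _)%E.
    have := @tilted_step _ _ _ _ nu xi r mxi r0 xir (a + s) k (U (y, t)) (fun=> f) k0 mf2 (fun _ _ => f0 _).
    rewrite /F => ->.
    apply: eq_integral => v _.
    have mlwE : measurable_fun setT (fun u => (lw (a + s + k) (U (y, t) + v) u / Zpost (a + s) (U (y, t)))%:E).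
      apply/measurable_EFinP; apply: measurable_funM; last exact: measurable_cst.
      exact: (bmf_lw mxi r0 xir _ _).1.
    rewrite (ge0_integralZl _ measurableT mlwE _ (f0 _)); last first.
      move=> u _; rewrite lee_fin mulr_ge0 ?(ltW (lw_gt0 _ _ _ _))// invr_ge0.
      exact: ltW (Zpost_gt0 nu mxi r0 xir _ _).
    congr (_ * _)%E.
    have bc : bmf (fun u : T => (Zpost (a + s) (U (y, t)))^-1) by exact: bmf_cst.
    under eq_integral do rewrite mulrC.
    by rewrite (expect_lwE nu mxi r0 xir _ _ bc) (pexp_cst nu mxi r0 xir) mulrC.
  rewrite (h1 Hf mH H0).
  have ms : measurable_fun setT (fun v => f (y + v)%R * (Zratio a (s + k) y v)%:E)%E.
    apply: (emeasurable_funM (mfu y)); apply/measurable_EFinP.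
    exact: (measurable_Zratio nu mxi a (s + k) y).
  rewrite -(gop_conv s0 k0 ms); last first.
    by move=> v; rewrite mule_ge0// lee_fin (Zratio_ge0 nu mxi r0 xir).
  apply: eq_gop => v.
  have mv : measurable_fun setT (fun v' => f (y + v + v')%R * (Zratio (a + s) k (y + v) v')%:E)%E.
    exact: (measurableT_comp mHi (measurable_pair1 (y + v))).
  rewrite -(ge0_integralZr _ measurableT mv); last 2 first.
  - by move=> v' _; exact: (Hi0 (y + v, v')).
  - by rewrite lee_fin (Zratio_ge0 nu mxi r0 xir).
  (* The transition densities of the two legs multiply to that of the whole: the intermediate mass
     cancels. *)
  apply: eq_integral => v' _; rewrite addrA -muleA; congr (_ * _)%E.
  rewrite -EFinM /Zratio !addrA mulrA divfK//.
  exact: lt0r_neq0 (Zpost_gt0 nu mxi r0 xir _ _).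
- move=> f mf f0.
  pose F (t : S) (u : T) (v : V) := f (G (y, t) + v).
  have mF : measurable_fun setT (fun q : S * (T * V) => F q.1 q.2.1 q.2.2).
    apply: (measurableT_comp mf); apply: measurable_rowD.
      exact: (measurableT_comp mGy measurable_fst).
    exact: (measurableT_comp measurable_snd measurable_snd).
  rewrite [LHS](step F mF (fun _ _ _ => f0 _)) {mF}.
  have mJ : measurable_fun setT (fun u : V => \int[gaussP d k]_v f (u + v)%R)%E.
    have madd : measurable_fun setT (fun z : V * V => f (z.1 + z.2)).
      by apply: (measurableT_comp mf); exact: (measurable_rowD measurable_fst measurable_snd).
    exact: (measurable_tonelli (gaussP d k) madd (fun z => f0 _)).
  have J0 u : (0 <= \int[gaussP d k]_v f (u + v)%R)%E by apply: integral_ge0.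
  rewrite -(gop_conv s0 k0 mf f0) -(h2 _ mJ J0).
  by apply: eq_integral => t _; rewrite /F (integral_pw_cst _ _ (J0 _)).
- exists (2 * B + 2 * (k ^+ 2 * (2 * r) ^+ 2)) => q; rewrite DE.
  have := @nrm2D_young _ _ 1 (D q.1) (k *: (xi q.2.1 - m0)) ltr01.
  rewrite nrm2Z invr1; have := h3 q.1; rewrite -/(D q.1).
  have := ler_wpM2l (sqr_ge0 k) (nrm2B_le (xir q.2.1) (mpr a y)); rewrite -/m0; lra.
- move=> e; have [C [C0 hC]] := h4 e.
  pose K := enorm e * (2 * r).
  have eK u : `|dot e (xi u - m0)| <= K.
    have r2 : 0 <= 2 * r by rewrite mulr_ge0// ltW.
    apply: (normr_dot_le (enorm_ge0 e) r2 _ (nrm2B_le (xir u) (mpr a y))).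
    by rewrite sqr_enorm.
  pose g u := k * dot e (xi u - m0) + k * K.
  have g0 u : 0 <= g u.
    by rewrite /g -mulrDr mulr_ge0 ?(ltW k0)//; have := eK u; rewrite ler_norml; lra.
  have bg : bmf g.
    by apply: bmfD; [apply: bmfZ; exact: (bmf_dotB mxi r0 xir)|exact: bmf_cst].
  (* The shift grows by [k * K], which keeps the contribution of the new draw non-negative. *)
  exists (C + k * K); split => [q|].
    by rewrite DE dotDr dotZr; have := C0 q.1; have := g0 q.2.1; rewrite /g -/(D _); lra.
  have mdot : measurable_fun setT (fun v : V => dot e v + (C + k * K)).
    apply: measurable_funD; last exact: measurable_cst.
    by apply: measurable_dot; [exact: measurable_cst|exact: measurable_id].
  rewrite (stepD (fun v => dot e v + (C + k * K)) mdot); last 2 first.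
  - by move=> t u; rewrite dotDr dotZr; have := C0 t; have := g0 u; rewrite /g -/(D _); lra.
  - move=> v; under [X in bmf X]eq_fun do rewrite dotDr dotZr.
    apply: bmfD; last exact: bmf_cst.
    by apply: bmfD; [exact: bmf_cst|apply: bmfZ; exact: (bmf_dotB mxi r0 xir)].
  have pE t : pexp (a + s) (U (y, t)) (fun u => dot e (D t + k *: (xi u - m0)) + (C + k * K)) =
      (dot e (D t) + C) + pexp (a + s) (U (y, t)) g.
    rewrite -[X in X + pexp _ _ _](pexp_cst nu mxi r0 xir (a + s) (U (y, t))).
    rewrite -(pexpD nu mxi r0 xir _ _ (bmf_cst T _) bg).
    congr (pexp _ _ _); apply/funext => u; rewrite /g dotDr dotZr; ring.
  under eq_integral do rewrite pE mulrDl EFinD.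
  have mpg : measurable_fun setT (fun u => (pexp (a + s) u g)%:E).
    apply/measurable_EFinP.
    rewrite (_ : (fun u => _) = (fun u => k * dot e (mp (a + s) u - m0) + k * K)).
      apply: measurable_funD; last exact: measurable_cst.
      apply: measurable_funM; first exact: measurable_cst.
      apply: measurable_dot; first exact: measurable_cst.
      apply: measurable_rowB; last exact: measurable_cst.
      exact: (measurable_mp nu mxi r0 xir).
    apply/funext => u; rewrite /g (pexpD nu mxi r0 xir _ _ (bmfZ k (bmf_dotB mxi r0 xir e m0)) (bmf_cst T _)).
    rewrite (pexpZ nu mxi r0 xir _ _ _ (bmf_dotB mxi r0 xir e m0)).
    by rewrite (pexp_dotB nu mxi r0 xir) (pexp_cst nu mxi r0 xir).
  have pg0 u : (0 <= (pexp (a + s) u g)%:E)%E.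
    by rewrite lee_fin; apply: expect_ge0 => t; rewrite mulr_ge0// (pw_ge0 nu mxi r0 xir).
  rewrite (ge0_integralD _ measurableT); last 4 first.
  - by move=> t _; rewrite lee_fin mulr_ge0// C0.
  - apply/measurable_EFinP; apply: measurable_funM; last exact/measurable_EFinP.
    apply: measurable_funD; last exact: measurable_cst.
    by apply: measurable_dot; first exact: measurable_cst.
  - by move=> t _; rewrite EFinM mule_ge0.
  - under eq_fun do rewrite EFinM.
    exact: (emeasurable_funM (measurableT_comp mpg mUy) mwy).
  rewrite hC EFinD; congr (_ + _)%E.
  transitivity (gop s (fun v => (pexp (a + s) (y + v) g * Zratio a s y v)%:E)).
    under eq_integral do rewrite EFinM.
    by rewrite (h1 _ mpg pg0); apply: eq_gop => v; rewrite EFinM.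
  (* By the martingale property the posterior mean at the intermediate state averages to [m0], so
     the new term of the error is centered. *)
  rewrite (gop_Zratio nu mxi r0 xir a y s0 bg g0) /g.
  rewrite (pexpD nu mxi r0 xir _ _ (bmfZ k (bmf_dotB mxi r0 xir e m0)) (bmf_cst T _)).
  rewrite (pexpZ nu mxi r0 xir _ _ _ (bmf_dotB mxi r0 xir e m0)).
  by rewrite (pexp_dotB nu mxi r0 xir) (pexp_cst nu mxi r0 xir) subrr dot0r mulr0 add0r.
- have bN v : bmf (fun u => nrm2 (v + k *: (xi u - m0))).
    have -> : (fun u => nrm2 (v + k *: (xi u - m0))) =
        (fun u => nrm2 v + (2 * k) * dot v (xi u - m0) + k ^+ 2 * nrm2 (xi u - m0)).
      by apply/funext => u; rewrite nrm2D nrm2Z dotZr; ring.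
    apply: bmfD; last by apply: bmfZ; exact: (bmf_nrm2B mxi xir).
    by apply: bmfD; [exact: bmf_cst|apply: bmfZ; exact: (bmf_dotB mxi r0 xir)].
  have mnrm : measurable_fun setT (@nrm2 R d).
    by apply: measurable_nrm2; exact: measurable_id.
  rewrite (stepD nrm2 mnrm (fun t u => nrm2_ge0 _) bN).
  pose M u := nrm2 (mp (a + s) u - m0).
  have mM : measurable_fun setT (fun u => (M u)%:E).
    apply/measurable_EFinP; apply: measurable_nrm2; apply: measurable_rowB.
      exact: (measurable_mp nu mxi r0 xir).
    exact: measurable_cst.
  have M0 u : (0 <= (M u)%:E)%E by rewrite lee_fin nrm2_ge0.
  have c1 : 0 <= 1 + c by rewrite addr_ge0// ltW.
  have c2 : 0 <= 1 + c^-1 by rewrite addr_ge0// invr_ge0 ltW.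
  have mND : measurable_fun setT (fun t => (nrm2 (D t) * w (y, t))%:E).
    apply/measurable_EFinP; apply: measurable_funM; last exact/measurable_EFinP.
    exact: measurable_nrm2.
  have mMw : measurable_fun setT (fun t => (M (U (y, t)))%:E * (w (y, t))%:E)%E.
    exact: (emeasurable_funM (measurableT_comp mM mUy) mwy).
  have ND0 t : (0 <= (nrm2 (D t) * w (y, t))%:E)%E by rewrite lee_fin mulr_ge0// nrm2_ge0.
  have Mw0 t : (0 <= (M (U (y, t)))%:E * (w (y, t))%:E)%E by rewrite mule_ge0.
  have cE1 : (0 <= (1 + c)%:E)%E by rewrite lee_fin.
  have cE2 : (0 <= ((1 + c^-1) * k ^+ 2)%:E)%E by rewrite lee_fin mulr_ge0// sqr_ge0.
  have cE3 : (0 <= (k ^+ 2 * r ^+ 2)%:E)%E by rewrite lee_fin mulr_ge0 ?sqr_ge0.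
  have mA : measurable_fun setT (fun t => (1 + c)%:E * (nrm2 (D t) * w (y, t))%:E)%E.
    by apply: (emeasurable_funM _ mND); exact: measurable_cst.
  have mB : measurable_fun setT (fun t =>
      ((1 + c^-1) * k ^+ 2)%:E * ((M (U (y, t)))%:E * (w (y, t))%:E))%E.
    by apply: (emeasurable_funM _ mMw); exact: measurable_cst.
  have mC : measurable_fun setT (fun t => (k ^+ 2 * r ^+ 2)%:E * (w (y, t))%:E)%E.
    by apply: (emeasurable_funM _ mwy); exact: measurable_cst.
  have mBC := emeasurable_funD mB mC.
  apply: (@le_trans _ _ (\int[P]_t ((1 + c)%:E * (nrm2 (D t) * w (y, t))%:E +
      (((1 + c^-1) * k ^+ 2)%:E * ((M (U (y, t)))%:E * (w (y, t))%:E) +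
       (k ^+ 2 * r ^+ 2)%:E * (w (y, t))%:E)))%E).
    apply: ge0_le_integral.
    - exact: measurableT.
    - move=> t _; rewrite lee_fin mulr_ge0//; apply: expect_ge0 => u.
      by rewrite mulr_ge0 ?nrm2_ge0 ?(pw_ge0 nu mxi r0 xir).
    - under eq_fun do rewrite EFinM.
      apply: (emeasurable_funM _ mwy).
      have mj : measurable_fun setT (fun z : S * T =>
          (nrm2 (D z.1 + k *: (xi z.2 - m0)) * pw (a + s) (U (y, z.1)) z.2)%:E).
        apply/measurable_EFinP; apply: measurable_funM.
          apply: measurable_nrm2; apply: measurable_rowD.
            exact: (measurableT_comp mD measurable_fst).
          apply: measurable_rowZ; first exact: measurable_cst.
          exact: (measurableT_comp mxm measurable_snd).
        have mUz : measurable_fun setT (fun z : S * T => (U (y, z.1), z.2)).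
          apply: measurable_fun_pair; last exact: measurable_snd.
          exact: (measurableT_comp mUy measurable_fst).
        exact: (measurableT_comp (measurable_pw nu mxi r0 xir (a + s)) mUz).
      have := measurable_tonelli nu mj.
      rewrite (_ : (fun x => _) = (fun t => (pexp (a + s) (U (y, t))
          (fun u => nrm2 (D t + k *: (xi u - m0))))%:E)).
        apply=> z; rewrite lee_fin mulr_ge0 ?nrm2_ge0//.
        exact: (pw_ge0 nu mxi r0 xir).
      apply/funext => t; rewrite /= (expect_pwE nu mxi r0 xir _ _ (bN _)) //.
    - exact: (emeasurable_funD mA mBC).
    move=> t _; rewrite -!EFinM -!EFinD lee_fin mulrA mulrA -mulrDl -mulrDl.
    apply: ler_wpM2r => //.
    (* Averaging over the draw first replaces it by its posterior mean at the cost [k^2 r^2]; only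
       then does Young's inequality with weight [c] separate [D t] from the displacement of the
       mean. *)
    have := pexp_nrm2D nu mxi r0 xir (a + s) (U (y, t)) (D t - k *: m0) k.
    have -> : (fun u => nrm2 (D t - k *: m0 + k *: xi u)) =
        (fun u => nrm2 (D t + k *: (xi u - m0))).
      by apply/funext => u; rewrite scalerBr addrCA addrC -addrA addrC.
    have -> : D t - k *: m0 + k *: mp (a + s) (U (y, t)) =
        D t + k *: (mp (a + s) (U (y, t)) - m0).
      by rewrite scalerBr addrCA addrC -addrA addrC.
    have := nrm2D_young (D t) (k *: (mp (a + s) (U (y, t)) - m0)) c0.
    by rewrite nrm2Z /M; lra.
  rewrite (ge0_integralD _ measurableT _ mA _ mBC); last 2 first.
  - by move=> t _; rewrite mule_ge0.
  - by move=> t _; rewrite adde_ge0// mule_ge0.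
  rewrite (ge0_integralD _ measurableT _ mB _ mC); last 2 first.
  - by move=> t _; rewrite mule_ge0.
  - by move=> t _; rewrite mule_ge0.
  rewrite (ge0_integralZl _ measurableT mND (fun t _ => ND0 t) cE1).
  rewrite (ge0_integralZl _ measurableT mMw (fun t _ => Mw0 t) cE2).
  rewrite (ge0_integralZl _ measurableT mwy (fun t _ => wE0 t) cE3).
  rewrite mass1 mule1 (h1 _ mM M0) -addrA [leRHS]EFinD.
  apply: leeD; first by rewrite [leRHS]EFinM lee_wpmul2l.
  rewrite [leRHS]EFinD; apply: leeD; last by [].
  have -> : (1 + c^-1) * (k ^+ 2 * (s * r ^+ 4)) = (1 + c^-1) * k ^+ 2 * (s * r ^+ 4).
    by ring.
  rewrite [leRHS]EFinM; apply: lee_wpmul2l => //.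
  rewrite (eq_gop _ (f' := fun v => (M (y + v) * Zratio a s y v)%:E)).
    exact: (mean_increment nu mxi r0 xir a y s0).
  by move=> v; rewrite EFinM.
Qed.


(** In other words [1 / (n + 2) <= 2 (sqrt (n + 1) - sqrt n)], which lets the harmonic sum in the
    next lemma telescope. It follows from [(q - p) (q + p) = 1], [p <= q] and [2 q <= q^2 + 1]. *)
Lemma sqrtn_gap (n : nat) :
  2 * (n%:R + 2) * Num.sqrt (n%:R : R) + 1 <= 2 * (n%:R + 2) * Num.sqrt n.+1%:R.
Proof.
have p2 : Num.sqrt (n%:R : R) ^+ 2 = n%:R by rewrite sqr_sqrtr.
have q2 : Num.sqrt (n.+1%:R : R) ^+ 2 = n%:R + 1 by rewrite sqr_sqrtr// natr1.
have := sqrtr_ge0 (n%:R : R); have := sqrtr_ge0 (n.+1%:R : R).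
have : Num.sqrt (n%:R : R) <= Num.sqrt n.+1%:R by rewrite ler_wsqrtr// ler_nat.
move: p2 q2; set p := Num.sqrt _; set q := Num.sqrt _ => p2 q2 pq q0 p0.
have h1 : (q - p) * (q + p) = 1 by rewrite -subr_sqr p2 q2; ring.
have h2 : 4 * q * (q - p) <= 2 * (n%:R + 2) * (q - p).
  rewrite ler_wpM2r ?subr_ge0//; have := sqr_ge0 (q - 1); nra.
have : 2 * (q + p) * (q - p) <= 4 * q * (q - p).
  by rewrite ler_wpM2r ?subr_ge0//; lra.
nra.
Qed.

(** With [c = 1 / (n + 1)] in [localizes_step], the bound divided by [n + 1] grows at step [n] by
    [k^3 r^4 n + k^2 r^2 / (n + 2)]. The first terms add up to at most [k^3 r^4 n^2 / 2], the second
    to at most [2 k^2 r^2 sqrt n]; this crude bound of a harmonic sum suffices because it vanishes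
    as [k] tends to 0 with [n k] fixed. *)
Lemma localizes_iter a k (n : nat) : 0 < k ->
  localizes a (n%:R * k)
    (k ^+ 3 * r ^+ 4 * (n%:R + 1) * n%:R ^+ 2 / 2 +
     2 * k ^+ 2 * r ^+ 2 * (n%:R + 1) * Num.sqrt n%:R).
Proof.
move=> k0; elim: n => [|n IH].
  rewrite mul0r sqrtr0 mulr0 expr0n mulr0 mul0r addr0; exact: localizes0.
have n1 : 0 < (n%:R + 1 : R)^-1 by rewrite invr_gt0 ltr_wpDl.
have nk : 0 <= n%:R * k by rewrite mulr_ge0// ltW.
have nkS : n.+1%:R * k = n%:R * k + k by rewrite -natr1 mulrDl mul1r.
rewrite [X in localizes _ X _]nkS.
refine (localizes_le _ (localizes_step nk k0 n1 IH)).
have S1 : n.+1%:R = n%:R + 1 :> R by rewrite natr1.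
rewrite invrK S1 {IH nkS}.
set N : R := n%:R; have N0 : 0 <= N by exact: ler0n.
have N1 : N + 1 != 0 by rewrite gt_eqF// ltr_wpDl.
set p := Num.sqrt N; set q := Num.sqrt (N + 1).
have -> : (1 + (N + 1)^-1) * (k ^+ 3 * r ^+ 4 * (N + 1) * N ^+ 2 / 2 +
    2 * k ^+ 2 * r ^+ 2 * (N + 1) * p) =
    (N + 2) * (k ^+ 3 * r ^+ 4 * N ^+ 2 / 2 + 2 * k ^+ 2 * r ^+ 2 * p) by field.
have h1 : 2 * (N + 2) * p + 1 <= 2 * (N + 2) * q.
  by have := sqrtn_gap n; rewrite S1.
have {}h1 := ler_wpM2l (mulr_ge0 (sqr_ge0 k) (sqr_ge0 r)) h1.
have h2 : 0 <= k ^+ 3 * r ^+ 4 * (N + 2).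
  by rewrite !mulr_ge0 ?exprn_ge0 ?(ltW k0) ?(ltW r0)// addr_ge0.
lra.
Qed.

(** The strength [A] is cut into [N^2] substeps, so that the square root in the bound is [N]. For
    large [N] the systematic part approaches [r^4 A^3 / 2] and the fluctuation of the draws is of
    order [1 / N]. *)
Lemma localizes_exists a A : 0 < A -> localizes a A (3 / 4 * (r ^+ 4 * A ^+ 3)).
Proof.
move=> A0.
(* From [N >= 3] the first part is at most 5/9 of [r^4 A^3], and from [N >= 21 / (r^2 A)] the second
   is at most 20/189 of it; the total stays below 3/4. *)
pose N : nat := (Num.truncn (21 / (r ^+ 2 * A))).+3.
have rA : 0 < r ^+ 2 * A by rewrite mulr_gt0// exprn_gt0.
have N3 : 3 <= (N%:R : R) by rewrite (ler_nat _ 3).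
have N0 : (N%:R : R) != 0 by rewrite gt_eqF// (lt_le_trans _ N3).
have NA : 21 <= r ^+ 2 * A * N%:R.
  rewrite mulrC -ler_pdivrMr//.
  have := truncnS_gt (21 / (r ^+ 2 * A)); move/ltW/le_trans; apply.
  by rewrite ler_nat /N ltnS ltnW.
pose k := A / N%:R ^+ 2.
have k0 : 0 < k by rewrite divr_gt0// exprn_gt0// (lt_le_trans _ N3).
have := localizes_iter a (N ^ 2) k0.
rewrite natrX.
have -> : N%:R ^+ 2 * k = A by rewrite /k mulrC divfK// expf_neq0.
apply: localizes_le.
rewrite sqrtr_sqr (ger0_norm (ler0n _ _)) /k.
move: N3 N0 NA; set M := N%:R => M3 M0 MA.
have -> : (A / M ^+ 2) ^+ 3 * r ^+ 4 * (M ^+ 2 + 1) * (M ^+ 2) ^+ 2 / 2 =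
   r ^+ 4 * A ^+ 3 * (1 + M^-1 ^+ 2) / 2 by field.
have -> : 2 * (A / M ^+ 2) ^+ 2 * r ^+ 2 * (M ^+ 2 + 1) * M =
   2 * (r ^+ 2 * A ^+ 2) * M^-1 * (1 + M^-1 ^+ 2) by field.
set i := M^-1.
have i0 : 0 <= i by rewrite invr_ge0; lra.
have i3 : i <= 1 / 3 by rewrite /i -div1r ler_pdivrMr ?(lt_le_trans _ M3)//; lra.
have iA : 21 * i <= r ^+ 2 * A.
  by rewrite /i ler_pdivrMr ?(lt_le_trans _ M3)//.
have i2 : i ^+ 2 <= 1 / 9 by nra.
have X0 : 0 <= r ^+ 4 * A ^+ 3 by rewrite mulr_ge0// exprn_ge0// ltW.
have Y0 : 0 <= r ^+ 2 * A ^+ 2 by rewrite mulr_ge0// exprn_ge0// ltW.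
have h1 : r ^+ 4 * A ^+ 3 * (1 + i ^+ 2) / 2 <= 5 / 9 * (r ^+ 4 * A ^+ 3) by nra.
have h2 : 21 * (r ^+ 2 * A ^+ 2 * i) <= r ^+ 4 * A ^+ 3.
  have -> : r ^+ 4 * A ^+ 3 = r ^+ 2 * A ^+ 2 * (r ^+ 2 * A) by ring.
  by rewrite mulrCA ler_wpM2l.
have Yi : 0 <= r ^+ 2 * A ^+ 2 * i by rewrite mulr_ge0.
have h3 : 2 * (r ^+ 2 * A ^+ 2) * i * (1 + i ^+ 2) <= 2 * (10 / 9) * (r ^+ 2 * A ^+ 2 * i) by nra.
lra.
Qed.

End localization.

(** * Couplings of one sampler step *)

Section weighted_image.
Context d d' dY (X : measurableType d) (S : measurableType d') (Y : measurableType dY)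
  (R : realType).

(** Normalizing divides by the total mass 1 and so only changes the bundled structure. *)
Lemma probability_of_measure d0 (X0 : measurableType d0) (m : {measure set X0 -> \bar R}) : m setT = 1%E ->
  exists p : probability X0 R, forall A, p A = m A.
Proof.
move=> m1; exists (mnormalize m (\d_point : probability X0 R)) => A.
change (mnormalize m (\d_point : probability X0 R) A = m A).
rewrite /mnormalize; case: ifPn => [/orP[]/eqP h|_].
- by have := etrans (esym m1) h; move/eqP; rewrite onee_eq0.
- by have := etrans (esym m1) h.
- transitivity (m A * (fine 1)^-1%:E)%E; last by rewrite /= invr1 mule1.
  by congr (_ * (fine _)^-1%:E)%E; exact: m1.
Qed.

(** This glues to a coupling [pi] a random input [t] whose conditional law given [x] has density
    [w (x, _)], and then maps by [phi]. Each stage of the sampler extends its coupling in this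
    way. *)
Lemma weighted_image (pi : probability X R) (P : probability S R)
    (w : X * S -> R) (phi : X * S -> Y) :
  measurable_fun setT w -> (forall z, 0 <= w z) ->
  (forall x, \int[P]_t (w (x, t))%:E = 1)%E -> measurable_fun setT phi ->
  exists g : probability Y R, forall f : Y -> \bar R,
    measurable_fun setT f -> (forall y, 0 <= f y)%E ->
    (\int[g]_y f y = \int[pi]_x \int[P]_t (f (phi (x, t)) * (w (x, t))%:E))%E.
Proof.
move=> mw w0 w1 mphi.
pose Q : probability (X * S)%type R := (pi \x P)%E.
pose m := mpush mphi (mdensity Q mw w0).
have mE f : measurable_fun setT f -> (forall y, 0 <= f y)%E ->
    (\int[m]_y f y = \int[pi]_x \int[P]_t (f (phi (x, t)) * (w (x, t))%:E))%E.
  move=> mf f0.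
  rewrite (ge0_integral_mpush mphi _ mf f0).
  have mfp := measurableT_comp mf mphi.
  rewrite (ge0_integral_density Q mw w0 mfp (fun z => f0 _)).
  have mfw : measurable_fun setT (fun z => f (phi z) * (w z)%:E)%E.
    by apply: (emeasurable_funM mfp); exact/measurable_EFinP.
  apply: (tonelli_prod pi P mfw) => z.
  by rewrite mule_ge0// lee_fin.
have m1 : m setT = 1%E.
  have <- : (\int[m]_y 1 = m setT)%E by rewrite integral_cst// mul1e.
  rewrite (mE (fun=> 1%E) (measurable_cst _) (fun=> lee01)).
  rewrite -[RHS](integral_prob_cst pi); apply: eq_integral => x _.
  by under eq_integral do rewrite mul1e; exact: w1.
have [p pE] := probability_of_measure m1.
exists p => f mf f0; rewrite -(mE f mf f0).
by apply: eq_measure_integral => A mA _; exact: pE.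
Qed.

End weighted_image.

(** * Centered cross terms in squared distances *)

Section gauss_parity.
Context {R : realType} {d : nat}.
Local Notation V := 'rV[R]_d.
Implicit Types (s : R) (e v : V).

Definition dpos e v : R := Num.max 0 (dot e v).
Definition dneg e v : R := Num.max 0 (- dot e v).

Lemma dposB e v : dpos e v - dneg e v = dot e v.
Proof. by rewrite /dpos /dneg; case: (leP 0 (dot e v)) => h; case: (leP 0 (- dot e v)); lra. Qed.

Lemma dpos_ge0 e v : 0 <= dpos e v.
Proof. by rewrite le_max lexx. Qed.

Lemma dneg_ge0 e v : 0 <= dneg e v.
Proof. by rewrite le_max lexx. Qed.

Lemma measurable_dpos e : measurable_fun setT (dpos e).
Proof.
apply: measurable_maxr; first exact: measurable_cst.
by apply: measurable_dot; [exact: measurable_cst|exact: measurable_id].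
Qed.

Lemma measurable_dneg e : measurable_fun setT (dneg e).
Proof.
apply: measurable_maxr; first exact: measurable_cst.
apply: measurableT_comp; first exact: oppr_measurable.
by apply: measurable_dot; [exact: measurable_cst|exact: measurable_id].
Qed.

(** Centering of a linear form, expressed by non-negative integrals: the symmetry [v |-> - v]
    exchanges the two parts, and the second moment makes them finite. *)
Lemma gauss_parity e s : 0 < s ->
  exists I : R, (\int[gaussP d s]_v (dpos e v)%:E = I%:E)%E /\
    (\int[gaussP d s]_v (dneg e v)%:E = I%:E)%E.
Proof.
move=> s0.
have mp : measurable_fun setT (fun v : V => (dpos e v)%:E).
  by apply/measurable_EFinP; exact: measurable_dpos.
have mn : measurable_fun setT (fun v : V => (nrm2 v)%:E).
  by apply/measurable_EFinP; apply: measurable_nrm2; exact: measurable_id.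
have p0 v : (0 <= (dpos e v)%:E)%E by rewrite lee_fin dpos_ge0.
have eqI : (\int[gaussP d s]_v (dneg e v)%:E = \int[gaussP d s]_v (dpos e v)%:E)%E.
  rewrite -(gauss_opp s0 mp p0); apply: eq_integral => v _.
  by rewrite /dpos /dneg dotNr.
suff fin : (\int[gaussP d s]_v (dpos e v)%:E)%E \is a fin_num.
  by exists (fine (\int[gaussP d s]_v (dpos e v)%:E)%E); rewrite eqI fineK.
rewrite ge0_fin_numE; last exact: integral_ge0.
apply: (@le_lt_trans _ _ (\int[gaussP d s]_v ((nrm2 e)%:E + (nrm2 v)%:E))%E).
  apply: ge0_le_integral.
  - exact: measurableT.
  - by move=> v _; exact: p0.
  - exact: mp.
  - by apply: (emeasurable_funD _ mn); exact: measurable_cst.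
  move=> v _; rewrite -EFinD lee_fin /dpos ge_max addr_ge0 ?nrm2_ge0//=.
  have := dot_young e v ltr01; rewrite invr1.
  have := nrm2_ge0 e; have := nrm2_ge0 v; lra.
rewrite (ge0_integralD _ measurableT _ (measurable_cst _) _ mn); last 2 first.
- by move=> v _; rewrite lee_fin nrm2_ge0.
- by move=> v _; rewrite lee_fin nrm2_ge0.
rewrite integral_prob_cst (le_lt_trans (leeD2l _ (gauss_nrm2 d s0)))//.
by rewrite -EFinD ltry.
Qed.

End gauss_parity.

Section orthogonal_expansion.
Context {R : realType} {d : nat} dS (S : measurableType dS) (P : probability S R).
Local Notation V := 'rV[R]_d.
Variables (w : S -> R) (D G : S -> V) (A E : R).
Hypotheses (mw : measurable_fun setT w) (w0 : forall t, 0 <= w t)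
  (mD : measurable_fun setT D) (mG : measurable_fun setT G) (A0 : 0 < A).
Hypothesis wG : forall f : V -> \bar R, measurable_fun setT f ->
  (forall u, 0 <= f u)%E -> (\int[P]_t (f (G t) * (w t)%:E) = gop A f)%E.
Hypothesis D_centered : forall e, exists C, (forall t, 0 <= dot e (D t) + C) /\
  (\int[P]_t ((dot e (D t) + C) * w t)%:E = C%:E)%E.
Hypothesis DE : (\int[P]_t (nrm2 (D t) * w t)%:E <= E%:E)%E.

(** The terms linear in [D] and [G] against [b] integrate to zero, so [nrm2 b] keeps the coefficient
    1 and errors add up as squares. The product of [D] and [G] has no such cancellation and is
    absorbed into the factors 2. *)
Lemma orthogonal_expansion (b : V) (u e : R) :
  (\int[P]_t (nrm2 (b + u *: D t + e *: G t) * w t)%:E <=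
   (nrm2 b + 2 * u ^+ 2 * E + 2 * e ^+ 2 * (d%:R * A))%:E)%E.
Proof.
have [C [C0 hC]] := D_centered ((2 * u) *: b).
have [I [Ip In]] := gauss_parity ((2 * e) *: b) A0.
have mwE : measurable_fun setT (fun t => (w t)%:E) by exact/measurable_EFinP.
have mass1 : (\int[P]_t (w t)%:E = 1)%E.
  have := wG (measurable_cst 1%E) (fun=> lee01).
  rewrite (gop_pos _ A0) integral_prob_cst => <-.
  by apply: eq_integral => t _; rewrite [RHS]mul1e.
pose W (f : S -> R) := (\int[P]_t (f t * w t)%:E)%E.
have mEM (f : S -> R) : measurable_fun setT f -> measurable_fun setT (fun t => (f t * w t)%:E).
  by move=> mf; apply/measurable_EFinP; exact: measurable_funM.
have WD (f g : S -> R) : measurable_fun setT f -> measurable_fun setT g ->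
    (forall t, 0 <= f t) -> (forall t, 0 <= g t) -> W (fun t => f t + g t) = (W f + W g)%E.
  move=> mf mg f0 g0; rewrite /W.
  under eq_integral do rewrite mulrDl EFinD.
  rewrite (ge0_integralD _ measurableT _ (mEM _ mf) _ (mEM _ mg))//.
  - by move=> t _; rewrite lee_fin mulr_ge0.
  - by move=> t _; rewrite lee_fin mulr_ge0.
have WZ (c : R) (f : S -> R) : measurable_fun setT f -> (forall t, 0 <= f t) -> 0 <= c ->
    W (fun t => c * f t) = (c%:E * W f)%E.
  move=> mf f0 c0; rewrite /W.
  under eq_integral do rewrite -mulrA EFinM.
  rewrite (ge0_integralZl _ measurableT (mEM _ mf))//.
  by move=> t _; rewrite lee_fin mulr_ge0.
have Wcst (c : R) : 0 <= c -> W (fun=> c) = c%:E.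
  move=> c0; rewrite /W; under eq_integral do rewrite EFinM.
  have cE : (0 <= c%:E)%E by rewrite lee_fin.
  have wE (t : S) : [set: S] t -> (0 <= (w t)%:E)%E by move=> _; rewrite lee_fin.
  by rewrite (ge0_integralZl _ measurableT mwE wE cE) mass1 mule1.
pose x t := nrm2 (b + u *: D t + e *: G t).
pose n t := dneg ((2 * e) *: b) (G t).
pose p t := dpos ((2 * e) *: b) (G t).
pose q t := dot ((2 * u) *: b) (D t) + C.
have mx : measurable_fun setT x.
  apply: measurable_nrm2; apply: measurable_rowD.
    apply: measurable_rowD; first exact: measurable_cst.
    by apply: measurable_rowZ => //; exact: measurable_cst.
  by apply: measurable_rowZ => //; exact: measurable_cst.
have mn : measurable_fun setT n by exact: (measurableT_comp (measurable_dneg _) mG).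
have mpp : measurable_fun setT p by exact: (measurableT_comp (measurable_dpos _) mG).
have mq : measurable_fun setT q.
  apply: measurable_funD; last exact: measurable_cst.
  by apply: measurable_dot => //; exact: measurable_cst.
have mnD : measurable_fun setT (fun t => nrm2 (D t)) by exact: measurable_nrm2.
have mnG : measurable_fun setT (fun t => nrm2 (G t)) by exact: measurable_nrm2.
have x0 t : 0 <= x t by exact: nrm2_ge0.
have n0 t : 0 <= n t by exact: dneg_ge0.
have p0 t : 0 <= p t by exact: dpos_ge0.
have nD0 t : 0 <= nrm2 (D t) by exact: nrm2_ge0.
have nG0 t : 0 <= nrm2 (G t) by exact: nrm2_ge0.
have IE : (\int[P]_t (n t * w t)%:E = I%:E)%E.
  rewrite -In -(gop_pos _ A0) -wG; last 2 first.
  - by apply/measurable_EFinP; exact: measurable_dneg.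
  - by move=> v; rewrite lee_fin dneg_ge0.
  by apply: eq_integral => t _; rewrite EFinM.
have IEp : (\int[P]_t (p t * w t)%:E = I%:E)%E.
  rewrite -Ip -(gop_pos _ A0) -wG; last 2 first.
  - by apply/measurable_EFinP; exact: measurable_dpos.
  - by move=> v; rewrite lee_fin dpos_ge0.
  by apply: eq_integral => t _; rewrite EFinM.
have GE : (\int[P]_t (nrm2 (G t) * w t)%:E <= (d%:R * A)%:E)%E.
  apply: le_trans (gauss_nrm2 d A0).
  rewrite -(gop_pos _ A0) -wG; last 2 first.
  - by apply/measurable_EFinP; apply: measurable_nrm2; exact: measurable_id.
  - by move=> v; rewrite lee_fin nrm2_ge0.
  rewrite le_eqVlt; apply/orP; left; apply/eqP.
  by apply: eq_integral => t _; rewrite EFinM.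
pose cb := nrm2 b; have cb0 : 0 <= cb := nrm2_ge0 b.
pose c1 := 2 * u ^+ 2; have c10 : 0 <= c1 by rewrite mulr_ge0 ?sqr_ge0.
pose c2 := 2 * e ^+ 2; have c20 : 0 <= c2 by rewrite mulr_ge0 ?sqr_ge0.
have Cge0 : 0 <= C.
  by rewrite -lee_fin -hC; apply: integral_ge0 => t _; rewrite lee_fin mulr_ge0.
have mC : measurable_fun setT (fun _ : S => C) by exact: measurable_cst.
have mcb : measurable_fun setT (fun _ : S => cb) by exact: measurable_cst.
have mc1 : measurable_fun setT (fun t => c1 * nrm2 (D t)).
  by apply: measurable_funM => //; exact: measurable_cst.
have mc2 : measurable_fun setT (fun t => c2 * nrm2 (G t)).
  by apply: measurable_funM => //; exact: measurable_cst.
have mcc := measurable_funD mc1 mc2.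
have mpcc := measurable_funD mpp mcc.
have mqpcc := measurable_funD mq mpcc.
have mrhs := measurable_funD mcb mqpcc.
have mnC := measurable_funD mn mC.
have mlhs := measurable_funD mx mnC.
have c1D0 t : 0 <= c1 * nrm2 (D t) by exact: mulr_ge0.
have c2G0 t : 0 <= c2 * nrm2 (G t) by exact: mulr_ge0.
have cc0 t : 0 <= c1 * nrm2 (D t) + c2 * nrm2 (G t) by exact: addr_ge0.
have pcc0 t := addr_ge0 (p0 t) (cc0 t).
have qpcc0 t : 0 <= q t + (p t + (c1 * nrm2 (D t) + c2 * nrm2 (G t))).
  exact: addr_ge0 (C0 t) (pcc0 t).
have lhsE : W (fun t => x t + (n t + C)) = (W x + (I + C)%:E)%E.
  rewrite (WD _ _ mx mnC x0) ?(WD _ _ mn mC n0)//.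
    by rewrite Wcst// [W n]IE.
  by move=> t; rewrite addr_ge0.
pose rhs t := cb + (q t + (p t + (c1 * nrm2 (D t) + c2 * nrm2 (G t)))).
have rhsE : (W rhs <=
    (cb + c1 * E + c2 * (d%:R * A) + (I + C))%:E)%E.
  rewrite /rhs (WD _ _ mcb mqpcc (fun=> cb0) qpcc0) (WD _ _ mq mpcc C0 pcc0).
  rewrite (WD _ _ mpp mcc p0 cc0).
  rewrite (WD _ _ mc1 mc2 c1D0 c2G0) (WZ _ _ mnD nD0 c10) (WZ _ _ mnG nG0 c20).
  rewrite (Wcst _ cb0) [W q]hC [W p]IEp.
  have -> : (cb + c1 * E + c2 * (d%:R * A) + (I + C))%:E =
    (cb%:E + (C%:E + (I%:E + (c1%:E * E%:E + c2%:E * (d%:R * A)%:E))))%E.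
    by rewrite -!EFinM -!EFinD; congr EFin; ring.
  do 3 (apply: leeD; first by []).
  by apply: leeD; apply: lee_wpmul2l; rewrite ?lee_fin.
(* [I + C] is what the two linear terms contribute once they are made non-negative: [C] from the
   shift of the [D] term, [I] from the negative part of the [G] term. Being finite, it cancels. *)
suff : (W x + (I + C)%:E <= (cb + c1 * E + c2 * (d%:R * A))%:E + (I + C)%:E)%E.
  by rewrite leeD2rE.
rewrite -lhsE -EFinD; apply: le_trans rhsE.
apply: ge0_le_integral.
- exact: measurableT.
- by move=> t _; rewrite lee_fin mulr_ge0 ?addr_ge0 ?addr_ge0.
- exact: (mEM _ mlhs).
- exact: (mEM _ mrhs).
move=> t _; rewrite lee_fin ler_wpM2r//.
rewrite /rhs /x /q /n /p -addrA nrm2D.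
have := dposB ((2 * e) *: b) (G t); rewrite dotZl.
have := @nrm2D_young _ _ 1 (u *: D t) (e *: G t) ltr01.
rewrite invr1 !nrm2Z dotDr !dotZr dotZl /cb /c1 /c2; lra.
Qed.

End orthogonal_expansion.

(** * Noisy laws, score and the initial coupling *)

Section couplings.
Context {R : realType} {d : nat} d' (T : measurableType d') (nu : probability T R).
Local Notation V := 'rV[R]_d.
Variables (xi : T -> V) (r : R).
Hypotheses (mxi : measurable_fun setT xi) (r0 : 0 < r).
Hypothesis xir : forall t, nrm2 (xi t) <= r ^+ 2.
Implicit Types (a c h s t u : R) (x y v : V) (f : V -> \bar R).

Local Notation Zpost := (obs_mass nu xi).
Local Notation mp := (mp nu xi).
Local Notation Zratio := (mass_ratio nu xi).

(* expectation of [f (xi + sqrt t Z)], [Z] standard Gaussian, in the variable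
   [u = (xi + sqrt t Z) / t] *)
Definition noisy_integral t f : \bar R :=
  (\int[gaussP d t^-1]_u (f (t *: u)%R * (Zpost t^-1 u)%:E))%E.

(** Tweedie's formula, taken here as a definition; [grad_ln_density] identifies it with the gradient
    of the log density. *)
Definition score s x : V := s^-1 *: (mp s^-1 (s^-1 *: x) - x).

Definition em_mean h s x : V := x + h *: score s x.

Lemma measurable_em h s : measurable_fun setT (em_mean h s).
Proof.
have mz : measurable_fun setT (fun x : V => s^-1 *: x).
  by apply: measurable_rowZ; [exact: measurable_cst|exact: measurable_id].
apply: measurable_rowD; first exact: measurable_id.
apply: measurable_rowZ; first exact: measurable_cst.
apply: measurable_rowZ; first exact: measurable_cst.
apply: measurable_rowB; last exact: measurable_id.
exact: (measurableT_comp (measurable_mp nu mxi r0 xir _) mz).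
Qed.

Lemma nrm2_lin_le (a b K : R) (p q : V) : 0 <= a -> 0 <= b -> 0 < K ->
  nrm2 q <= K ^+ 2 * nrm2 p -> nrm2 (a *: p + b *: q) <= (a + b * K) ^+ 2 * nrm2 p.
Proof.
move=> a0 b0 K0 qp.
have pq : dot p q <= K * nrm2 p.
  by rewrite dotC; have := @dot_diff_le R d K q 0 p K0; rewrite subr0 dot0l addr0; exact.
rewrite nrm2D !nrm2Z dotZl dotZr.
have h1 : a * b * dot p q <= a * b * (K * nrm2 p) by rewrite ler_wpM2l// mulr_ge0.
have h2 : b ^+ 2 * nrm2 q <= b ^+ 2 * (K ^+ 2 * nrm2 p) by rewrite ler_wpM2l// sqr_ge0.
lra.
Qed.

Lemma em_lin h s (p q x y : V) : s != 0 ->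
  (x + h *: (s^-1 *: (p - x))) - (y + h *: (s^-1 *: (q - y))) =
  ((s - h) / s) *: (x - y) + (h / s) *: (p - q).
Proof. by move=> s0; apply/rowP => i; rewrite !mxE; field. Qed.

(** The Euler mean is [(s - h) / s] times [x] plus [h / s] times the posterior mean at [x / s],
    which is Lipschitz in [x] with constant [r^2 / s]. The condition [h <= s] keeps both
    coefficients non-negative. *)
Lemma em_lipschitz h s x y : 0 < s -> 0 <= h -> h <= s ->
  nrm2 (em_mean h s x - em_mean h s y) <=
  ((s - h) / s + h * r ^+ 2 / s ^+ 2) ^+ 2 * nrm2 (x - y).
Proof.
move=> s0 h0 hs; have s1 : s != 0 by rewrite gt_eqF.
have L := mp_lipschitz nu mxi r0 xir s^-1 (s^-1 *: y) (s^-1 *: x).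
rewrite /em_mean /score (em_lin _ _ _ _ _ s1).
move: (mp _ (s^-1 *: x)) (mp _ (s^-1 *: y)) L => p q L.
have E : (s - h) / s + h * r ^+ 2 / s ^+ 2 = (s - h) / s + h / s * (r ^+ 2 / s) by field.
rewrite E; apply: nrm2_lin_le.
- by rewrite divr_ge0 ?subr_ge0// ltW.
- by rewrite divr_ge0// ltW.
- by rewrite divr_gt0// exprn_gt0.
apply: le_trans L _.
rewrite -scalerBr nrm2Z le_eqVlt; apply/orP; left; apply/eqP; field.
exact: s1.
Qed.

Lemma localizes_mass (A : R) (dS : measure_display) (S : measurableType dS)
    (P : probability S R) (w : V * S -> R) (G : V * S -> V) y : 0 < A ->
  (forall f : V -> \bar R, measurable_fun setT f -> (forall v, 0 <= f v)%E ->
      (\int[P]_t (f (G (y, t)) * (w (y, t))%:E) = gop A f)%E) ->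
  (\int[P]_t (w (y, t))%:E = 1)%E.
Proof.
move=> A0 H; have := H (cst 1%E) (measurable_cst _) (fun=> lee01).
rewrite (gop_pos _ A0) integral_prob_cst => <-.
by apply: eq_integral => t _; rewrite [RHS]mul1e.
Qed.

Lemma Zpost00 : Zpost 0 0 = 1.
Proof.
rewrite /obs_mass -[RHS](expect_cst nu 1); congr (expect _ _).
by apply/funext => t; rewrite /obs_weight dot0r !mul0r subrr expR0.
Qed.

Lemma measurable_drift_error (dS : measure_display) (S : measurableType dS) a s
    (U G : V * S -> V) : measurable_fun setT U -> measurable_fun setT G ->
  measurable_fun setT (drift_error nu xi a s U G).
Proof.
move=> mU mG; apply: measurable_rowB.
  apply: measurable_rowB => //; exact: measurable_rowB mU measurable_fst.
apply: measurable_rowZ; first exact: measurable_cst.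
exact: (measurableT_comp (measurable_mp nu mxi r0 xir _) measurable_fst).
Qed.

Lemma noisy_initial t : 0 < t -> mp 0 0 = 0 ->
  exists pi : probability (V * V)%type R,
  [/\ forall f, measurable_fun setT f -> (forall x, 0 <= f x)%E ->
        (\int[pi]_z f z.1 = noisy_integral t f)%E,
      forall f, measurable_fun setT f -> (forall x, 0 <= f x)%E ->
        (\int[pi]_z f z.2 = \int[gaussP d t]_v f v)%E &
      (\int[pi]_z (nrm2 (z.1 - z.2))%:E <= (3 / 4 * (r ^+ 4 / t))%:E)%E].
Proof.
move=> t0 m0; have ti0 : 0 < t^-1 by rewrite invr_gt0.
have [dS [S [P [w [U [G [[mw mU mG w0] H]]]]]]] := localizes_exists nu mxi r0 xir 0 ti0.
have [h1 h2 h3 h4 h5] := H 0.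
pose w' (z : unit * S) := w (0, z.2).
pose phi (z : unit * S) := (t *: U (0, z.2), t *: G (0, z.2)).
have m2 : measurable_fun setT (fun z : unit * S => (0 : V, z.2)).
  by apply: measurable_fun_pair; [exact: measurable_cst|exact: measurable_snd].
have mw' : measurable_fun setT w' by exact: (measurableT_comp mw m2).
have mtU : measurable_fun setT (fun z : V * S => t *: U z).
  by apply: measurable_rowZ => //; exact: measurable_cst.
have mtG : measurable_fun setT (fun z : V * S => t *: G z).
  by apply: measurable_rowZ => //; exact: measurable_cst.
have mphi : measurable_fun setT phi.
  apply: measurable_fun_pair; first exact: (measurableT_comp mtU m2).
  exact: (measurableT_comp mtG m2).
have w1 (x : unit) : (\int[P]_s (w' (x, s))%:E = 1)%E.
  exact: (localizes_mass ti0 h2).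
have [pi piE] := weighted_image (\d_tt : probability unit R) mw' (fun z => w0 _) w1 mphi.
have {}piE (k : V * V -> \bar R) : measurable_fun setT k -> (forall z, 0 <= k z)%E ->
    (\int[pi]_z k z = \int[P]_s (k (t *: U (0, s), t *: G (0, s))%R * (w (0, s))%:E))%E.
  by move=> mf f0; rewrite (piE _ mf f0) -[RHS](integral_prob_cst (\d_tt : probability unit R)).
have mscale : measurable_fun setT (fun v : V => t *: v).
  by apply: measurable_rowZ; [exact: measurable_cst|exact: measurable_id].
have tt : t * t^-1 = 1 by rewrite divff// gt_eqF.
exists pi; split.
- move=> f mf f0; rewrite piE; last 2 first.
  + exact: (measurableT_comp mf measurable_fst).
  + by move=> z; exact: f0.
  rewrite /= (h1 (fun v => f (t *: v)) (measurableT_comp mf mscale) (fun v => f0 _)).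
  rewrite (gop_pos _ ti0) /noisy_integral; apply: eq_integral => v _.
  rewrite add0r /Zratio !add0r.
  by rewrite Zpost00 divr1.
- move=> f mf f0; rewrite piE; last 2 first.
  + exact: (measurableT_comp mf measurable_snd).
  + by move=> z; exact: f0.
  rewrite /= (h2 (fun v => f (t *: v)) (measurableT_comp mf mscale) (fun v => f0 _)).
  rewrite (gop_pos _ ti0) (gauss_scale ti0 t0 mf f0).
  by rewrite expr2 -mulrA tt mulr1.
- rewrite (piE (fun z => (nrm2 (z.1 - z.2))%:E)); last 2 first.
  + apply/measurable_EFinP; apply: measurable_nrm2.
    exact: (measurable_rowB measurable_fst measurable_snd).
  + by move=> z; rewrite lee_fin nrm2_ge0.
  have mp0 : measurable_fun setT (fun q : S => (0 : V, q)).
    by apply: measurable_fun_pair; [exact: measurable_cst|exact: measurable_id].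
  have mD : measurable_fun setT (fun q : S => (nrm2 (drift_error nu xi 0 t^-1 U G (0, q)) * w (0, q))%:E).
    apply/measurable_EFinP; apply: measurable_funM.
      apply: measurable_nrm2.
      exact: (measurableT_comp (measurable_drift_error 0 t^-1 mU mG) mp0).
    exact: (measurableT_comp mw mp0).
  have -> : (3 / 4 * (r ^+ 4 / t))%:E = ((t ^+ 2)%:E * (3 / 4 * (r ^+ 4 * t^-1 ^+ 3))%:E)%E.
    by rewrite -EFinM; congr EFin; field; rewrite gt_eqF.
  have t2 : (0 <= (t ^+ 2)%:E)%E by rewrite lee_fin sqr_ge0.
  apply: le_trans (lee_wpmul2l t2 h5).
  rewrite -(ge0_integralZl _ measurableT mD) //; last first.
    by move=> s _; rewrite lee_fin mulr_ge0// nrm2_ge0.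
  rewrite le_eqVlt; apply/orP; left; apply/eqP; apply: eq_integral => s _ /=.
  rewrite -EFinM -EFinM /drift_error /= m0 scaler0 !subr0 -scalerBr nrm2Z.
  by congr EFin; ring.
Qed.

Lemma ge0_integral_nrm2_le dX (X : measurableType dX) (m : probability X R)
    (p q : X -> R) (K C e : R) : measurable_fun setT p -> measurable_fun setT q ->
  (forall z, 0 <= p z) -> (forall z, 0 <= q z) -> 0 <= K -> 0 <= C ->
  (forall z, p z <= K * q z + C) -> (\int[m]_z (q z)%:E <= e%:E)%E ->
  (\int[m]_z (p z)%:E <= (K * e + C)%:E)%E.
Proof.
move=> mp_ mq p0 q0 K0 C0 pq qe.
have mqE : measurable_fun setT (fun z => (q z)%:E) by exact/measurable_EFinP.
have qE0 z : [set: X] z -> (0 <= (q z)%:E)%E by move=> _; rewrite lee_fin.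
have K0E : (0 <= K%:E)%E by rewrite lee_fin.
have mKq : measurable_fun setT (fun z => K%:E * (q z)%:E)%E.
  by apply: emeasurable_funM => //; exact: measurable_cst.
apply: (@le_trans _ _ (\int[m]_z (K%:E * (q z)%:E + C%:E))%E).
  apply: ge0_le_integral.
  - exact: measurableT.
  - by move=> z _; rewrite lee_fin.
  - exact/measurable_EFinP.
  - by apply: emeasurable_funD => //; exact: measurable_cst.
  by move=> z _; rewrite -EFinM -EFinD lee_fin.
rewrite (ge0_integralD _ measurableT _ mKq _ (measurable_cst _)); last 2 first.
- by move=> z _; rewrite -EFinM lee_fin mulr_ge0.
- by move=> z _; rewrite lee_fin.
rewrite (ge0_integralZl _ measurableT mqE qE0 K0E) integral_prob_cst EFinD EFinM.
by rewrite leeD2r// lee_wpmul2l.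
Qed.

(** The localization kernel carries the noisy law at level [u + h] to that at level [u]: the masses
    cancel, and Gaussians of variances [1 / (u + h)] and [1 / u - 1 / (u + h)] convolve. *)
Lemma noisyI_step h u f : 0 < h -> 0 < u -> measurable_fun setT f ->
  (forall x, 0 <= f x)%E ->
  noisy_integral (u + h) (fun x => \int[gaussP d (u^-1 - (u + h)^-1)]_v
    (f (u *: ((u + h)^-1 *: x + v))%R *
     (Zratio (u + h)^-1 (u^-1 - (u + h)^-1) ((u + h)^-1 *: x)%R v)%:E))%E = noisy_integral u f.
Proof.
move=> h0 u0 mf f0; set s := u + h.
have s0 : 0 < s by rewrite addr_gt0.
have si0 : 0 < s^-1 by rewrite invr_gt0.
have A0 : 0 < u^-1 - s^-1 by rewrite subr_gt0 ltf_pV2 ?posrE// ltrDl.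
have sA : s^-1 + (u^-1 - s^-1) = u^-1 by rewrite addrC subrK.
have mscale c : measurable_fun setT (fun v : V => c *: v).
  by apply: measurable_rowZ; [exact: measurable_cst|exact: measurable_id].
have mZ : measurable_fun setT (fun v => (Zpost u^-1 v)%:E).
  by apply/measurable_EFinP; exact: measurable_Zpost.
have mg : measurable_fun setT (fun v => f (u *: v)%R * (Zpost u^-1 v)%:E)%E.
  by apply: emeasurable_funM => //; exact: (measurableT_comp mf (mscale u)).
have g0 v : (0 <= f (u *: v)%R * (Zpost u^-1 v)%:E)%E.
  by rewrite mule_ge0// lee_fin ltW// (Zpost_gt0 nu mxi r0 xir).
rewrite [RHS]/noisy_integral -[in RHS]sA.
have := gauss_conv si0 A0 mg g0; rewrite sA => <-.
rewrite /noisy_integral; apply: eq_integral => x _.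
have ss : s^-1 *: (s *: x) = x by rewrite scalerA mulVf ?scale1r// gt_eqF.
rewrite ss.
have Z0 := Zpost_gt0 nu mxi r0 xir s^-1 x.
have mk : measurable_fun setT (fun v => f (u *: (x + v))%R *
    (Zratio s^-1 (u^-1 - s^-1) x v)%:E)%E.
  apply: emeasurable_funM; last by apply/measurable_EFinP; exact: measurable_Zratio.
  exact: (measurableT_comp (measurableT_comp mf (mscale u)) (measurable_addy x)).
have k0 v : [set: V] v -> (0 <= f (u *: (x + v))%R * (Zratio s^-1 (u^-1 - s^-1) x v)%:E)%E.
  by move=> _; rewrite mule_ge0// lee_fin (Zratio_ge0 nu mxi r0 xir).
have Z0E : (0 <= (Zpost s^-1 x)%:E)%E by rewrite lee_fin ltW.
rewrite -(ge0_integralZr _ measurableT mk k0 Z0E).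
apply: eq_integral => v _; rewrite -muleA -EFinM /mass_ratio sA divfK//.
by rewrite gt_eqF.
Qed.

End couplings.

(** * One Euler step *)

Section steps.
Context {R : realType} {d : nat} d' (T : measurableType d') (nu : probability T R).
Local Notation V := 'rV[R]_d.
Variables (xi : T -> V) (r : R).
Hypotheses (mxi : measurable_fun setT xi) (r0 : 0 < r).
Hypothesis xir : forall t, nrm2 (xi t) <= r ^+ 2.
Implicit Types (a c h s t u : R) (x y v : V) (f : V -> \bar R).

Local Notation mp := (mp nu xi).
Local Notation Zratio := (mass_ratio nu xi).
Local Notation noisyI := (noisy_integral nu xi).
Local Notation em := (em_mean nu xi).

(** With [c] the square root, [u (c^2 - 1) = h] and [c >= 1] give [u (c - 1) <= h / 2]. The
    assumption [h <= u] then bounds [1 / (u (u + h))] by [2 / (u + h)^2]. *)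
Lemma noise_gap h u (k : R) : 0 < h -> h <= u -> 0 <= k ->
  2 * (u * (1 - Num.sqrt ((u + h) / u))) ^+ 2 * (k * (u^-1 - (u + h)^-1)) <=
  k * h ^+ 3 / (u + h) ^+ 2.
Proof.
move=> h0 hu k0; have u0 : 0 < u := lt_le_trans h0 hu.
have s0 : 0 < u + h by rewrite addr_gt0.
have [u1 s1] : u != 0 /\ u + h != 0 by rewrite !gt_eqF.
set c := Num.sqrt _.
have q0 : 0 < (u + h) / u by rewrite divr_gt0.
have c2 : c ^+ 2 = (u + h) / u by rewrite sqr_sqrtr// ltW.
have c1 : 1 <= c by rewrite -sqrtr1 ler_wsqrtr// ler_pdivlMr// mul1r lerDl ltW.
have uc : u * (c ^+ 2 - 1) = h by rewrite c2; field.
have ucc : (u * (1 - c)) ^+ 2 * 4 <= h ^+ 2.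
  have -> : h ^+ 2 = (u * (1 - c)) ^+ 2 * (c + 1) ^+ 2 by rewrite -uc; ring.
  by rewrite ler_wpM2l ?sqr_ge0//; nra.
have -> : u^-1 - (u + h)^-1 = h / (u * (u + h)) by field; rewrite u1 s1.
have -> : k * h ^+ 3 / (u + h) ^+ 2 = (2 * h ^+ 2) * (k * (h / (2 * (u + h) * (u + h)))).
  by field.
apply: (@le_trans _ _ ((h ^+ 2 / 2) * (k * (h / (u * (u + h)))))).
  apply: ler_wpM2r; last by move: ucc; lra.
  by rewrite mulr_ge0// divr_ge0 ?mulr_ge0// ltW.
have -> : h ^+ 2 / 2 * (k * (h / (u * (u + h)))) =
    2 * h ^+ 2 * (k * (h / (4 * u * (u + h)))) by field; rewrite u1 s1.
apply: ler_wpM2l; first by rewrite mulr_ge0// sqr_ge0.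
apply: ler_wpM2l => //; apply: ler_wpM2l; first exact: ltW.
rewrite lef_pV2 ?posrE ?mulr_gt0//.
by rewrite ler_wpM2r ?(ltW s0)//; lra.
Qed.

(** Lipschitz constant of the Euler mean from noise level [u + h] to [u]. *)
Definition step_factor h u : R := u / (u + h) + h * r ^+ 2 / (u + h) ^+ 2.

(** The first term is [2 u^2] times the localization error [3/4 r^4 A^3] for [A = h / (u (u + h))];
    the second bounds the cost of the noise mismatch. *)
Definition step_error h u : R :=
  3 / 2 * (r ^+ 4 * h ^+ 3) / (u * (u + h) ^+ 3) + d%:R * h ^+ 3 / (u + h) ^+ 2.

(** Exact and sampled step share the Gaussian [G] of one localization step. The new difference is
    the difference of the Euler means plus [u] times the drift error plus [u (1 - c)] times [G], and
    the last two are centered given the old pair. *)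
Lemma euler_step h u (pi : probability (V * V)%type R) (e : R) :
  0 < h -> h <= u ->
  (forall f, measurable_fun setT f -> (forall x, 0 <= f x)%E ->
     (\int[pi]_z f z.1 = noisyI (u + h) f)%E) ->
  (\int[pi]_z (nrm2 (z.1 - z.2))%:E <= e%:E)%E ->
  exists pi' : probability (V * V)%type R,
  [/\ forall f, measurable_fun setT f -> (forall x, 0 <= f x)%E ->
        (\int[pi']_z f z.1 = noisyI u f)%E,
      forall f, measurable_fun setT f -> (forall x, 0 <= f x)%E ->
        (\int[pi']_z f z.2 =
         \int[pi]_z \int[gaussP d h]_v f (em h (u + h) z.2 + v)%R)%E &
      (\int[pi']_z (nrm2 (z.1 - z.2))%:E <=
       (step_factor h u ^+ 2 * e + step_error h u)%:E)%E].
Proof.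
move=> h0 hu pi1 pie; have u0 : 0 < u := lt_le_trans h0 hu.
set s := u + h.
have s0 : 0 < s by rewrite addr_gt0.
have [u1 s1] : u != 0 /\ s != 0 by rewrite !gt_eqF.
set A := u^-1 - s^-1.
have A0 : 0 < A by rewrite subr_gt0 ltf_pV2 ?posrE// ltrDl.
have [dS [S [P [w0 [U [G [[mw mU mG wge0] H]]]]]]] :=
  localizes_exists nu mxi r0 xir s^-1 A0.
(* [G] has variance [A = h / (u s)], so [c u] is the factor that brings it to the variance [h] of
   the sampler noise. *)
pose c := Num.sqrt (s / u).
have q0 : 0 < s / u by rewrite divr_gt0.
have c0 : 0 < c by rewrite sqrtr_gt0.
have c2 : c ^+ 2 = s / u by rewrite sqr_sqrtr// ltW.
pose j (z : (V * V) * S) := (s^-1 *: z.1.1, z.2).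
pose w z := w0 (j z).
pose phi (z : (V * V) * S) := (u *: U (j z), em h s z.1.2 + (c * u) *: G (j z)).
have mscale t : measurable_fun setT (fun v : V => t *: v).
  by apply: measurable_rowZ; [exact: measurable_cst|exact: measurable_id].
have mem := measurable_em nu mxi r0 xir h s.
have mj : measurable_fun setT j.
  apply: measurable_fun_pair; last exact: measurable_snd.
  exact: (measurableT_comp (mscale _) (measurableT_comp measurable_fst measurable_fst)).
have mww : measurable_fun setT w by exact: (measurableT_comp mw mj).
have mphi : measurable_fun setT phi.
  apply: measurable_fun_pair.
    exact: (measurableT_comp (measurableT_comp (mscale u) mU) mj).
  apply: measurable_rowD.
    exact: (measurableT_comp mem (measurableT_comp measurable_snd measurable_fst)).
  exact: (measurableT_comp (measurableT_comp (mscale (c * u)) mG) mj).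
have w1 z : (\int[P]_t (w (z, t))%:E = 1)%E.
  by have [_ hG _ _ _] := H (s^-1 *: z.1); exact: (localizes_mass A0 hG).
have [pi' piE] := weighted_image pi mww (fun z => wge0 _) w1 mphi.
exists pi'; split.
- move=> f mf f0; rewrite (piE (fun z => f z.1) (measurableT_comp mf measurable_fst) (fun z => f0 _)).
  rewrite -(noisyI_step nu mxi r0 xir h0 u0 mf f0) -/s -/A.
  pose k x := (\int[gaussP d A]_v (f (u *: (s^-1 *: x + v))%R *
     (Zratio s^-1 A (s^-1 *: x)%R v)%:E))%E.
  transitivity (\int[pi]_z k z.1)%E; last first.
    have mF : measurable_fun setT (fun z : V * V => f (u *: (s^-1 *: z.1 + z.2))%R *
        (Zratio s^-1 A (s^-1 *: z.1)%R z.2)%:E)%E.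
      have m1 : measurable_fun setT (fun z : V * V => s^-1 *: z.1).
        exact: (measurableT_comp (mscale _) measurable_fst).
      have m12 : measurable_fun setT (fun z : V * V => s^-1 *: z.1 + z.2).
        exact: (measurable_rowD m1 measurable_snd).
      apply: emeasurable_funM.
        exact: (measurableT_comp (measurableT_comp mf (mscale u)) m12).
      apply/measurable_EFinP; apply: measurable_funM.
        exact: (measurableT_comp (measurable_Zpost nu mxi _) m12).
      exact: (measurableT_comp (measurable_invZpost nu mxi r0 xir s^-1) m1).
    have F0 z : (0 <= f (u *: (s^-1 *: z.1 + z.2))%R *
        (Zratio s^-1 A (s^-1 *: z.1)%R z.2)%:E)%E.
      by rewrite mule_ge0// lee_fin (Zratio_ge0 nu mxi r0 xir).
    have mk : measurable_fun setT k by exact: (measurable_tonelli (gaussP d A) mF F0).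
    by rewrite (pi1 k mk)// => x; apply: integral_ge0 => v _; exact: (F0 (x, v)).
  apply: eq_integral => z _.
  have [hU _ _ _ _] := H (s^-1 *: z.1).
  by rewrite /= (hU (fun v => f (u *: v)) (measurableT_comp mf (mscale u)) (fun v => f0 _))
    (gop_pos _ A0).
- move=> f mf f0; rewrite (piE (fun z => f z.2) (measurableT_comp mf measurable_snd) (fun z => f0 _)).
  apply: eq_integral => z _.
  have [_ hG _ _ _] := H (s^-1 *: z.1).
  pose y := em h s z.2.
  have mfy : measurable_fun setT (fun v => f (y + v)).
    exact: (measurableT_comp mf (measurable_addy y)).
  rewrite /= (hG (fun v => f (y + (c * u) *: v)) (measurableT_comp mfy (mscale _)) (fun v => f0 _)).
  rewrite (gop_pos _ A0) (gauss_scale A0 (mulr_gt0 c0 u0) mfy (fun v => f0 _)).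
  congr (\int[gaussP d _]_v _)%E.
  by rewrite exprMn c2 /A /s; field; rewrite u1 s1.
rewrite (piE (fun z => (nrm2 (z.1 - z.2))%:E)); last 2 first.
- apply/measurable_EFinP; apply: measurable_nrm2.
  exact: (measurable_rowB measurable_fst measurable_snd).
- by move=> z; rewrite lee_fin nrm2_ge0.
pose L := step_factor h u; pose C := step_error h u.
pose b z := em h s z.1 - em h s z.2.
have bL (z : V * V) : nrm2 (b z) <= L ^+ 2 * nrm2 (z.1 - z.2).
  have hs : h <= s by rewrite lerDr ltW.
  have := em_lipschitz nu mxi r0 xir z.1 z.2 s0 (ltW h0) hs.
  by rewrite /s addrK.
have mQ : measurable_fun setT (fun z : (V * V) * S =>
    (nrm2 ((phi z).1 - (phi z).2))%:E * (w z)%:E)%E.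
  apply: emeasurable_funM; last exact/measurable_EFinP.
  apply/measurable_EFinP; apply: measurable_nrm2; apply: measurable_rowB.
    exact: (measurableT_comp measurable_fst mphi).
  exact: (measurableT_comp measurable_snd mphi).
have Q0 z : (0 <= (nrm2 ((phi z).1 - (phi z).2))%:E * (w z)%:E)%E.
  by rewrite mule_ge0// lee_fin ?nrm2_ge0// /w.
have mI := measurable_tonelli P mQ Q0.
have C0 : 0 <= C.
  by rewrite /C /step_error addr_ge0// mulr_ge0 ?mulr_ge0 ?invr_ge0 ?mulr_ge0 ?exprn_ge0 ?divr_ge0// ltW.
have mq : measurable_fun setT (fun z : V * V => nrm2 (z.1 - z.2)).
  by apply: measurable_nrm2; exact: (measurable_rowB measurable_fst measurable_snd).
have mLq : measurable_fun setT (fun z : V * V => L ^+ 2 * nrm2 (z.1 - z.2) + C).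
  apply: measurable_funD; last exact: measurable_cst.
  by apply: measurable_funM => //; exact: measurable_cst.
have Lq0 (z : V * V) : 0 <= L ^+ 2 * nrm2 (z.1 - z.2) + C.
  by rewrite addr_ge0// mulr_ge0 ?sqr_ge0 ?nrm2_ge0.
apply: (@le_trans _ _ (\int[pi]_z (L ^+ 2 * nrm2 (z.1 - z.2) + C)%:E)%E); last first.
  exact: (ge0_integral_nrm2_le mLq mq Lq0 (fun z => nrm2_ge0 _) (sqr_ge0 _) C0 (fun z => lexx _) pie).
apply: ge0_le_integral.
- exact: measurableT.
- by move=> z _; apply: integral_ge0 => t _; exact: (Q0 (z, t)).
- exact: mI.
- exact/measurable_EFinP.
move=> z _; have [_ hG _ hD hE] := H (s^-1 *: z.1).
set y := s^-1 *: z.1 in hG hD hE *.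
have mp0 : measurable_fun setT (fun q : S => (y, q)).
  by apply: measurable_fun_pair; [exact: measurable_cst|exact: measurable_id].
have mD := measurableT_comp (measurable_drift_error nu mxi r0 xir s^-1 A mU mG) mp0.
have mGy := measurableT_comp mG mp0.
have mwy := measurableT_comp mw mp0.
have := orthogonal_expansion mwy (fun q => wge0 (y, q)) mD mGy A0 hG hD hE (b z) u (u * (1 - c)).
move=> O; apply: le_trans (le_trans O _).
  rewrite le_eqVlt; apply/orP; left; apply/eqP; apply: eq_integral => t _.
  rewrite -EFinM; congr (_ * _)%:E; congr nrm2.
  rewrite /phi /j /= -/y /b /drift_error /=.
  have -> : em h s z.1 = u *: y + (u * A) *: mp s^-1 y.
    rewrite /em_mean /score -/y; move: (mp _ _) => p; rewrite /y /A /s.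
    by apply/rowP => i; rewrite !mxE; field; rewrite u1 s1.
  move: (U _) (G _) (em _ _ _) (mp _ _) => p1 p2 p3 p4.
  by apply/rowP => i; rewrite !mxE; ring.
rewrite lee_fin -addrA; apply: lerD; first exact: bL.
have -> : C = 3 / 2 * (r ^+ 4 * h ^+ 3) / (u * s ^+ 3) + d%:R * h ^+ 3 / s ^+ 2 by [].
apply: lerD; last exact: (noise_gap h0 hu).
rewrite le_eqVlt; apply/orP; left; apply/eqP.
by rewrite /A /s; field; rewrite u1 s1.
Qed.

End steps.

(** * The final posterior draw *)

Section posterior_draw.
Context {R : realType} {d : nat} d' (T : measurableType d') (nu : probability T R).
Local Notation V := 'rV[R]_d.
Variables (xi : T -> V) (r : R).
Hypotheses (mxi : measurable_fun setT xi) (r0 : 0 < r).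
Hypothesis xir : forall t, nrm2 (xi t) <= r ^+ 2.
Implicit Types (a c h s u : R) (x y v : V) (f : V -> \bar R).

Local Notation Zpost := (obs_mass nu xi).
Local Notation pw := (post_weight nu xi).
Local Notation noisyI := (noisy_integral nu xi).


Local Notation lw := (obs_weight xi).

(** Bayes' formula: a noisy point followed by a posterior draw has the same joint law as a sample
    followed by its noise. The mass cancels the normalization of the posterior, and a Gaussian shift
    turns the likelihood into a translation. *)
Lemma noisyI_posterior s (F : V * V -> \bar R) : 0 < s ->
  measurable_fun setT F -> (forall z, 0 <= F z)%E ->
  noisyI s (fun y => \int[nu]_t (F (xi t, y) * (pw s^-1 (s^-1 *: y)%R t)%:E))%E =
  (\int[nu]_t \int[gaussP d s^-1]_v F (xi t, xi t + s *: v)%R)%E.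
Proof.
move=> s0 mF F0; have si0 : 0 < s^-1 by rewrite invr_gt0.
have s1 : s != 0 by rewrite gt_eqF.
have mscale c : measurable_fun setT (fun v : V => c *: v).
  by apply: measurable_rowZ; [exact: measurable_cst|exact: measurable_id].
have mxis : measurable_fun setT (fun z : V * T => (xi z.2, s *: z.1)).
  apply: measurable_fun_pair; first exact: (measurableT_comp mxi measurable_snd).
  exact: (measurableT_comp (mscale s) measurable_fst).
have mFl : measurable_fun setT (fun z : V * T => F (xi z.2, s *: z.1) * (lw s^-1 z.1 z.2)%:E)%E.
  apply: emeasurable_funM; first exact: (measurableT_comp mF mxis).
  by apply/measurable_EFinP; exact: measurable_lw.
have Fl0 z : (0 <= F (xi z.2, s *: z.1)%R * (lw s^-1 z.1 z.2)%:E)%E.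
  by rewrite mule_ge0// lee_fin ltW// lw_gt0.
transitivity (\int[gaussP d s^-1]_v \int[nu]_t (F (xi t, s *: v)%R * (lw s^-1 v t)%:E))%E.
  rewrite /noisy_integral; apply: eq_integral => v _.
  have -> : s^-1 *: (s *: v) = v by rewrite scalerA mulVf ?scale1r.
  have mp1 : measurable_fun setT (fun t : T => (v, t)).
    by apply: measurable_fun_pair; [exact: measurable_cst|exact: measurable_id].
  have mk : measurable_fun setT (fun t => F (xi t, s *: v)%R * (pw s^-1 v t)%:E)%E.
    apply: emeasurable_funM.
      exact: (measurableT_comp (measurableT_comp mF mxis) mp1).
    by apply/measurable_EFinP; exact: (measurableT_comp (measurable_pw nu mxi r0 xir _) mp1).
  have k0 t : [set: T] t -> (0 <= F (xi t, s *: v)%R * (pw s^-1 v t)%:E)%E.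
    by move=> _; rewrite mule_ge0// lee_fin (pw_ge0 nu mxi r0 xir).
  have Z0 := Zpost_gt0 nu mxi r0 xir s^-1 v.
  have Z0E : (0 <= (Zpost s^-1 v)%:E)%E by rewrite lee_fin ltW.
  rewrite -(ge0_integralZr _ measurableT mk k0 Z0E); apply: eq_integral => t _.
  by rewrite -muleA -EFinM /post_weight divfK// gt_eqF.
rewrite (tonelli_swap (gaussP d s^-1) nu mFl Fl0).
apply: eq_integral => t _.
have mp2 : measurable_fun setT (fun v : V => (v, t)).
  by apply: measurable_fun_pair; [exact: measurable_id|exact: measurable_cst].
have mf : measurable_fun setT (fun v => F (xi t, s *: v)).
  exact: (measurableT_comp (measurableT_comp mF mxis) mp2).
rewrite -[LHS](gauss_shift (xi t) si0 mf (fun v => F0 _)); apply: eq_integral => v _.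
by rewrite scalerDr scalerA divff// scale1r addrC.
Qed.

(** The draw is made from the first component and ignores the second. By Bayes' formula it has the
    law of [xi] and its mean square distance to the noisy point is that of the noise, at most
    [d s]. *)
Lemma posterior_draw s (pi : probability (V * V)%type R) (e : R) :
  (0 < d)%N -> 0 < s -> 0 < e ->
  (forall f, measurable_fun setT f -> (forall x, 0 <= f x)%E ->
     (\int[pi]_z f z.1 = noisyI s f)%E) ->
  (\int[pi]_z (nrm2 (z.1 - z.2))%:E <= e%:E)%E ->
  exists pi' : probability (V * V)%type R,
  [/\ forall f, measurable_fun setT f -> (forall x, 0 <= f x)%E ->
        (\int[pi']_z f z.1 = \int[nu]_t f (xi t))%E,
      forall f, measurable_fun setT f -> (forall x, 0 <= f x)%E ->
        (\int[pi']_z f z.2 = \int[pi]_z f z.2)%E &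
      (\int[pi']_z (nrm2 (z.1 - z.2))%:E <=
       ((Num.sqrt (d%:R * s) + Num.sqrt e) ^+ 2)%:E)%E].
Proof.
move=> d0 s0 e0 pi1 pie; have si0 : 0 < s^-1 by rewrite invr_gt0.
pose w (z : (V * V) * T) := pw s^-1 (s^-1 *: z.1.1) z.2.
pose phi (z : (V * V) * T) := (xi z.2, z.1.2).
have mscale c : measurable_fun setT (fun v : V => c *: v).
  by apply: measurable_rowZ; [exact: measurable_cst|exact: measurable_id].
have m11 : measurable_fun setT (fun z : (V * V) * T => z.1.1).
  exact: (measurableT_comp measurable_fst measurable_fst).
have m12 : measurable_fun setT (fun z : (V * V) * T => z.1.2).
  exact: (measurableT_comp measurable_snd measurable_fst).
have mx2 : measurable_fun setT (fun z : (V * V) * T => xi z.2).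
  exact: (measurableT_comp mxi measurable_snd).
have mw : measurable_fun setT w.
  apply: (measurableT_comp (measurable_pw nu mxi r0 xir s^-1)
    (_ : measurable_fun setT (fun z : (V * V) * T => (s^-1 *: z.1.1, z.2)))).
  apply: measurable_fun_pair; last exact: measurable_snd.
  exact: (measurableT_comp (mscale _) m11).
have mphi : measurable_fun setT phi by exact: measurable_fun_pair.
have w0 z : 0 <= w z by exact: (pw_ge0 nu mxi r0 xir).
have w1 z : (\int[nu]_t (w (z, t))%:E = 1)%E.
  transitivity (expect nu (pw s^-1 (s^-1 *: z.1)))%:E.
    exact: (expectE nu (bmf_pw nu mxi r0 xir s^-1 (s^-1 *: z.1))).
  congr EFin; apply: etrans (pexp_cst nu mxi r0 xir s^-1 (s^-1 *: z.1) 1).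
  by congr (expect _ _); apply/funext => t; rewrite mul1r.
have post (F : V * V -> \bar R) : measurable_fun setT F -> (forall z, 0 <= F z)%E ->
    (\int[pi]_z \int[nu]_t (F (xi t, z.1) * (w (z, t))%:E) =
     \int[nu]_t \int[gaussP d s^-1]_v F (xi t, xi t + s *: v)%R)%E.
  move=> mF F0; rewrite -(noisyI_posterior s0 mF F0) -pi1//.
    have mG : measurable_fun setT (fun z : V * T =>
        F (xi z.2, z.1) * (pw s^-1 (s^-1 *: z.1)%R z.2)%:E)%E.
      apply: emeasurable_funM.
        apply: (measurableT_comp mF (_ : measurable_fun setT (fun z : V * T => (xi z.2, z.1)))).
        apply: measurable_fun_pair; last exact: measurable_fst.
        exact: (measurableT_comp mxi measurable_snd).
      apply/measurable_EFinP.
      apply: (measurableT_comp (measurable_pw nu mxi r0 xir s^-1)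
        (_ : measurable_fun setT (fun z : V * T => (s^-1 *: z.1, z.2)))).
      apply: measurable_fun_pair; last exact: measurable_snd.
      exact: (measurableT_comp (mscale _) measurable_fst).
    have G0 z : (0 <= F (xi z.2, z.1) * (pw s^-1 (s^-1 *: z.1)%R z.2)%:E)%E.
      by rewrite mule_ge0// lee_fin (pw_ge0 nu mxi r0 xir).
    exact: (measurable_tonelli nu mG G0).
  move=> y; apply: integral_ge0 => t _.
  by rewrite mule_ge0// lee_fin (pw_ge0 nu mxi r0 xir).
have [pi' piE] := weighted_image pi mw w0 w1 mphi.
exists pi'; split.
- move=> f mf f0; rewrite (piE (fun z => f z.1) (measurableT_comp mf measurable_fst) (fun z => f0 _)).
  rewrite (post (fun z => f z.1) (measurableT_comp mf measurable_fst) (fun z => f0 _)).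
  by apply: eq_integral => t _; exact: (integral_prob_cst (gaussP d s^-1) (f (xi t))).
- move=> f mf f0; rewrite (piE (fun z => f z.2) (measurableT_comp mf measurable_snd) (fun z => f0 _)).
  apply: eq_integral => z _.
  have mwz : measurable_fun setT (fun t => (w (z, t))%:E).
    apply/measurable_EFinP; apply: (measurableT_comp mw (_ : measurable_fun setT (fun t => (z, t)))).
    by apply: measurable_fun_pair; [exact: measurable_cst|exact: measurable_id].
  have w0E t : [set: T] t -> (0 <= (w (z, t))%:E)%E by move=> _; rewrite lee_fin.
  by rewrite (ge0_integralZl _ measurableT mwz w0E (f0 _)) w1 mule1.
have mq : measurable_fun setT (fun z : V * V => (nrm2 (z.1 - z.2))%:E).
  apply/measurable_EFinP; apply: measurable_nrm2.
  exact: (measurable_rowB measurable_fst measurable_snd).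
have q0 (z : V * V) : (0 <= (nrm2 (z.1 - z.2))%:E)%E by rewrite lee_fin nrm2_ge0.
rewrite (piE _ mq q0).
pose a := Num.sqrt (d%:R * s); pose b := Num.sqrt e.
have ds0 : 0 < d%:R * s by rewrite mulr_gt0// ltr0n.
have a0 : 0 < a by rewrite sqrtr_gt0.
have b0 : 0 < b by rewrite sqrtr_gt0.
have a2 : a ^+ 2 = d%:R * s by rewrite sqr_sqrtr// ltW.
have b2 : b ^+ 2 = e by rewrite sqr_sqrtr// ltW.
(* This weight turns Young's inequality into Minkowski's: [(1 + c) a^2 + (1 + 1/c) b^2 = (a + b)^2].
   Positivity of [d] and [e] makes it well defined. *)
pose c := b / a; have c0 : 0 < c by rewrite divr_gt0.
pose g1 (z : (V * V) * T) := (nrm2 (xi z.2 - z.1.1) * w z)%:E.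
pose g2 (z : (V * V) * T) := (nrm2 (z.1.1 - z.1.2) * w z)%:E.
have mg1 : measurable_fun setT g1.
  apply/measurable_EFinP; apply: measurable_funM => //.
  by apply: measurable_nrm2; exact: measurable_rowB.
have mg2 : measurable_fun setT g2.
  apply/measurable_EFinP; apply: measurable_funM => //.
  by apply: measurable_nrm2; exact: measurable_rowB.
have g10 z : (0 <= g1 z)%E by rewrite lee_fin mulr_ge0// nrm2_ge0.
have g20 z : (0 <= g2 z)%E by rewrite lee_fin mulr_ge0// nrm2_ge0.
pose Q : probability ((V * V) * T)%type R := (pi \x nu)%E.
have i1 : (\int[Q]_z g1 z <= (a ^+ 2)%:E)%E.
  rewrite /Q (tonelli_prod pi nu mg1 g10) /g1.
  under eq_integral do under eq_integral do rewrite EFinM.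
  rewrite (post _ mq q0) a2 -[leRHS](integral_prob_cst nu).
  apply: ge0_le_integral.
  - exact: measurableT.
  - by move=> t _; apply: integral_ge0 => v _; exact: (q0 (xi t, xi t + s *: v)).
  - have mS : measurable_fun setT (fun z : T * V => (nrm2 (xi z.1 - (xi z.1 + s *: z.2)))%:E).
      have mx1 : measurable_fun setT (fun z : T * V => xi z.1).
        exact: (measurableT_comp mxi measurable_fst).
      apply/measurable_EFinP; apply: measurable_nrm2; apply: measurable_rowB => //.
      apply: measurable_rowD => //; exact: (measurableT_comp (mscale s) measurable_snd).
    by apply: (measurable_tonelli (gaussP d s^-1) mS) => z; rewrite lee_fin nrm2_ge0.
  - exact: measurable_cst.
  move=> t _; under eq_integral do rewrite /= opprD addrA subrr sub0r nrm2N.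
  have mn : measurable_fun setT (fun v : V => (nrm2 v)%:E).
    by apply/measurable_EFinP; apply: measurable_nrm2; exact: measurable_id.
  rewrite (gauss_scale si0 s0 mn (fun v => nrm2_ge0 v)).
  have -> : s ^+ 2 * s^-1 = s by rewrite expr2 mulfK// gt_eqF.
  exact: gauss_nrm2.
have i2 : (\int[Q]_z g2 z <= (b ^+ 2)%:E)%E.
  rewrite /Q (tonelli_prod pi nu mg2 g20) /g2 b2; apply: le_trans pie.
  rewrite le_eqVlt; apply/orP; left; apply/eqP; apply: eq_integral => z _ /=.
  under eq_integral do rewrite EFinM.
  have mwz : measurable_fun setT (fun t => (w (z, t))%:E).
    apply/measurable_EFinP; apply: (measurableT_comp mw (_ : measurable_fun setT (fun t => (z, t)))).
    by apply: measurable_fun_pair; [exact: measurable_cst|exact: measurable_id].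
  have w0E t : [set: T] t -> (0 <= (w (z, t))%:E)%E by move=> _; rewrite lee_fin.
  by rewrite (ge0_integralZl _ measurableT mwz w0E (q0 _)) w1 mule1.
have mG : measurable_fun setT (fun z => (nrm2 ((phi z).1 - (phi z).2))%:E * (w z)%:E)%E.
  apply: emeasurable_funM; last exact/measurable_EFinP.
  exact: (measurableT_comp mq mphi).
have G0 z : (0 <= (nrm2 ((phi z).1 - (phi z).2))%:E * (w z)%:E)%E.
  by apply: mule_ge0; rewrite lee_fin; [exact: nrm2_ge0|exact: w0].
rewrite -(tonelli_prod pi nu mG G0) -/Q.
have c1 : 0 <= 1 + c by rewrite addr_ge0// ltW.
have c2 : 0 <= 1 + c^-1 by rewrite addr_ge0// invr_ge0 ltW.
have c1E : (0 <= (1 + c)%:E)%E by rewrite lee_fin.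
have c2E : (0 <= (1 + c^-1)%:E)%E by rewrite lee_fin.
have mk1 : measurable_fun setT (fun z => (1 + c)%:E * g1 z)%E.
  by apply: emeasurable_funM => //; exact: measurable_cst.
have mk2 : measurable_fun setT (fun z => (1 + c^-1)%:E * g2 z)%E.
  by apply: emeasurable_funM => //; exact: measurable_cst.
have k10 z : [set: (V * V) * T] z -> (0 <= (1 + c)%:E * g1 z)%E by move=> _; rewrite mule_ge0.
have k20 z : [set: (V * V) * T] z -> (0 <= (1 + c^-1)%:E * g2 z)%E by move=> _; rewrite mule_ge0.
apply: (@le_trans _ _ (\int[Q]_z ((1 + c)%:E * g1 z + (1 + c^-1)%:E * g2 z))%E).
  apply: ge0_le_integral.
  - exact: measurableT.
  - by move=> z _; exact: G0.
  - exact: mG.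
  - exact: (emeasurable_funD mk1 mk2).
  move=> z _; rewrite /g1 /g2 -!EFinM -EFinD lee_fin.
  have -> : (1 + c) * (nrm2 (xi z.2 - z.1.1) * w z) + (1 + c^-1) * (nrm2 (z.1.1 - z.1.2) * w z) =
    ((1 + c) * nrm2 (xi z.2 - z.1.1) + (1 + c^-1) * nrm2 (z.1.1 - z.1.2)) * w z by ring.
  apply: ler_wpM2r; first exact: w0.
  rewrite /phi /=.
  have := nrm2D_young (xi z.2 - z.1.1) (z.1.1 - z.1.2) c0.
  have -> : xi z.2 - z.1.1 + (z.1.1 - z.1.2) = xi z.2 - z.1.2 by rewrite addrA subrK.
  exact.
rewrite (ge0_integralD _ measurableT k10 mk1 k20 mk2).
rewrite (ge0_integralZl _ measurableT mg1 (fun z _ => g10 z) c1E).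
rewrite (ge0_integralZl _ measurableT mg2 (fun z _ => g20 z) c2E).
apply: le_trans (leeD (lee_wpmul2l c1E i1) (lee_wpmul2l c2E i2)) _.
rewrite -!EFinM -EFinD lee_fin le_eqVlt; apply/orP; left; apply/eqP.
by rewrite -/a -/b /c invf_div; field; rewrite !gt_eqF.
Qed.

End posterior_draw.

(** * Accumulation of the errors *)

Section potential.
Context {R : realType} (d : nat) (r eps : R).
Implicit Types h s t u : R.

(* Integrating factor of the one-step error recursion, equal to one at [eps]. *)
Definition potential t : R :=
  (eps / t) ^+ 2 * expR (2 * r ^+ 2 * (eps^-1 - t^-1)).

Lemma potential_ge0 t : 0 <= potential t.
Proof. by rewrite mulr_ge0 ?sqr_ge0 ?expR_ge0. Qed.

Lemma potential_le t : 0 < t ->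
  potential t <= (eps / t) ^+ 2 * expR (2 * r ^+ 2 / eps).
Proof.
move=> t0; apply: ler_wpM2l; first exact: sqr_ge0.
rewrite ler_expR mulrBr gerBl; apply: divr_ge0; last exact: ltW.
by rewrite mulr_ge0// sqr_ge0.
Qed.

(** The factor equals [u / (u + h) * (1 + q)] with [q = r^2 (1/u - 1/(u + h))], and
    [1 + q <= expR q]. *)
Lemma potential_step h u : 0 < h -> 0 < u ->
  potential u * step_factor r h u ^+ 2 <= potential (u + h).
Proof.
move=> h0 u0; have s0 : 0 < u + h by rewrite addr_gt0.
have [u1 s1] : u != 0 /\ u + h != 0 by rewrite !gt_eqF.
set q := r ^+ 2 * (h / (u * (u + h))).
have q0 : 0 <= q by rewrite mulr_ge0 ?sqr_ge0 ?divr_ge0 ?mulr_ge0// ltW.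
have -> : step_factor r h u = u / (u + h) * (1 + q).
  by rewrite /step_factor /q; field; rewrite u1 s1.
have -> : potential (u + h) = (eps / (u + h)) ^+ 2 *
    (expR (2 * r ^+ 2 * (eps^-1 - u^-1)) * expR q ^+ 2).
  rewrite /potential; congr (_ * _).
  rewrite [expR q ^+ 2]expr2 -!expRD; congr expR; rewrite /q.
  have -> : h / (u * (u + h)) = u^-1 - (u + h)^-1 by field; rewrite u1 s1.
  ring.
have -> : potential u * (u / (u + h) * (1 + q)) ^+ 2 = (eps / (u + h)) ^+ 2 *
    (expR (2 * r ^+ 2 * (eps^-1 - u^-1)) * (1 + q) ^+ 2).
  rewrite /potential; by move: (expR _) => E; field; rewrite u1 s1.
apply: ler_wpM2l; first exact: sqr_ge0.
apply: ler_wpM2l; first exact: expR_ge0.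
have e1 : 1 + q <= expR q by exact: expR_ge1Dx.
by rewrite ler_sqr ?nnegrE ?expR_ge0// addr_ge0.
Qed.

Lemma step_error_ge0 h u : 0 < h -> 0 < u -> 0 <= step_error (d:=d) r h u.
Proof.
move=> h0 u0; have s0 : 0 < u + h by rewrite addr_gt0.
have r4 : 0 <= r ^+ 4 by rewrite exprn_even_ge0.
apply: addr_ge0.
  apply: divr_ge0; last by apply: mulr_ge0; [exact: ltW|exact: exprn_ge0 (ltW s0)].
  apply: mulr_ge0; first by rewrite divr_ge0.
  by apply: mulr_ge0 => //; exact: exprn_ge0 (ltW h0).
apply: divr_ge0; last exact: exprn_ge0 (ltW s0).
by apply: mulr_ge0 => //; exact: exprn_ge0 (ltW h0).
Qed.

(** The integrals of [t^-6] and [t^-4] over [[u, s]], [s = u + h], are at least [h] times the values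
    at the geometric mean of [u] and [s]. After clearing denominators the gaps are
    [(u^2 - s^2)^2 + u s (u - s)^2] and [(u - s)^2], up to positive factors. *)
Lemma step_error_le h u : 0 < h -> 0 < u ->
  step_error (d:=d) r h u / u ^+ 2 <= h ^+ 2 *
    (3 / 10 * r ^+ 4 * (u ^- 5 - (u + h) ^- 5) + d%:R / 3 * (u ^- 3 - (u + h) ^- 3)).
Proof.
move=> h0 u0; have s0 : 0 < u + h by rewrite addr_gt0.
have [u1 s1] : u != 0 /\ u + h != 0 by rewrite !gt_eqF.
set s := u + h in s0 s1 *.
have us : u <= s by rewrite lerDl ltW.
have hE : h = s - u by rewrite /s addrC addKr.
have u0' := ltW u0; have s0' := ltW s0.
have -> : step_error (d:=d) r h u / u ^+ 2 = h ^+ 2 *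
   (3 / 2 * r ^+ 4 * (h / (u ^+ 3 * s ^+ 3)) + d%:R * (h / (u ^+ 2 * s ^+ 2))).
  by rewrite /step_error -/s; field; rewrite u1 s1.
apply: ler_wpM2l; first exact: sqr_ge0.
have r4 : 0 <= r ^+ 4 by rewrite exprn_even_ge0.
have us2 : u ^+ 2 <= u * s by rewrite expr2 ler_wpM2l.
have us3 : u * s <= s ^+ 2 by rewrite expr2 ler_wpM2r.
apply: lerD.
  have -> : 3 / 10 * r ^+ 4 * (u ^- 5 - s ^- 5) =
      3 / 2 * r ^+ 4 * ((u ^- 5 - s ^- 5) / 5) by field; rewrite u1 s1.
  apply: ler_wpM2l; first by rewrite mulr_ge0.
  rewrite ler_pdivlMr// -subr_ge0.
  have -> : u ^- 5 - s ^- 5 - h / (u ^+ 3 * s ^+ 3) * 5 =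
    h / (u ^+ 5 * s ^+ 5) * (u ^+ 4 + u ^+ 3 * s + u * s ^+ 3 + s ^+ 4 - 4 * (u * s) ^+ 2).
    by rewrite hE; field; rewrite u1 s1.
  apply: mulr_ge0.
    by apply: divr_ge0; [exact: ltW|apply: mulr_ge0; exact: exprn_ge0].
  have -> : u ^+ 4 + u ^+ 3 * s + u * s ^+ 3 + s ^+ 4 - 4 * (u * s) ^+ 2 =
    (u ^+ 2 - s ^+ 2) ^+ 2 + u * s * (u - s) ^+ 2 by ring.
  apply: addr_ge0; first exact: sqr_ge0.
  by apply: mulr_ge0; [exact: mulr_ge0|exact: sqr_ge0].
have -> : d%:R / 3 * (u ^- 3 - s ^- 3) = d%:R * ((u ^- 3 - s ^- 3) / 3).
  by field; rewrite u1 s1.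
apply: ler_wpM2l => //.
rewrite ler_pdivlMr// -subr_ge0.
have -> : u ^- 3 - s ^- 3 - h / (u ^+ 2 * s ^+ 2) * 3 =
  h / (u ^+ 3 * s ^+ 3) * (u - s) ^+ 2.
  by rewrite hE; field; rewrite u1 s1.
apply: mulr_ge0; last exact: sqr_ge0.
by apply: divr_ge0; [exact: ltW|apply: mulr_ge0; exact: exprn_ge0].
Qed.

Lemma error_recursion (T h : R) (N : nat) (E : nat -> R) : 0 < eps -> 0 < h ->
  T = eps + N%:R * h ->
  (forall n, (n <= N)%N -> 0 <= E n) ->
  (forall n, (n < N)%N ->
    E n.+1 <= step_factor r h (T - n.+1%:R * h) ^+ 2 * E n + step_error (d:=d) r h (T - n.+1%:R * h)) ->
  E N <= expR (2 * r ^+ 2 / eps) *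
    ((eps / T) ^+ 2 * E 0%N + h ^+ 2 * (3 / 10 * r ^+ 4 / eps ^+ 3 + d%:R / (3 * eps))).
Proof.
move=> e0 h0 TE E0 HE; have h0' := ltW h0; have e0' := ltW e0.
pose t n := T - n%:R * h.
have tS n : t n = t n.+1 + h by rewrite /t -natr1; ring.
have te n : (n <= N)%N -> eps <= t n.
  move=> nN; rewrite /t TE -addrA lerDl subr_ge0 ler_wpM2r//.
  by rewrite ler_nat.
set K := expR _; have K0 : 0 <= K by exact: expR_ge0.
(* [B n] is the telescoped sum after [n] steps and bounds [potential (t n) * E n]. At [t N = eps]
   the potential is 1, so the invariant bounds [E N] itself. *)
pose B n := potential T * E 0%N + eps ^+ 2 * K * h ^+ 2 *
  (3 / 10 * r ^+ 4 * (t n ^- 5 - T ^- 5) + d%:R / 3 * (t n ^- 3 - T ^- 3)).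
have t0E : t 0%N = T by rewrite /t mul0r subr0.
have rec n : (n <= N)%N -> potential (t n) * E n <= B n.
  elim: n => [_|n IH nN].
    by rewrite /B t0E !subrr !mulr0 addr0 mulr0 addr0.
  have u0 : 0 < t n.+1 := lt_le_trans e0 (te _ nN).
  have P0 := potential_ge0 (t n.+1).
  apply: le_trans (ler_wpM2l P0 (HE _ nN)) _.
  rewrite -/(t n.+1) mulrDr mulrA.
  have -> : B n.+1 = B n + eps ^+ 2 * K * (h ^+ 2 *
      (3 / 10 * r ^+ 4 * (t n.+1 ^- 5 - (t n.+1 + h) ^- 5) +
       d%:R / 3 * (t n.+1 ^- 3 - (t n.+1 + h) ^- 3))).
    by rewrite -tS /B; ring.
  apply: lerD.
    apply: le_trans (IH (ltnW nN)); rewrite [t n]tS.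
    exact: (ler_wpM2r (E0 _ (ltnW nN)) (potential_step h0 u0)).
  have err := step_error_le h0 u0.
  apply: (@le_trans _ _ (eps ^+ 2 * K * (step_error (d:=d) r h (t n.+1) / t n.+1 ^+ 2))).
    have -> : eps ^+ 2 * K * (step_error (d:=d) r h (t n.+1) / t n.+1 ^+ 2) =
      (eps / t n.+1) ^+ 2 * K * step_error (d:=d) r h (t n.+1).
      by field; rewrite gt_eqF.
    by apply: ler_wpM2r; [exact: step_error_ge0|exact: potential_le].
  by apply: ler_wpM2l => //; rewrite mulr_ge0 ?sqr_ge0.
have PT : potential (t N) = 1.
  have -> : t N = eps by rewrite /t TE addrK.
  by rewrite /potential divff ?gt_eqF// expr1n mul1r subrr mulr0 expR0.
have := rec N (leqnn N); rewrite PT mul1r => EB; apply: le_trans EB _.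
rewrite /B [leRHS]mulrDr; have -> : t N = eps by rewrite /t TE addrK.
have T0 : 0 < T by rewrite TE ltr_wpDr// mulr_ge0.
apply: lerD.
  by rewrite mulrA; apply: ler_wpM2r; [exact: E0|rewrite mulrC; exact: potential_le].
have -> : K * (h ^+ 2 * (3 / 10 * r ^+ 4 / eps ^+ 3 + d%:R / (3 * eps))) =
    eps ^+ 2 * K * h ^+ 2 * (3 / 10 * r ^+ 4 * eps ^- 5 + d%:R / 3 * eps ^- 3).
  by field; rewrite gt_eqF.
apply: ler_wpM2l; first by rewrite !mulr_ge0 ?sqr_ge0.
have r4 : 0 <= r ^+ 4 by rewrite exprn_even_ge0.
apply: lerD; apply: ler_wpM2l; rewrite ?gerBl ?invr_ge0 ?exprn_ge0 ?(ltW T0)//.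
  by rewrite mulr_ge0.
Qed.

End potential.

(** * Chaining the couplings along the sampler *)

Section sampler_coupling.
Context {R : realType} {d : nat} d' (T0 : measurableType d') (nu : probability T0 R).
Local Notation V := 'rV[R]_d.
Variables (xi : T0 -> V) (r : R).
Hypotheses (mxi : measurable_fun setT xi) (r0 : 0 < r).
Hypothesis xir : forall t, nrm2 (xi t) <= r ^+ 2.

Lemma powR32_sqr (x : R) : 0 <= x -> (x `^ (3 / 2)) ^+ 2 = x ^+ 3.
Proof.
move=> x0; rewrite -powR_mulrn ?powR_ge0// -powRrM.
have -> : 3 / 2 * 2%:R = 3%:R :> R by field.
by rewrite powR_mulrn.
Qed.

(** With [A], [B] the two terms on the right, the radicand is at most [A^2 + B^2]. For [A] this is
    [3/4 <= 4]. For [B], [eps <= r^2] gives [d / (3 eps) <= d/3 * r^4 / eps^3], and [3/10 <= d/3] as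
    [d >= 1]; together they make the constant [2 d / 3]. *)
Lemma sqrt_bound (eps h T : R) : (0 < d)%N -> 0 < eps -> eps <= r ^+ 2 -> 0 < h -> 0 < T ->
  Num.sqrt (expR (2 * r ^+ 2 / eps) * ((eps / T) ^+ 2 * (3 / 4 * (r ^+ 4 / T)) +
     h ^+ 2 * (3 / 10 * r ^+ 4 / eps ^+ 3 + d%:R / (3 * eps)))) <=
  2 * eps / T `^ (3 / 2) * expR (r ^+ 2 / eps) * r ^+ 2 +
  Num.sqrt (2 * d%:R / 3) * (r ^+ 2 / eps `^ (3 / 2)) * expR (r ^+ 2 / eps) * h.
Proof.
move=> d0 e0 er h0 T00.
have KE : expR (2 * r ^+ 2 / eps) = expR (r ^+ 2 / eps) ^+ 2.
  by rewrite [RHS]expr2 -expRD; congr expR; field; rewrite gt_eqF.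
have K0 : 0 < expR (r ^+ 2 / eps) by exact: expR_gt0.
rewrite KE; move: (expR (r ^+ 2 / eps)) K0 => K K0.
have Tp : 0 < T `^ (3 / 2) by rewrite powR_gt0.
have ep : 0 < eps `^ (3 / 2) by rewrite powR_gt0.
have T2 := powR32_sqr (ltW T00); have e2 := powR32_sqr (ltW e0).
have d1 : 1 <= d%:R :> R by rewrite ler1n.
have q0 : 0 <= 2 * d%:R / 3 :> R by rewrite divr_ge0 ?mulr_ge0.
have q2 := sqr_sqrtr q0.
have q00 : 0 <= Num.sqrt (2 * d%:R / 3 : R) by exact: sqrtr_ge0.
move: (T `^ (3 / 2)) (eps `^ (3 / 2)) (Num.sqrt (2 * d%:R / 3)) Tp ep T2 e2 q2 q00.
move=> p q z p0 q1 p2 qq z2 z0.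
have T1 : T != 0 by rewrite gt_eqF.
have e1 : eps != 0 by rewrite gt_eqF.
have p1 : p != 0 by rewrite gt_eqF.
have q3 : q != 0 by rewrite gt_eqF.
have A0 : 0 <= 2 * eps / p * K * r ^+ 2.
  by apply: mulr_ge0; [apply: mulr_ge0; [apply: divr_ge0; [rewrite mulr_ge0// ltW|exact: ltW]|exact: ltW]|exact: sqr_ge0].
have B0 : 0 <= z * (r ^+ 2 / q) * K * h.
  apply: mulr_ge0 _ (ltW h0); apply: mulr_ge0 _ (ltW K0); apply: mulr_ge0 => //.
  by apply: divr_ge0; [exact: sqr_ge0|exact: ltW].
rewrite -[leRHS]ger0_norm ?addr_ge0// -sqrtr_sqr ler_wsqrtr//.
set A := 2 * eps / p * K * r ^+ 2 in A0 *; set B := z * (r ^+ 2 / q) * K * h in B0 *.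
apply: (@le_trans _ _ (A ^+ 2 + B ^+ 2)); last by rewrite sqrrD; have := mulr_ge0 A0 B0; lra.
have -> : A ^+ 2 = K ^+ 2 * ((eps / T) ^+ 2 * (4 * (r ^+ 4 / T))).
  rewrite /A; transitivity (4 * eps ^+ 2 / p ^+ 2 * K ^+ 2 * r ^+ 4); first by field.
  by rewrite p2; field.
have -> : B ^+ 2 = K ^+ 2 * (h ^+ 2 * (2 * d%:R / 3 * (r ^+ 4 / eps ^+ 3))).
  rewrite /B; transitivity (z ^+ 2 * (r ^+ 4 / q ^+ 2) * K ^+ 2 * h ^+ 2); first by field.
  by rewrite z2 qq; ring.
rewrite -mulrDr; apply: ler_wpM2l; first exact: sqr_ge0.
have r4 : 0 <= r ^+ 4 by rewrite exprn_even_ge0.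
apply: lerD; apply: ler_wpM2l; rewrite ?sqr_ge0//.
  by have : 0 <= r ^+ 4 / T by [exact: divr_ge0 r4 (ltW T00)]; lra.
have -> : d%:R / (3 * eps) = d%:R / 3 * (eps ^+ 2 / eps ^+ 3) by field.
have e30 : 0 <= (eps ^+ 3)^-1 by rewrite invr_ge0 exprn_ge0// ltW.
have le1 : eps ^+ 2 / eps ^+ 3 <= r ^+ 4 / eps ^+ 3.
  apply: ler_wpM2r => //; have -> : r ^+ 4 = (r ^+ 2) ^+ 2 by ring.
  by rewrite ler_sqr ?nnegrE ?sqr_ge0 ?(ltW e0).
have g0 : 0 <= r ^+ 4 / eps ^+ 3 by exact: mulr_ge0.
rewrite -mulrA; move: (r ^+ 4 / eps ^+ 3) (eps ^+ 2 / eps ^+ 3) le1 g0 => G F le1 g0.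
have : d%:R / 3 * F <= d%:R / 3 * G by rewrite ler_wpM2l// divr_ge0.
have : 1 * G <= d%:R * G by rewrite ler_wpM2r.
lra.
Qed.

Fixpoint cost_bound (h T : R) (n : nat) : R :=
  match n with
  | 0%N => 3 / 4 * (r ^+ 4 / T)
  | n'.+1 => step_factor r h (T - n'.+1%:R * h) ^+ 2 * cost_bound h T n' +
      step_error (d:=d) r h (T - n'.+1%:R * h)
  end.

(** [J n f] stands for the expectation of [f] at the [n]-th iterate. Only the recursion of these
    functionals enters, so the coupling is built without reference to the space that carries the
    sampler. *)
Lemma sampler_coupling (eps h : R) (N : nat) (J : nat -> (V -> \bar R) -> \bar R) :
  (0 < d)%N -> 0 < eps -> 0 < h -> h <= eps -> eps <= r ^+ 2 -> mp nu xi 0 0 = 0 ->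
  let T := eps + N%:R * h in
  (forall f, measurable_fun setT f -> (forall x, 0 <= f x)%E ->
    (J 0%N f = \int[gaussP d T]_v f v)%E) ->
  (forall n f, (n < N)%N -> measurable_fun setT f -> (forall x, 0 <= f x)%E ->
    J n.+1 f = J n (fun x => \int[gaussP d h]_v f (em_mean nu xi h (T - n%:R * h) x + v)%R)%E) ->
  exists pi : probability (V * V)%type R,
  [/\ forall f, measurable_fun setT f -> (forall x, 0 <= f x)%E ->
        (\int[pi]_z f z.1 = \int[nu]_t f (xi t))%E,
      forall f, measurable_fun setT f -> (forall x, 0 <= f x)%E ->
        (\int[pi]_z f z.2 = J N f)%E &
      (\int[pi]_z (nrm2 (z.1 - z.2))%:E <=
       ((Num.sqrt (d%:R * eps)
         + (2 * eps / T `^ (3 / 2) * expR (r ^+ 2 / eps) * r ^+ 2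
         + Num.sqrt (2 * d%:R / 3) * (r ^+ 2 / eps `^ (3 / 2)) * expR (r ^+ 2 / eps) * h)) ^+ 2)%:E)%E].
Proof.
move=> d0 e0 h0 he er m0 T J0 JS; have h0' := ltW h0.
have T00 : 0 < T by rewrite ltr_wpDr// mulr_ge0.
have te n : (n <= N)%N -> eps <= T - n%:R * h.
  move=> nN; rewrite /T -addrA lerDl subr_ge0 ler_wpM2r//.
  by rewrite ler_nat.
have tS n : T - n.+1%:R * h + h = T - n%:R * h by rewrite -natr1; ring.
have chain n : (n <= N)%N -> exists pi : probability (V * V)%type R,
  [/\ forall f, measurable_fun setT f -> (forall x, 0 <= f x)%E ->
        (\int[pi]_z f z.1 = noisy_integral nu xi (T - n%:R * h) f)%E,
      forall f, measurable_fun setT f -> (forall x, 0 <= f x)%E ->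
        (\int[pi]_z f z.2 = J n f)%E &
      (\int[pi]_z (nrm2 (z.1 - z.2))%:E <= (cost_bound h T n)%:E)%E].
  elim: n => [_|n IH nN].
    have [pi [p1 p2 p3]] := noisy_initial mxi r0 xir T00 m0.
    exists pi; split => //; first by rewrite mul0r subr0.
    by move=> f mf f0; rewrite p2// J0.
  have [pi [p1 p2 p3]] := IH (ltnW nN).
  have hu : h <= T - n.+1%:R * h := le_trans he (te _ nN).
  have p1' f : measurable_fun setT f -> (forall x, 0 <= f x)%E ->
      (\int[pi]_z f z.1 = noisy_integral nu xi (T - n.+1%:R * h + h) f)%E.
    by rewrite tS; exact: p1.
  have [pi' [q1 q2 q3]] := euler_step mxi r0 xir h0 hu p1' p3.
  exists pi'; split => // f mf f0; rewrite q2// JS// tS -p2//.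
    have mem := measurable_em nu mxi r0 xir h (T - n%:R * h).
    have mF : measurable_fun setT (fun z : V * V => f (em_mean nu xi h (T - n%:R * h) z.1 + z.2)).
      apply: (measurableT_comp mf); apply: measurable_rowD; last exact: measurable_snd.
      exact: (measurableT_comp mem measurable_fst).
    exact: (measurable_tonelli (gaussP d h) mF (fun z => f0 _)).
  by move=> x; apply: integral_ge0.
have [pi [p1 p2 p3]] := chain N (leqnn N).
have tN : T - N%:R * h = eps by rewrite /T addrK.
rewrite tN in p1.
set E := expR (2 * r ^+ 2 / eps) * ((eps / T) ^+ 2 * (3 / 4 * (r ^+ 4 / T)) +
     h ^+ 2 * (3 / 10 * r ^+ 4 / eps ^+ 3 + d%:R / (3 * eps))).
have r4 : 0 < r ^+ 4 by exact: exprn_gt0.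
have q0 : 0 < 3 / 4 * (r ^+ 4 / T) by rewrite mulr_gt0 ?divr_gt0.
have u0 n : (n <= N)%N -> 0 < T - n%:R * h by move=> nN; exact: lt_le_trans e0 (te _ nN).
have E0 : 0 < E.
  rewrite mulr_gt0 ?expR_gt0// ltr_wpDr//.
    by rewrite mulr_ge0 ?sqr_ge0// addr_ge0// divr_ge0 ?mulr_ge0 ?exprn_ge0// ltW.
  by rewrite mulr_gt0// exprn_gt0// divr_gt0.
have cE : ((cost_bound h T N)%:E <= E%:E)%E.
  rewrite lee_fin.
  apply: (@error_recursion R d r eps T h N (cost_bound h T) e0 h0 erefl); last first.
    by move=> n _; exact: lexx.
  elim=> [_|n IH nN] /=; first exact: ltW.
  apply: addr_ge0; last by apply: step_error_ge0 => //; exact: u0.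
  by apply: mulr_ge0; [exact: sqr_ge0|exact: IH (ltnW nN)].
have [pi' [s1 s2 s3]] := posterior_draw mxi r0 xir d0 e0 E0 p1 (le_trans p3 cE).
exists pi'; split => //; first by move=> f mf f0; rewrite s2// p2.
have sb := sqrt_bound d0 e0 er h0 T00.
have AB0 := le_trans (sqrtr_ge0 _) sb.
apply: le_trans s3 _; rewrite lee_fin ler_sqr ?nnegrE.
- by rewrite lerD2l.
- exact: addr_ge0 (sqrtr_ge0 _) (sqrtr_ge0 _).
- exact: addr_ge0 (sqrtr_ge0 _) AB0.
Qed.

End sampler_coupling.

(** * Law of the sampler *)

Section rectangles.
Context d1 d2 (S1 : measurableType d1) (S2 : measurableType d2) (R : realType).

(** Uniqueness on rectangles, with the factor [c] absorbed into the first measure. The value [c = 0]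
    must be allowed, since [c] will be the probability of an event about later noise. *)
Lemma product_scale_unique (m : {measure set (S1 * S2) -> \bar R})
    (p1 : probability S1 R) (p2 : probability S2 R) (c : R) : 0 <= c ->
  (forall A B, measurable A -> measurable B -> m (A `*` B) = c%:E * (p1 A * p2 B))%E ->
  forall D, measurable D -> m D = (c%:E * (p1 \x p2) D)%E.
Proof.
move=> c0 H D mD; pose k := NngNum c0.
have mE A B : measurable A -> measurable B -> (m (A `*` B) = mscale k p1 A * p2 B)%E.
  by move=> mA mB; rewrite H//= /mscale/= muleA.
rewrite -(product_measure_unique mE mD) /=.
rewrite /product_measure1 ge0_integral_mscale//.
exact: measurable_fun_xsection.
Qed.

End rectangles.

(** * Independence of an iterate from later noise *)

Section independent_recursion.
Context {R : realType} {d : nat} dS (S : measurableType dS) (Q : probability S R).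
Local Notation V := 'rV[R]_d.
Variables (N : nat) (X Z : nat -> S -> V) (F : nat -> V -> V).
Hypotheses (mX : forall n, measurable_fun setT (X n))
  (mZ : forall n, measurable_fun setT (Z n)) (mF : forall n, measurable_fun setT (F n)).
Hypothesis XS : forall n w, (n < N)%N -> X n.+1 w = F n (X n w) + Z n.+1 w.

(** Cylinder event on the noises after step [n]; independence from the future is tested on these. *)
Definition future n (C : nat -> set V) : set S :=
  \bigcap_(k in [set k | (n < k <= N)%N]) (Z k @^-1` C k).

Definition future_prob n (C : nat -> set V) : R :=
  \prod_(n.+1 <= k < N.+1) fine (Q (Z k @^-1` C k)).

Hypothesis indep0 : forall C, (forall n, measurable (C n)) ->
  Q (X 0%N @^-1` C 0%N `&` future 0 C) = (Q (X 0%N @^-1` C 0%N) * (future_prob 0 C)%:E)%E.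

Let mpre (Y : S -> V) A : measurable_fun setT Y -> measurable A -> measurable (Y @^-1` A).
Proof. by move=> mY mA; rewrite -[X in measurable X]setTI; exact: mY. Qed.

Lemma measurable_future n C : (forall n, measurable (C n)) -> measurable (future n C).
Proof. by move=> mC; apply: bigcap_measurableType => k _; exact: mpre. Qed.

Lemma future_prob_ge0 n C : 0 <= future_prob n C.
Proof. by apply: prodr_ge0 => k _; exact: fine_ge0. Qed.

Let upd (C : nat -> set V) m D k := if k == m then D else C k.

Lemma futureS n C D : (n < N)%N ->
  future n (upd C n.+1 D) = Z n.+1 @^-1` D `&` future n.+1 C.
Proof.
move=> nN; rewrite /future /upd; apply/seteqP; split => w.
  move=> H; split; first by have := H n.+1; rewrite /= eqxx ltnSn nN; exact.
  move=> k /= /andP[nk kN]; have := H k; rewrite /= (ltn_trans _ nk)// kN gtn_eqF//.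
  exact.
move=> [wD H] k /= /andP[nk kN]; case: eqP => [->//|/eqP kn].
by apply: H; rewrite /= kN andbT ltn_neqAle eq_sym kn.
Qed.

Lemma future_probS n C D : (n < N)%N ->
  future_prob n (upd C n.+1 D) = fine (Q (Z n.+1 @^-1` D)) * future_prob n.+1 C.
Proof.
move=> nN; rewrite /future_prob big_ltn ?ltnS// /upd eqxx; congr (_ * _).
by rewrite !big_nat; apply: eq_bigr => k /andP[nk _]; rewrite gtn_eqF.
Qed.

Definition past_independent n := forall A C, measurable A ->
  (forall n, measurable (C n)) ->
  Q (X n @^-1` A `&` future n C) = (Q (X n @^-1` A) * (future_prob n C)%:E)%E.

Lemma future_setT n : future n (fun=> setT) = setT.
Proof. by apply/seteqP; split => // w _ k. Qed.

Lemma future_prob_setT n : future_prob n (fun=> setT) = 1.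
Proof. by rewrite /future_prob big1// => k _; rewrite preimage_setT probability_setT. Qed.

(** [Q] is restricted to the future event and pushed forward by the pair. On rectangles the result
    is a product by [past_independent n], applied with the next noise prescribed through [upd]. *)
Lemma future_joint n C D : (n < N)%N -> past_independent n ->
  (forall n, measurable (C n)) -> measurable D ->
  Q ((fun w => (X n w, Z n.+1 w)) @^-1` D `&` future n.+1 C) =
  ((future_prob n.+1 C)%:E * (plaw (mX n) Q \x plaw (mZ n.+1) Q) D)%E.
Proof.
move=> nN IH mC mD.
have mXZ : measurable_fun setT (fun w => (X n w, Z n.+1 w)) by exact: measurable_fun_pair.
have mE := measurable_future n.+1 mC.
have := @product_scale_unique _ _ _ _ _ (mpush mXZ (mrestr Q mE))
  (plaw (mX n) Q) (plaw (mZ n.+1) Q) _ (future_prob_ge0 n.+1 C) _ D mD.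
rewrite {1}/mpush /pushforward /mrestr /=; apply => A B mA mB.
have mupd k : measurable (upd C n.+1 B k) by rewrite /upd; case: ifP.
have := IH _ _ mA mupd.
rewrite (futureS _ _ nN) (future_probS _ _ nN) setIA => H; apply: etrans H _.
rewrite EFinM fineK; last by apply: fin_num_measure; exact: mpre.
by rewrite muleA [RHS]muleC.
Qed.

Lemma independent_step n C A : (n < N)%N -> past_independent n ->
  (forall n, measurable (C n)) -> measurable A ->
  Q (X n.+1 @^-1` A `&` future n.+1 C) =
  ((future_prob n.+1 C)%:E *
   (plaw (mX n) Q \x plaw (mZ n.+1) Q) [set z | A (F n z.1 + z.2)%R])%E.
Proof.
move=> nN IH mC mA.
have mG : measurable_fun setT (fun z : V * V => F n z.1 + z.2).
  apply: measurable_rowD; last exact: measurable_snd.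
  exact: (measurableT_comp (mF n) measurable_fst).
have mD : measurable [set z : V * V | A (F n z.1 + z.2)].
  by rewrite -[X in measurable X]setTI; exact: mG.
rewrite -(future_joint nN IH mC mD); congr (Q (_ `&` _)).
by apply/seteqP; split => w; rewrite /= XS.
Qed.

(** [X n.+1] is a function of the pair [(X n, Z n.+1)], whose joint law with the later noises
    factors. The same identity with trivial future sets identifies the remaining factor as the law
    of [X n.+1]. *)
Lemma past_independentP n : (n <= N)%N -> past_independent n.
Proof.
elim: n => [_ A C mA mC|n IH nN A C mA mC].
  pose C' k := if k is 0%N then A else C k.
  have mC' k : measurable (C' k) by case: k => [|k]; [exact: mA|exact: mC].
  have := indep0 mC'; rewrite /C' /future /future_prob.
  have -> : \bigcap_(k in [set k | (0 < k <= N)%N]) (Z k @^-1` C' k) =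
      \bigcap_(k in [set k | (0 < k <= N)%N]) (Z k @^-1` C k).
    by apply: eq_bigcapr => -[|k].
  have -> // : \prod_(1 <= k < N.+1) fine (Q (Z k @^-1` C' k)) =
    \prod_(1 <= k < N.+1) fine (Q (Z k @^-1` C k)).
  by rewrite !big_nat; apply: eq_bigr => -[|k].
have mT k : measurable [set: V] by [].
rewrite (independent_step nN (IH (ltnW nN)) mC mA) [LHS]muleC; congr (_ * _)%E.
have := independent_step nN (IH (ltnW nN)) (fun=> measurableT) mA.
by rewrite future_setT setIT future_prob_setT mul1e => ->.
Qed.

Lemma integral_recursion n (f : V -> \bar R) : (n < N)%N ->
  measurable_fun setT f -> (forall x, 0 <= f x)%E ->
  (\int[Q]_w f (X n.+1 w) =
   \int[Q]_w \int[plaw (mZ n.+1) Q]_v f (F n (X n w) + v)%R)%E.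
Proof.
move=> nN mf f0.
have mG : measurable_fun setT (fun z : V * V => F n z.1 + z.2).
  apply: measurable_rowD; last exact: measurable_snd.
  exact: (measurableT_comp (mF n) measurable_fst).
have mfG := measurableT_comp mf mG.
have fG0 z : (0 <= f (F n z.1 + z.2)%R)%E by exact: f0.
rewrite -(ge0_integral_plaw (mX n.+1) Q mf f0).
transitivity (\int[mpush mG (plaw (mX n) Q \x plaw (mZ n.+1) Q)%E]_y f y)%E.
  apply: eq_measure_integral => A mA _.
  have := independent_step nN (past_independentP (ltnW nN)) (fun=> measurableT) mA.
  by rewrite future_setT setIT future_prob_setT mul1e.
rewrite (ge0_integral_mpush mG _ mf f0).
rewrite (tonelli_prod (plaw (mX n) Q) (plaw (mZ n.+1) Q) mfG fG0).
have mI := measurable_tonelli (plaw (mZ n.+1) Q) mfG fG0.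
by apply: (ge0_integral_plaw (mX n) Q mI) => x; apply: integral_ge0 => v _; exact: f0.
Qed.

End independent_recursion.

(** * Density and score of the forward process *)

Section set_function_integral.
Context dT (T : measurableType dT) (R : realType).
Import HBNNSimple.

(** [lebesgue_row] is a bare set function, so measure theory does not apply to it directly. The
    integral evaluates a set function only on level sets of simple functions, hence agreement on
    measurable sets suffices. *)
Lemma eq_set_fun_integral (m1 m2 : set T -> \bar R) (D : set T) (f : T -> \bar R) :
  (forall A, measurable A -> m1 A = m2 A) ->
  (\int[m1]_(x in D) f x = \int[m2]_(x in D) f x)%E.
Proof.
move=> m12.
have sE (h : {nnsfun T >-> R}) : sintegral m1 h = sintegral m2 h.
  rewrite !sintegralET; apply: eq_fsbigr => x _; congr (_ * _)%E; apply: m12.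
  exact: measurable_sfunP.
by rewrite /integral; congr (_ - _)%E; congr ereal_sup; apply: eq_imagel => h _; exact: sE.
Qed.

End set_function_integral.

(** * Lebesgue measure as a density relative to a Gaussian *)

Section lebesgue_gauss.
Context {R : realType}.
Variable s : R.
Hypothesis s0 : 0 < s.

(* inverse of the density of [N(0, s I)] *)
Definition inv_gauss_pdf d (v : 'rV[R]_d) : R :=
  (normal_peak (Num.sqrt s))^-1 ^+ d * expR (nrm2 v / (2 * s)).

Lemma peak_gt0 : 0 < normal_peak (Num.sqrt s).
Proof. by rewrite normal_peak_gt0// gt_eqF// sqrtr_gt0. Qed.

Lemma inv_gauss_pdf_gt0 d (v : 'rV[R]_d) : 0 < inv_gauss_pdf v.
Proof. by rewrite mulr_gt0 ?expR_gt0// exprn_gt0// invr_gt0 peak_gt0. Qed.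

Lemma inv_gauss_pdf_cons d x (v : 'rV[R]_d) :
  inv_gauss_pdf (cons_row (x, v)) * pdf1 s x = inv_gauss_pdf v.
Proof.
have k0 := peak_gt0; rewrite /inv_gauss_pdf (pdf1E _ s0) nrm2_cons exprS.
have -> : expR ((x ^+ 2 + nrm2 v) / (2 * s)) =
    expR (nrm2 v / (2 * s)) * (expR (- x ^+ 2 / (2 * s)))^-1.
  rewrite -expRN -expRD; congr expR; ring.
have e0 := expR_gt0 (- x ^+ 2 / (2 * s)).
move: (expR (- x ^+ 2 / (2 * s))) e0 => e e0.
by field; rewrite !gt_eqF.
Qed.

Lemma measurable_inv_gauss_pdf d : measurable_fun setT (@inv_gauss_pdf d).
Proof.
apply: measurable_funM; first exact: measurable_cst.
apply: (measurableT_comp (@measurable_expR R)); apply: measurable_funM.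
  by apply: measurable_nrm2; exact: measurable_id.
exact: measurable_cst.
Qed.

(** The inverse density factors over head and tail, so the recursion that defines [lebesgue_row]
    matches the Gaussian one. All integrals against Lebesgue measure on rows can thus be taken
    against a probability. *)
Lemma lebesgue_rowE d (A : set 'rV[R]_d) : measurable A ->
  lebesgue_row R d A = (\int[gaussP d s]_v (\1_A v * inv_gauss_pdf v)%:E)%E.
Proof.
elim: d A => [|d IH] A mA.
  rewrite (@ge0_integral_gauss0 R s (fun v => (\1_A v * inv_gauss_pdf v)%:E)).
  by rewrite /inv_gauss_pdf expr0 mul1r /nrm2 dot0l mul0r expR0 mulr1 /lebesgue_row/= diracE indicE.
have mAw : measurable_fun setT (fun v : 'rV[R]_d.+1 => (\1_A v * inv_gauss_pdf v)%:E).
  apply/measurable_EFinP; apply: measurable_funM; first exact: measurable_indic.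
  exact: measurable_inv_gauss_pdf.
have Aw0 v : (0 <= (\1_A v * inv_gauss_pdf v)%:E)%E.
  by rewrite lee_fin mulr_ge0// ltW// inv_gauss_pdf_gt0.
rewrite (ge0_integral_gaussS _ mAw Aw0).
pose F (z : R * 'rV[R]_d) := (\1_A (cons_row z) * inv_gauss_pdf (cons_row z))%:E.
have mF : measurable_fun setT F by exact: (measurableT_comp mAw (@measurable_cons_row R d)).
have F0 z : (0 <= F z)%E by exact: Aw0.
have mI := measurable_gauss_inner s mF F0.
have I0 x : (0 <= \int[gaussP d s]_v F (x, v))%E by apply: integral_ge0.
rewrite (ge0_integral_normal1 s mI I0).
rewrite /lebesgue_row /= /pushforward /product_measure1.
apply: eq_integral => x _ /=.
have mAx : measurable (xsection (@cons_row R d @^-1` A) x).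
  apply: measurable_xsection; rewrite -[X in measurable X]setTI.
  exact: (measurable_cons_row _ mA).
rewrite -/(lebesgue_row R d) (IH _ mAx).
have mFx : measurable_fun setT (fun v => F (x, v)).
  apply: (measurableT_comp mF (_ : measurable_fun setT (fun v : 'rV[R]_d => (x, v)))).
  by apply: measurable_fun_pair; [exact: measurable_cst|exact: measurable_id].
have p0E : (0 <= (pdf1 s x)%:E)%E by rewrite lee_fin pdf1_ge0.
rewrite -(ge0_integralZr _ measurableT mFx (fun v _ => F0 _) p0E).
apply: eq_integral => v _; rewrite /F -EFinM -mulrA inv_gauss_pdf_cons.
congr (_ * _)%:E; rewrite !indicE; congr (nat_of_bool _)%:R.
by apply/idP/idP => /set_mem H; apply/mem_set; move: H; rewrite /xsection /= inE.
Qed.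

Lemma integral_lebesgue_row d (f : 'rV[R]_d -> R) (A : set 'rV[R]_d) :
  measurable_fun setT f -> (forall x, 0 <= f x) -> measurable A ->
  (\int[lebesgue_row R d]_(x in A) (f x)%:E =
   \int[gaussP d s]_(x in A) (f x * inv_gauss_pdf x)%:E)%E.
Proof.
move=> mf f0 mA.
have w0 v := ltW (@inv_gauss_pdf_gt0 d v).
have mw := @measurable_inv_gauss_pdf d.
transitivity (\int[mdensity (gaussP d s) mw w0]_(x in A) (f x)%:E)%E.
  apply: eq_set_fun_integral => B mB; apply: etrans (lebesgue_rowE mB) _.
  rewrite /mdensity/= /density_measure [RHS]integral_mkcond.
  apply: eq_integral => v _; rewrite patchE indicE; case: ifPn => vB.
    by rewrite mul1r.
  by rewrite mul0r.
rewrite integral_mkcond.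
have mfA : measurable_fun setT ((fun x => (f x)%:E) \_ A).
  by apply/(measurable_restrictT _ mA); apply/measurable_EFinP; exact: measurable_funTS.
have fA0 x : (0 <= ((fun x => (f x)%:E) \_ A) x)%E.
  by rewrite patchE; case: ifP => // _; rewrite lee_fin.
rewrite (ge0_integral_density (gaussP d s) mw w0 mfA fA0) [RHS]integral_mkcond.
apply: eq_integral => x _; rewrite !patchE; case: ifP => _; first by rewrite EFinM.
by rewrite mul0e.
Qed.

End lebesgue_gauss.

(** * Gaussians charge open sets *)

Section gauss_positive.
Context {R : realType}.
Variable s : R.
Hypothesis s0 : 0 < s.

Definition tent1 (e y x : R) : R := Num.max 0 (e - `|y - x|).

Definition tent d (e : R) (y v : 'rV[R]_d) : R :=
  \prod_(i < d) tent1 e (y ord0 i) (v ord0 i).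

Lemma tent1_ge0 e y x : 0 <= tent1 e y x.
Proof. by rewrite le_max lexx. Qed.

Lemma tent_ge0 d e (y v : 'rV[R]_d) : 0 <= tent e y v.
Proof. by apply: prodr_ge0 => i _; exact: tent1_ge0. Qed.

Lemma tent_neq0 d e (y v : 'rV[R]_d) i : tent e y v != 0 ->
  `|y ord0 i - v ord0 i| < e.
Proof.
apply: contraNT; rewrite -leNgt => h; rewrite /tent (bigD1 i)//= /tent1.
have -> : Num.max 0 (e - `|y ord0 i - v ord0 i|) = 0.
  by apply/max_idPl; rewrite subr_le0.
by rewrite mul0r.
Qed.

Lemma measurable_tent1 e y : measurable_fun setT (tent1 e y).
Proof.
apply: measurable_maxr; first exact: measurable_cst.
apply: measurable_funB; first exact: measurable_cst.
apply: (measurableT_comp (@normr_measurable R setT)).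
by apply: measurable_funB; [exact: measurable_cst|exact: measurable_id].
Qed.

Lemma measurable_tent d e (y : 'rV[R]_d) : measurable_fun setT (tent e y).
Proof.
apply: measurable_prod => i _.
exact: (measurableT_comp (measurable_tent1 e (y ord0 i)) (measurable_coord i)).
Qed.

(** On [[y - e/2, y + e/2]] the tent is at least [e / 2] and the density at least its value at
    [|y| + e]. *)
Lemma normal1_tent1_gt0 e y : 0 < e -> (0 < \int[normal1 s]_x (tent1 e y x)%:E)%E.
Proof.
move=> e0.
have mb : measurable_fun setT (fun x => (tent1 e y x)%:E).
  by apply/measurable_EFinP; exact: measurable_tent1.
have b0 x : (0 <= (tent1 e y x)%:E)%E by rewrite lee_fin tent1_ge0.
rewrite (ge0_integral_normal1 s mb b0).
pose c := normal_peak (Num.sqrt s) * expR (- (`|y| + e) ^+ 2 / (2 * s)).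
have c0 : 0 < c by rewrite mulr_gt0 ?expR_gt0// (peak_gt0 s0).
pose I : set (measurableTypeR R) := `[y - e / 2, y + e / 2]%classic.
have mI : measurable I by exact: measurable_itv.
have mIi : measurable_fun setT (fun x : measurableTypeR R => (\1_I x)%:E : \bar R).
  by apply/measurable_EFinP; exact: measurable_indic.
have Ii0 x : [set: measurableTypeR R] x -> (0 <= (\1_I x)%:E :> \bar R)%E.
  by move=> _; rewrite lee_fin.
have ec0 : (0 <= (e / 2 * c)%:E)%E by rewrite lee_fin mulr_ge0 ?divr_ge0// ltW.
apply: (@lt_le_trans _ _ (\int[@lebesgue_measure R]_x ((e / 2 * c)%:E * (\1_I x)%:E))%E).
  rewrite (ge0_integralZl _ measurableT mIi Ii0 ec0).
  have -> : (\int[@lebesgue_measure R]_x (\1_I x)%:E = e%:E)%E.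
    transitivity (@lebesgue_measure R `[y - e / 2, y + e / 2]%classic).
      apply: etrans (integral_indic _ measurableT mI) _.
      by rewrite setIT.
    rewrite lebesgue_measure_itv /= lte_fin.
    have -> : y - e / 2 < y + e / 2 by lra.
    by rewrite -EFinB; congr EFin; field.
  by rewrite -EFinM lte_fin mulr_gt0// mulr_gt0// divr_gt0.
apply: ge0_le_integral.
- exact: measurableT.
- by move=> x xT; rewrite mule_ge0// Ii0.
- by apply: (emeasurable_funM _ mIi); exact: measurable_cst.
- by apply: (emeasurable_funM mb); exact: measurable_pdf1E.
move=> x _; rewrite -!EFinM lee_fin indicE.
case: (boolP (x \in I)) => [|_]; last by rewrite mulr0 mulr_ge0 ?tent1_ge0 ?pdf1_ge0.
rewrite inE /I /= in_itv /= => /andP[xl xu]; rewrite mulr1.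
have h1 : `|y - x| <= e / 2 by rewrite ler_norml; apply/andP; split; lra.
apply: ler_pM; [by rewrite divr_ge0// ltW|exact: ltW| |].
  by rewrite /tent1 le_max; apply/orP; right; lra.
rewrite (pdf1E _ s0) /c ler_wpM2l ?(ltW (peak_gt0 s0))// ler_expR.
apply: ler_wpM2r; first by rewrite invr_ge0 mulr_ge0// ltW.
rewrite lerN2 -(real_normK (num_real x)) ler_sqr ?nnegrE ?addr_ge0 ?(ltW e0)//.
have -> : x = y - (y - x) by ring.
by apply: le_trans (ler_normB _ _) _; lra.
Qed.

Lemma gauss_tent_gt0 d e (y : 'rV[R]_d) : 0 < e ->
  (0 < \int[gaussP d s]_v (tent e y v)%:E)%E.
Proof.
move=> e0; elim: d y => [|d IH] y.
  rewrite (@ge0_integral_gauss0 R s (fun v => (tent e y v)%:E)) /tent big_ord0.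
  by rewrite lte_fin.
have mb : measurable_fun setT (fun v => (tent e y v)%:E).
  by apply/measurable_EFinP; exact: measurable_tent.
have b0 v : (0 <= (tent e y v)%:E)%E by rewrite lee_fin tent_ge0.
rewrite (ge0_integral_gaussS s mb b0).
have mt : measurable_fun setT (fun v => (tent e (tail_row y) v)%:E).
  by apply/measurable_EFinP; exact: measurable_tent.
have t0 v : [set: 'rV[R]_d] v -> (0 <= (tent e (tail_row y) v)%:E)%E.
  by move=> _; rewrite lee_fin tent_ge0.
pose K := (\int[gaussP d s]_v (tent e (tail_row y) v)%:E)%E.
have K0 : (0 <= K)%E by apply: integral_ge0.
suff H : (0 < \int[normal1 s]_x ((tent1 e (y ord0 ord0) x)%:E * K))%E.
  apply: (lt_le_trans H); rewrite le_eqVlt; apply/orP; left; apply/eqP.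
  apply: eq_integral => x _.
  have x0 : (0 <= (tent1 e (y ord0 ord0) x)%:E)%E by rewrite lee_fin tent1_ge0.
  rewrite -(ge0_integralZl _ measurableT mt t0 x0); apply: eq_integral => v _.
  rewrite -EFinM; congr EFin; rewrite /tent big_ord_recl cons_row0; congr (_ * _).
  by apply: eq_bigr => i _; rewrite cons_rowS mxE.
have m1 : measurable_fun setT (fun x => (tent1 e (y ord0 ord0) x)%:E).
  by apply/measurable_EFinP; exact: measurable_tent1.
have b10 (x : measurableTypeR R) : [set: measurableTypeR R] x -> (0 <= (tent1 e (y ord0 ord0) x)%:E)%E.
  by move=> _; rewrite lee_fin tent1_ge0.
rewrite (@ge0_integralZr _ (measurableTypeR R) R _ setT measurableT _ m1 _ b10 K0).
by rewrite mule_gt0//; [exact: normal1_tent1_gt0|exact: IH].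
Qed.

(** Equal integrals give equality almost everywhere. If the functions differed at [y] they would
    differ on a ball around it, and a tent supported there would have Gaussian integral zero. *)
Lemma continuous_gauss_ae_eq d (g1 g2 : 'rV[R]_d -> R) :
  measurable_fun setT g1 -> measurable_fun setT g2 -> continuous g1 -> continuous g2 ->
  (\int[gaussP d s]_v `|(g1 v)%:E| < +oo)%E ->
  (forall A, measurable A ->
    \int[gaussP d s]_(v in A) (g1 v)%:E = \int[gaussP d s]_(v in A) (g2 v)%:E)%E ->
  g1 =1 g2.
Proof.
move=> mg1 mg2 c1 c2 fin H y; apply: contrapT => /eqP ne.
have ig : (gaussP d s).-integrable setT (fun v => (g1 v)%:E).
  by apply/integrableP; split => //; exact/measurable_EFinP.
have mg2E : measurable_fun setT (fun v => (g2 v)%:E) by exact/measurable_EFinP.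
have ae := integral_ae_eq measurableT ig mg2E (fun E _ mE => H E mE).
pose D v := g1 v - g2 v.
have cD : {for y, continuous D} by apply: continuousB; [exact: c1|exact: c2].
have D0 : D y != 0 by rewrite subr_eq0.
have : \forall v \near y, D v != 0.
  have : \forall x \near D y, x != 0 by exact: open_neq.
  exact: cD.
move=> /nbhs_ballP[e /= e0 eD].
(* Balls of the library norm are cubes, which is the shape of the support of the product tent. *)
have h : forall v, tent e y v != 0 -> g1 v != g2 v.
  move=> v bv; rewrite -subr_eq0; apply: eD; split => // i j.
  by rewrite (ord1 i); exact: tent_neq0.
suff : (\int[gaussP d s]_v (tent e y v)%:E = 0)%E.
  by move=> E; have := gauss_tent_gt0 y e0; rewrite E ltxx.
rewrite -[RHS](integral_prob_cst (gaussP d s) 0%E).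
have mb : measurable_fun setT (fun v => (tent e y v)%:E).
  by apply/measurable_EFinP; exact: measurable_tent.
have b0 v : [set: 'rV[R]_d] v -> (0 <= (tent e y v)%:E)%E.
  by move=> _; rewrite lee_fin tent_ge0.
apply: (ge0_ae_eq_integral measurableT mb (measurable_cst _) b0 (fun v _ => lexx _)).
apply: filterS ae => v /= gv _; congr EFin; apply: contrapT => /eqP bv.
have := h v bv; move/eqP; apply; have := gv Logic.I; by case.
Qed.

End gauss_positive.

Section row_continuity.
Context {R : realType} {d : nat}.
Local Notation V := 'rV[R]_d.

Lemma continuous_row_sum n (f : 'I_n -> V -> R) : (forall i, continuous (f i)) ->
  continuous (fun v => \sum_(i < n) f i v).
Proof.
elim: n f => [f _|n IH f cf].
  rewrite (_ : (fun v => _) = cst 0); first exact: cst_continuous.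
  by apply/funext => v; rewrite big_ord0.
rewrite (_ : (fun v => _) = (fun v => f ord0 v + \sum_(i < n) f (lift ord0 i) v)).
  move=> v; apply: continuousD; first exact: cf.
  by apply: IH => i; exact: cf.
by apply/funext => v; rewrite big_ord_recl.
Qed.

Lemma continuous_coord i : continuous (fun v : V => v ord0 i).
Proof. exact: coord_continuous. Qed.

Lemma continuous_nrm2 : continuous (@nrm2 R d).
Proof.
rewrite (_ : @nrm2 R d = (fun v => \sum_(i < d) (v ord0 i * v ord0 i))).
  apply: continuous_row_sum => i v.
  by apply: continuousM; exact: continuous_coord.
by apply/funext => v.
Qed.

Lemma continuous_scale (c : R) : continuous (fun v : V => c *: v).
Proof. exact: scaler_continuous. Qed.

Lemma continuous_inv_gauss_pdf s : continuous (@inv_gauss_pdf R s d).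
Proof.
move=> v; apply: (@continuousM R V (cst ((normal_peak (Num.sqrt s))^-1 ^+ d))
  (fun v => expR (nrm2 v / (2 * s))) v); first exact: cst_continuous.
have c : {for v, continuous (fun v : V => nrm2 v / (2 * s))}.
  by apply: continuousM; [exact: continuous_nrm2|exact: cst_continuous].
exact: (continuous_comp c (@continuous_expR R _)).
Qed.

End row_continuity.

(** * The density of the noisy sample *)

Section density_identification.
Context {R : realType} {d : nat} d' (T : measurableType d') (nu : probability T R).
Local Notation V := 'rV[R]_d.
Variables (xi : T -> V) (r : R).
Hypotheses (mxi : measurable_fun setT xi) (r0 : 0 < r).
Hypothesis xir : forall t, nrm2 (xi t) <= r ^+ 2.

Local Notation Zpost := (obs_mass nu xi).
Local Notation lw := (obs_weight xi).

(** Cauchy-Schwarz in the exponent of the weight, as [|xi| <= r]. Used in both directions it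
    squeezes the partition function and proves its continuity. *)
Lemma Zpost_harnack a U U' : Zpost a U' <= Zpost a U * expR (r * enorm (U' - U)).
Proof.
rewrite /obs_mass mulrC -(expectZ nu _ (bmf_lw mxi r0 xir a U)).
apply: expect_le; [exact: (bmf_lw mxi r0 xir a U')|exact: (bmfZ _ (bmf_lw mxi r0 xir a U))|].
move=> t; rewrite /obs_weight -expRD ler_expR.
have -> : dot (xi t) U' = dot (xi t) (U' - U) + dot (xi t) U by rewrite -dotDr subrK.
have : dot (xi t) (U' - U) <= r * enorm (U' - U).
  apply: (dot_le (ltW r0) (enorm_ge0 _) (xir t)); by rewrite sqr_enorm.
lra.
Qed.

Lemma continuous_Zpost a : continuous (Zpost a).
Proof.
move=> U.
have ce : continuous (fun U' : V => enorm (U' - U)).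
  rewrite (_ : (fun U' => _) = (fun U' => Num.sqrt (nrm2 (U' - U)))); last first.
    by apply/funext => U'; rewrite enormE.
  move=> U'; have c1 : {for U', continuous (fun U' : V => U' - U)}.
    by apply: continuousB; [exact: cvg_id|exact: cst_continuous].
  have c2 := continuous_comp c1 (@continuous_nrm2 R d _).
  exact: (continuous_comp c2 (@sqrt_continuous R _)).
have ck (k : R) : (fun U' : V => Zpost a U * expR (k * enorm (U' - U))) x @[x --> U] --> Zpost a U.
  have : {for U, continuous (fun U' : V => Zpost a U * expR (k * enorm (U' - U)))}.
    apply: continuousM; first exact: cst_continuous.
    have c : {for U, continuous (fun U' : V => k * enorm (U' - U))}.
      by apply: continuousM; [exact: cst_continuous|exact: ce].
    exact: (continuous_comp c (@continuous_expR R _)).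
  have E : Zpost a U * expR (k * enorm (U - U)) = Zpost a U.
    by rewrite subrr enormE /nrm2 dot0l sqrtr0 mulr0 expR0 mulr1.
  by move=> c; rewrite -[X in _ --> X]E; exact: c.
apply: (squeeze_cvgr _ (ck (- r)) (ck r)); near=> U'; apply/andP; split; last exact: Zpost_harnack.
have := Zpost_harnack a U' U.
have -> : enorm (U - U') = enorm (U' - U) by rewrite !enormE -opprB nrm2N.
by rewrite mulNr expRN ler_pdivrMr// expR_gt0.
Unshelve. all: by end_near.
Qed.

(** Cameron-Martin formula with the shift written as [s] times [xi t / s]; averaging the tilting
    factors over [nu] yields the partition function at strength [1 / s]. *)
Lemma gauss_noisy s (f : V -> \bar R) : 0 < s -> measurable_fun setT f ->
  (forall x, 0 <= f x)%E ->
  (\int[nu]_t \int[gaussP d s]_v f (xi t + v)%R =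
   \int[gaussP d s]_v (f v * (Zpost s^-1 (s^-1 *: v))%:E))%E.
Proof.
move=> s0 mf f0.
have mG : measurable_fun setT (fun z : T * V => f z.2 * (lw s^-1 (s^-1 *: z.2)%R z.1)%:E)%E.
  apply: emeasurable_funM; first exact: (measurableT_comp mf measurable_snd).
  apply/measurable_EFinP.
  apply: (measurableT_comp (measurable_lw mxi s^-1)
    (_ : measurable_fun setT (fun z : T * V => (s^-1 *: z.2, z.1)))).
  apply: measurable_fun_pair; last exact: measurable_fst.
  by apply: measurable_rowZ; [exact: measurable_cst|exact: measurable_snd].
have G0 z : (0 <= f z.2 * (lw s^-1 (s^-1 *: z.2)%R z.1)%:E)%E.
  by rewrite mule_ge0// lee_fin ltW// lw_gt0.
transitivity (\int[nu]_t \int[gaussP d s]_v (f v * (lw s^-1 (s^-1 *: v)%R t)%:E))%E.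
  apply: eq_integral => t _.
  have s1 : s != 0 by rewrite gt_eqF.
  have sb : s *: (s^-1 *: xi t) = xi t by rewrite scalerA divff// scale1r.
  transitivity (\int[gaussP d s]_v f (v + s *: (s^-1 *: xi t))%R)%E.
    by apply: eq_integral => v _; congr f; rewrite sb addrC.
  apply: etrans (gauss_shift (s^-1 *: xi t) s0 mf f0) _.
  apply: eq_integral => v _; congr (_ * (expR _)%:E)%E.
  by rewrite dotZl dotZr nrm2Z; field.
rewrite (tonelli_swap nu (gaussP d s) mG G0); apply: eq_integral => v _ /=.
have ml : measurable_fun setT (fun t => (lw s^-1 (s^-1 *: v) t)%:E).
  apply/measurable_EFinP.
  apply: (measurableT_comp (measurable_lw mxi s^-1)
    (_ : measurable_fun setT (fun t : T => (s^-1 *: v, t)))).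
  by apply: measurable_fun_pair; [exact: measurable_cst|exact: measurable_id].
have l0 t : [set: T] t -> (0 <= (lw s^-1 (s^-1 *: v) t)%:E)%E.
  by move=> _; rewrite lee_fin ltW// lw_gt0.
rewrite (ge0_integralZl _ measurableT ml l0 (f0 v)).
by rewrite (expectE nu (bmf_lw mxi r0 xir s^-1 (s^-1 *: v))).
Qed.

(** Relative to [N(0, s I)] both sides are densities of the same law and both are continuous, so
    they agree at every point, as the gradient requires. *)
Lemma density_unique s (p : V -> R) : 0 < s -> (forall x, 0 <= p x) ->
  measurable_fun setT p -> continuous p ->
  (forall A, measurable A ->
    \int[lebesgue_row R d]_(x in A) (p x)%:E =
    \int[nu]_t \int[gaussP d s]_v (\1_A (xi t + v)%R)%:E)%E ->
  forall x, p x * inv_gauss_pdf s x = Zpost s^-1 (s^-1 *: x).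
Proof.
move=> s0 p0 mp cp H x.
have ms : measurable_fun setT (fun v : V => s^-1 *: v).
  by apply: measurable_rowZ; [exact: measurable_cst|exact: measurable_id].
have mZ : measurable_fun setT (fun v : V => Zpost s^-1 (s^-1 *: v)).
  exact: (measurableT_comp (measurable_Zpost nu mxi s^-1) ms).
have Z0 v : (0 <= (Zpost s^-1 (s^-1 *: v))%:E)%E.
  by rewrite lee_fin ltW// (Zpost_gt0 nu mxi r0 xir).
apply/esym; move: x; apply: (continuous_gauss_ae_eq s0 mZ).
- by apply: (measurable_funM mp); exact: measurable_inv_gauss_pdf.
- move=> v.
  exact: (continuous_comp (@continuous_scale R d s^-1 v) (@continuous_Zpost s^-1 _)).
- move=> v; apply: continuousM; [exact: cp|exact: continuous_inv_gauss_pdf].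
- suff -> : (\int[gaussP d s]_v `|(Zpost s^-1 (s^-1 *: v))%:E| = 1)%E by rewrite ltry.
  have E1 : (\int[nu]_t \int[gaussP d s]_v (cst 1%E (xi t + v)%R) = 1)%E.
    rewrite -[RHS](integral_prob_cst nu); apply: eq_integral => t _.
    exact: (integral_prob_cst (gaussP d s) 1%E).
  apply: etrans E1; apply: etrans (esym (gauss_noisy s0 (measurable_cst 1%E) (fun=> lee01))).
  by apply: eq_integral => v _; rewrite gee0_abs// [RHS]mul1e.
move=> A mA; rewrite -(integral_lebesgue_row s0 mp p0 mA) (H _ mA).
have mi : measurable_fun setT (fun v : V => (\1_A v)%:E : \bar R).
  by apply/measurable_EFinP; exact: measurable_indic.
rewrite (gauss_noisy s0 mi); last by move=> v; rewrite lee_fin.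
rewrite integral_mkcond; apply: eq_integral => v _; rewrite patchE indicE.
by case: ifP => _; rewrite ?mul1e ?mul0e.
Qed.

End density_identification.

(** * Tweedie's formula *)

Section score_density.
Context {R : realType} {d : nat} d' (T : measurableType d') (nu : probability T R).
Local Notation V := 'rV[R]_d.
Variables (xi : T -> V) (r : R).
Hypotheses (mxi : measurable_fun setT xi) (r0 : 0 < r).
Hypothesis xir : forall t, nrm2 (xi t) <= r ^+ 2.

Local Notation Zpost := (obs_mass nu xi).
Local Notation lw := (obs_weight xi).

Lemma derive_line (f : V -> R) (x v : V) (df : R) :
  is_derive (0 : R) (1 : R) (fun h => f (h *: v + x)) df -> 'D_v f x = df.
Proof.
move=> H; rewrite -(@derive_val _ _ _ _ _ _ _ H) /derive.
suff -> : (fun h : R => h^-1 *: ((f \o shift x) (h *: v) - f x)) =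
    (fun h : R => h^-1 *: (((fun h => f (h *: v + x)) \o shift (0 : R)) (h *: (1 : R)) -
      f ((0 : R) *: v + x))) by [].
by apply/funext => h /=; rewrite scale0r add0r addr0 -[h *: (1 : R)]/(h * 1) mulr1.
Qed.

Lemma dot_delta i (y : V) : dot (delta_mx ord0 i) y = y ord0 i.
Proof.
rewrite /dot (bigD1 i)//= mxE !eqxx mul1r big1 ?addr0// => j ji.
by rewrite mxE eqxx (negbTE ji) mul0r.
Qed.

Lemma is_derive_line_energy s (x v : V) : s != 0 ->
  is_derive (0 : R) (1 : R) (fun h : R => nrm2 (h *: v + x) / (2 * s)) (dot v x / s).
Proof.
move=> s0.
rewrite (_ : (fun h => _) = (fun h : R => (h * h * nrm2 v + h * (2 * dot v x) + nrm2 x) / (2 * s))).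
  set b := dot v x; set a := nrm2 v; set c := nrm2 x.
  by apply: is_derive_eq; rewrite /GRing.scale /=; field.
by apply/funext => h; rewrite nrm2D nrm2Z dotZl; congr (_ / _); ring.
Qed.

(** [ln p] is [ln Zpost] at [x / s] minus [nrm2 x / (2 s)] minus a constant. The logarithmic
    derivative of the partition function in a direction [w] is the posterior mean tested against
    [w]. *)
Lemma grad_ln_density s (p : V -> R) x : 0 < s ->
  (forall x, p x * inv_gauss_pdf s x = Zpost s^-1 (s^-1 *: x)) ->
  grad (fun x => ln (p x)) x = score nu xi s x.
Proof.
move=> s0 H; apply/rowP => i; rewrite /grad mxE.
have s1 : s != 0 by rewrite gt_eqF.
pose v : V := delta_mx ord0 i.
apply: derive_line; rewrite -/v.
pose U := s^-1 *: x; pose w := s^-1 *: v.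
pose K := (normal_peak (Num.sqrt s))^-1 ^+ d.
have K0 : 0 < K by rewrite exprn_gt0// invr_gt0 (peak_gt0 s0).
have lnp h : ln (p (h *: v + x)) =
    ln (Zpost s^-1 (U + h *: w)) - (nrm2 (h *: v + x) / (2 * s) + ln K).
  have -> : U + h *: w = s^-1 *: (h *: v + x).
    by rewrite scalerDr addrC /w !scalerA mulrC.
  have I0 := inv_gauss_pdf_gt0 s0 (h *: v + x).
  have -> : p (h *: v + x) = Zpost s^-1 (s^-1 *: (h *: v + x)) / inv_gauss_pdf s (h *: v + x).
    by rewrite -H mulfK// gt_eqF.
  rewrite ln_div ?posrE//; last exact: (Zpost_gt0 nu mxi r0 xir).
  by rewrite /inv_gauss_pdf -/K lnM ?posrE ?expR_gt0// expRK [ln K + _]addrC.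
rewrite (_ : (fun h => _) = (fun h => ln (Zpost s^-1 (U + h *: w)) -
    (nrm2 (h *: v + x) / (2 * s) + ln K))); last by apply/funext.
have Z0 := Zpost_gt0 nu mxi r0 xir s^-1 U.
have dZ := is_derive_Zpost nu mxi r0 xir s^-1 U w 0.
have dl : is_derive (Zpost s^-1 (U + (0 : R) *: w)) (1 : R) (@ln R) (Zpost s^-1 U)^-1.
  by rewrite scale0r addr0; exact: is_derive1_ln.
have dc := is_derive1_comp dl dZ.
have dE := is_derive_line_energy x v s1.
have -> : score nu xi s x ord0 i = (Zpost s^-1 U)^-1 *
    expect nu (fun t => dot w (xi t) * lw s^-1 (U + (0 : R) *: w) t) - (dot v x / s + 0).
  have -> : score nu xi s x ord0 i = dot w (mp nu xi s^-1 U) - dot v x / s.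
    rewrite /score -/U; move: (mp _ _ _ _) => m.
    by rewrite !mxE /w dotZl !dot_delta; ring.
  rewrite addr0; congr (_ - _); rewrite (dot_mp nu mxi r0 xir).
  by rewrite (pexpE nu mxi r0 xir _ _ (bmf_dot mxi r0 xir w)) mulrC scale0r addr0.
exact: is_deriveB.
Qed.

End score_density.

(** * From almost sure hypotheses to a bounded sample *)

Section bounded_input.
Context {R : realType} {d : nat} dO (Omega : measurableType dO) (P : probability Omega R).
Local Notation V := 'rV[R]_d.

Lemma probability_ae_eq (Y Y' : Omega -> V) A : measurable_fun setT Y ->
  measurable_fun setT Y' -> {ae P, forall w, Y w = Y' w} -> measurable A ->
  P (Y @^-1` A) = P (Y' @^-1` A).
Proof.
move=> mY mY' YY' mA.
have mi (Y0 : Omega -> V) : measurable_fun setT Y0 ->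
    measurable_fun setT (fun w => (\1_A (Y0 w))%:E : \bar R).
  move=> mY0; apply/measurable_EFinP.
  have mI : measurable_fun setT (fun v : V => \1_A v : R) by exact: measurable_indic.
  exact: (measurableT_comp mI mY0).
have iE (Y0 : Omega -> V) : measurable_fun setT Y0 ->
    P (Y0 @^-1` A) = (\int[P]_w (\1_A (Y0 w))%:E)%E.
  move=> mY0; have mp : measurable (Y0 @^-1` A).
    by rewrite -[X in measurable X]setTI; exact: mY0.
  by apply/esym; apply: etrans (integral_indic P measurableT mp) _; rewrite setIT.
rewrite (iE _ mY) (iE _ mY'); apply: (ae_eq_integral _ _ measurableT (mi _ mY) (mi _ mY')).
by apply: filterS YY' => w /= -> _.
Qed.

(** The posterior calculus asks for [|xi| <= r] at every point, so [X] is set to 0 on the null set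
    where the bound fails. *)
Lemma bounded_version (X : Omega -> V) (r : R) : 0 < r -> measurable_fun setT X ->
  {ae P, forall w, enorm (X w) <= r} ->
  exists xi : Omega -> V, [/\ measurable_fun setT xi,
    forall w, nrm2 (xi w) <= r ^+ 2 & {ae P, forall w, X w = xi w}].
Proof.
move=> r0 mX Xr; exists (fun w => if nrm2 (X w) <= r ^+ 2 then X w else 0); split.
- apply: (measurable_fun_ifT _ mX (measurable_cst _)).
  by apply: measurable_fun_ler; [exact: measurable_nrm2|exact: measurable_cst].
- by move=> w; case: ifP => // _; rewrite /nrm2 dot0l sqr_ge0.
apply: filterS Xr => w; rewrite enormE => Xw.
have -> // : nrm2 (X w) <= r ^+ 2.
by rewrite -(sqr_sqrtr (nrm2_ge0 (X w))) ler_sqr ?nnegrE// ltW.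
Qed.

(** At strength 0 and state 0 all weights are 1, so the posterior is the prior and its mean is that
    of [X]. *)
Lemma mean_zero_mp (X xi : Omega -> V) (r : R) : 0 < r -> measurable_fun setT X ->
  measurable_fun setT xi -> (forall w, nrm2 (xi w) <= r ^+ 2) ->
  {ae P, forall w, X w = xi w} ->
  (forall i, 'E_P[fun w => X w ord0 i] = 0)%E -> mp P xi 0 0 = 0.
Proof.
move=> r0 mX mxi xir Xxi EX; apply/rowP => i; rewrite !mxE.
transitivity (expect P (fun w => xi w ord0 i)).
  rewrite /pexp; congr (expect _ _); apply/funext => w.
  by rewrite /post_weight /obs_weight dot0r !mul0r subrr expR0 Zpost00 divr1 mulr1.
apply: EFin_inj; rewrite -(expectE P (bmf_coord mxi r0 xir i)) -[RHS](EX i) unlock.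
have mc (Y : Omega -> V) : measurable_fun setT Y ->
    measurable_fun setT (fun w => (Y w ord0 i)%:E).
  by move=> mY; apply/measurable_EFinP; exact: (measurableT_comp (measurable_coord i) mY).
apply/esym; apply: (ae_eq_integral _ _ measurableT (mc _ mX) (mc _ mxi)).
by apply: filterS Xxi => w /= -> _.
Qed.

Lemma law_sum (X Y xi : Omega -> V) (s : R) (A : set V) : measurable_fun setT X ->
  measurable_fun setT Y -> measurable_fun setT xi -> {ae P, forall w, X w = xi w} ->
  (forall B C, measurable B -> measurable C ->
    P (X @^-1` B `&` Y @^-1` C) = P (X @^-1` B) * gaussP d s C)%E ->
  measurable A ->
  (P ((fun w => X w + Y w)%R @^-1` A) =
   \int[P]_w \int[gaussP d s]_v (\1_A (xi w + v)%R)%:E)%E.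
Proof.
move=> mX mY mxi Xxi indep mA.
have mXY : measurable_fun setT (fun w => (X w, Y w)) by exact: measurable_fun_pair.
have mS : measurable_fun setT (fun z : V * V => z.1 + z.2).
  exact: (measurable_rowD measurable_fst measurable_snd).
pose D := [set z : V * V | A (z.1 + z.2)].
have mD : measurable D by rewrite -[X in measurable X]setTI; exact: mS.
have E : (plaw mXY P D = 1%:E * (plaw mX P \x gaussP d s) D)%E.
  apply: product_scale_unique => // B C mB mC.
  by rewrite mul1e -indep.
transitivity ((plaw mX P \x gaussP d s) D)%E; first by rewrite -[RHS]mul1e -E.
have mF : measurable_fun setT (fun z : V * V => (\1_A (z.1 + z.2)%R)%:E : \bar R).
  apply/measurable_EFinP.
  have mI : measurable_fun setT (fun v : V => \1_A v : R) by exact: measurable_indic.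
  exact: (measurableT_comp mI mS).
have F0 (z : V * V) : (0 <= (\1_A (z.1 + z.2)%R)%:E :> \bar R)%E by rewrite lee_fin.
transitivity (\int[(plaw mX P \x gaussP d s)%E]_z (\1_A (z.1 + z.2)%R)%:E)%E.
  by apply/esym; apply: etrans (integral_indic _ measurableT mD) _; rewrite setIT.
rewrite (tonelli_prod (plaw mX P) (gaussP d s) mF F0).
have mI := measurable_tonelli (gaussP d s) mF F0.
have I0 x : (0 <= \int[gaussP d s]_v (\1_A (x + v)%R)%:E)%E.
  by apply: integral_ge0 => v _; rewrite lee_fin.
rewrite (ge0_integral_plaw mX P mI I0).
apply: (ae_eq_integral _ _ measurableT (measurableT_comp mI mX) (measurableT_comp mI mxi)).
by apply: filterS Xxi => w /= -> _.
Qed.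

End bounded_input.

Section wasserstein.
Context {R : realType} {d : nat}.
Local Notation V := 'rV[R]_d.

Lemma W2_le (mu nu : set V -> \bar R) (pi : probability (V * V)%type R) (K : R) : 0 <= K ->
  coupling mu nu pi -> (\int[pi]_z (nrm2 (z.1 - z.2))%:E <= (K ^+ 2)%:E)%E ->
  (W2 mu nu <= K%:E)%E.
Proof.
move=> K0 pic cost; apply: (@le_trans _ _ ((\int[pi]_z (enorm (z.1 - z.2) ^+ 2)%:E) `^ 2^-1)%E).
  by apply: ereal_inf_lbound; exists pi.
under eq_integral do rewrite sqr_enorm.
have i0 : (0 <= \int[pi]_z (nrm2 (z.1 - z.2))%:E)%E.
  by apply: integral_ge0 => z _; rewrite lee_fin nrm2_ge0.
rewrite poweR12_sqrt//; move: i0 cost; case: (\int[pi]_z _)%E => [c| |] //=.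
rewrite !lee_fin => c0 cK; rewrite -[leRHS]ger0_norm// -sqrtr_sqr.
exact: ler_wsqrtr.
Qed.

End wasserstein.

Section forward_process.
Context {R : realType} {d : nat} dO (Omega : measurableType dO) (P : probability Omega R).
Local Notation V := 'rV[R]_d.
Variables (X : {RV P >-> V}) (B : R -> {RV P >-> V}) (p : R -> V -> R) (r : R)
  (xi : Omega -> V).
Hypotheses (r0 : 0 < r) (mxi : measurable_fun setT xi)
  (xir : forall w, nrm2 (xi w) <= r ^+ 2) (Xxi : {ae P, forall w, X w = xi w})
  (BM : brownian_motion B) (indep : independent_of_process X B)
  (dens : forall t : R, 0 < t ->
     has_density P (fun w => X w + B t w) (p t) /\ continuous (p t)).

(** [B t] agrees with the increment [B t - B 0] outside a null set. *)
Lemma brownian_marginal t C : 0 < t -> measurable C -> P (B t @^-1` C) = gaussP d t C.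
Proof.
move=> t0 mC; have [B0 _ BL _] := BM.
have mB u : measurable_fun setT (B u) by exact: measurable_funPT.
have mBB : measurable_fun setT (fun w => B t w - B 0 w) by exact: measurable_rowB.
have := BL 0 t (lexx 0) t0 C mC; rewrite subr0 gaussianE => <-.
apply: (probability_ae_eq (mB t) mBB _ mC).
by apply: filterS B0 => w ->; rewrite subr0.
Qed.

Lemma score_forward t x : 0 < t -> grad (fun x => ln (p t x)) x = score P xi t x.
Proof.
move=> t0; have [[p0 mp law] cp] := dens t0.
apply: (grad_ln_density mxi r0 xir _ t0) => y.
apply: (density_unique mxi r0 xir t0 p0 mp cp) => A mA.
have mX : measurable_fun setT X by exact: measurable_funPT.
have mB : measurable_fun setT (B t) by exact: measurable_funPT.
rewrite -(law A mA); apply: (law_sum mX mB mxi Xxi _ mA).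
move=> D C mD mC; rewrite -(brownian_marginal t0 mC).
(* Cylinders over the single time [t] suffice to separate [X] from [B t]. *)
have := indep (A := D) (n := 1%N) (t := fun=> t) (C := fun=> C) mD (fun=> ltW t0) (fun=> mC).
have -> : \bigcap_(i : 'I_1) (B t @^-1` C) = B t @^-1` C.
  by apply/seteqP; split => w; [move=> H; exact: (H ord0 Logic.I)|move=> H i _; exact: H].
exact.
Qed.

End forward_process.

Lemma coupling_of_integrals (R : realType) (d : nat) d1 d2 (S1 : measurableType d1)
    (S2 : measurableType d2) (P1 : probability S1 R) (P2 : probability S2 R)
    (xi : S1 -> 'rV[R]_d) (Y : S2 -> 'rV[R]_d) (mu nu : set 'rV[R]_d -> \bar R)
    (pi : probability ('rV[R]_d * 'rV[R]_d)%type R) :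
  measurable_fun setT xi -> measurable_fun setT Y ->
  (forall A, measurable A -> P1 (xi @^-1` A) = mu A) ->
  (forall A, measurable A -> P2 (Y @^-1` A) = nu A) ->
  (forall f, measurable_fun setT f -> (forall x, 0 <= f x)%E ->
    (\int[pi]_z f z.1 = \int[P1]_t f (xi t))%E) ->
  (forall f, measurable_fun setT f -> (forall x, 0 <= f x)%E ->
    (\int[pi]_z f z.2 = \int[P2]_t f (Y t))%E) ->
  coupling mu nu pi.
Proof.
move=> mxi mY muE nuE H1 H2.
have mI (A : set 'rV[R]_d) : measurable A -> measurable_fun setT (fun x => (\1_A x)%:E : \bar R).
  by move=> mA; apply/measurable_EFinP; exact: measurable_indic.
have I0 (A : set 'rV[R]_d) x : (0 <= (\1_A x)%:E :> \bar R)%E by rewrite lee_fin.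
have pre dS (S : measurableType dS) (m : probability S R) (f : S -> 'rV[R]_d) A :
    measurable_fun setT f -> measurable A -> (\int[m]_w (\1_A (f w))%:E = m (f @^-1` A))%E.
  move=> mf mA; have mfA : measurable (f @^-1` A).
    by rewrite -[X in measurable X]setTI; exact: mf.
  by apply: etrans (integral_indic m measurableT mfA) _; rewrite setIT.
split=> A mA.
- rewrite -(muE A mA) -(pre _ _ P1 _ _ mxi mA) -(H1 _ (mI A mA) (I0 A)).
  rewrite (pre _ _ pi _ _ measurable_fst mA); congr (pi _).
  by apply/seteqP; split => z //= [].
- rewrite -(nuE A mA) -(pre _ _ P2 _ _ mY mA) -(H2 _ (mI A mA) (I0 A)).
  rewrite (pre _ _ pi _ _ measurable_snd mA); congr (pi _).
  by apply/seteqP; split => z //= [].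
Qed.

Theorem proposition13 (R : realType) (d : nat) (mu : probability 'rV[R]_d R) :
  exists T0 : R,
  forall (dO : measure_display) (Omega : measurableType dO)
    (P : probability Omega R) (X : {RV P >-> 'rV[R]_d})
    (B : R -> {RV P >-> 'rV[R]_d}) (p : R -> 'rV[R]_d -> R) (r : R),
    has_law P X mu ->
    0 < r ->
    {ae P, forall w, enorm (X w) <= r} ->
    (forall i : 'I_d, 'E_P[fun w => X w ord0 i] = 0)%E ->
    brownian_motion B ->
    independent_of_process X B ->
    (forall t : R, 0 < t ->
       has_density P (fun w => X w + B t w) (p t) /\ continuous (p t)) ->
  forall (T eps : R) (N : nat),
    T0 <= T -> 0 < eps -> (1 <= N)%N -> eps < T ->
    let h := (T - eps) / N%:R in
    h <= eps -> eps <= r ^+ 2 ->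
  forall (dS : measure_display) (S : measurableType dS)
    (Q : probability S R) (Xhat Z : nat -> {RV Q >-> 'rV[R]_d}),
    has_law Q (Xhat 0%N) (gaussian d T) ->
    (forall n, (1 <= n <= N)%N -> has_law Q (Z n) (gaussian d h)) ->
    mutually_independent Q N.+1
      (fun n => if n is 0%N then Xhat 0%N else Z n) ->
    (forall n w, (1 <= n <= N)%N ->
       Xhat n w = Xhat n.-1 w
         + h *: grad (fun x => ln (p (T - n.-1%:R * h) x)) (Xhat n.-1 w)
         + Z n w) ->
  (W2 (distribution P X) (distribution Q (Xhat N)) <=
   (Num.sqrt (d%:R * eps)
    + 2 * eps / T `^ (3 / 2) * expR (r ^+ 2 / eps) * r ^+ 2
    + Num.sqrt (2 * d%:R / 3) * (r ^+ 2 / eps `^ (3 / 2))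
        * expR (r ^+ 2 / eps) * h)%:E)%E.
Proof.
(* The threshold can be 0 because the initial coupling costs [3/4 r^4 / T] for every positive
   [T]. *)
exists 0 => dO Omega P X B p r _ r0 Xr EX BM indep dens T eps N _ e0 N1 eT h he er
  dS S Q Xhat Z X0 Zlaw mind XS.
have NR : N%:R != 0 :> R by rewrite pnatr_eq0 -lt0n.
have h0 : 0 < h by rewrite divr_gt0 ?subr_gt0// ltr0n.
have TE : T = eps + N%:R * h by rewrite /h; field.
have T0 : 0 < T := lt_trans e0 eT.
have mX : measurable_fun setT X by exact: measurable_funPT.
have mXh n : measurable_fun setT (Xhat n) by exact: measurable_funPT.
have mZ n : measurable_fun setT (Z n) by exact: measurable_funPT.
set A1 := Num.sqrt (d%:R * eps); set A2 := 2 * eps / _ * _ * _; set A3 := _ * h.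
have A10 : 0 <= A1 by exact: sqrtr_ge0.
have A20 : 0 <= A2.
  apply: mulr_ge0; last exact: sqr_ge0.
  apply: mulr_ge0; last exact: expR_ge0.
  by apply: divr_ge0; [rewrite mulr_ge0// ltW|exact: powR_ge0].
have A30 : 0 <= A3.
  apply: mulr_ge0 _ (ltW h0); apply: mulr_ge0; last exact: expR_ge0.
  apply: mulr_ge0; first exact: sqrtr_ge0.
  by apply: divr_ge0; [exact: sqr_ge0|exact: powR_ge0].
have K0 : 0 <= A1 + A2 + A3 by rewrite !addr_ge0.
(* In dimension 0 all distances vanish and the product coupling does; the weight in [posterior_draw]
   needs [d > 0]. *)
have [d0|d0] := posnP d.
  pose pi : probability ('rV[R]_d * 'rV[R]_d)%type R := (plaw mX P \x plaw (mXh N) Q)%E.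
  apply: (W2_le K0 (pi := pi)).
    split=> A mA.
    - apply: etrans (product_measure1E _ _ mA measurableT) _.
      by rewrite [X in (_ * X)%E]probability_setT mule1.
    - apply: etrans (product_measure1E _ _ measurableT mA) _.
      by rewrite [X in (X * _)%E]probability_setT mul1e.
  under eq_integral.
    move=> z _; have -> : nrm2 (z.1 - z.2) = 0.
      rewrite /nrm2 /dot big1// => i _; have := ltn_ord i.
      by rewrite ltnNge (leq_trans _ (leq0n i))// d0.
    over.
  by rewrite integral_prob_cst lee_fin sqr_ge0.
have [xi [mxi xir Xxi]] := bounded_version r0 mX Xr.
have m0 : mp P xi 0 0 = 0 := mean_zero_mp r0 mX mxi xir Xxi EX.
pose F n := em_mean P xi h (T - n%:R * h).
have mF n : measurable_fun setT (F n) by exact: (measurable_em P mxi r0 xir).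
have tpos n : (n <= N)%N -> 0 < T - n%:R * h.
  move=> nN; apply: (lt_le_trans e0).
  by rewrite TE -addrA lerDl subr_ge0 ler_wpM2r ?(ltW h0)// ler_nat.
have XF n w : (n < N)%N -> Xhat n.+1 w = F n (Xhat n w) + Z n.+1 w.
  move=> nN; rewrite XS ?nN// /F /em_mean /=.
  by rewrite (score_forward r0 mxi xir Xxi BM indep dens _ (tpos n (ltnW nN))).
have indep0 (C : nat -> set 'rV[R]_d) : (forall n, measurable (C n)) ->
  Q (Xhat 0%N @^-1` C 0%N `&` future N Z 0 C) =
    (Q (Xhat 0%N @^-1` C 0%N) * (future_prob Q N Z 0 C)%:E)%E.
  move=> mC; rewrite /future /future_prob.
  (* [Y] names the family of [mind], with the starting point at index 0 and the noises at indices 1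
     to [N], so that intersection and product both split off index 0. *)
  have [Y [Y0 YS]] : exists Y : nat -> S -> 'rV[R]_d,
      [/\ Y 0%N = Xhat 0%N, forall k, Y k.+1 = Z k.+1 &
        Q (\bigcap_(k in `I_N.+1) (Y k @^-1` C k)) = (\prod_(k < N.+1) Q (Y k @^-1` C k))%E].
    by eexists; split; last exact: (mind C mC).
  have -> : \bigcap_(k in `I_N.+1) (Y k @^-1` C k) = Xhat 0%N @^-1` C 0%N `&`
      \bigcap_(k in [set k | (0 < k <= N)%N]) (Z k @^-1` C k).
    apply/seteqP; split => w.
      move=> H; split; first by have := H 0%N; rewrite Y0; exact.
      by case=> // k /= kN; have := H k.+1; rewrite YS; apply.
    by move=> [H0 H] [|k] /= kN; [rewrite Y0|rewrite YS; apply: (H k.+1)].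
  rewrite -(big_mkord xpredT (fun k => Q (Y k @^-1` C k))) big_ltn//.
  move=> ->; rewrite Y0; congr (_ * _)%E.
  rewrite (big_morph EFin (@EFinM R) (erefl 1%:E)) !big_nat.
  apply: eq_bigr => -[|k] // _; rewrite YS fineK//; apply: fin_num_measure.
  by rewrite -[X in measurable X]setTI; exact: mZ.
pose J n (f : 'rV[R]_d -> \bar R) := (\int[Q]_w f (Xhat n w))%E.
have J0 f : measurable_fun setT f -> (forall x, 0 <= f x)%E ->
    (J 0%N f = \int[gaussP d (eps + N%:R * h)]_v f v)%E.
  move=> mf f0; rewrite /J -(ge0_integral_plaw (mXh 0%N) Q mf f0).
  apply: eq_measure_integral => A mA _.
  by apply: etrans (X0 A mA) _; rewrite -TE gaussianE.
have JS n f : (n < N)%N -> measurable_fun setT f -> (forall x, 0 <= f x)%E ->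
    J n.+1 f = J n (fun x => \int[gaussP d h]_v
      f (em_mean P xi h (eps + N%:R * h - n%:R * h) x + v)%R)%E.
  move=> nN mf f0; rewrite /J (integral_recursion mXh mZ mF XF indep0 nN mf f0).
  apply: eq_integral => w _; rewrite /F TE; apply: eq_measure_integral => A mA _.
  have nN' : (1 <= n.+1 <= N)%N by [].
  by apply: etrans (Zlaw _ nN' A mA) _; rewrite gaussianE.
have [pi [pi1 pi2 cost]] := sampler_coupling mxi r0 xir d0 e0 h0 he er m0 J0 JS.
apply: (W2_le K0 (pi := pi)).
  apply: (coupling_of_integrals mxi (mXh N) _ _ pi1 pi2) => // A mA.
  by apply/esym; exact: (probability_ae_eq mX mxi Xxi mA).
by move: cost; rewrite -TE -addrA.
Qed.
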